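(* Let $\varphi$ be an $A_N$-positive primitive automorphism of $F_N$ ($N\ge2$). There exists an algorithm able to find all the singularities (of $\varphi$) in a finite number of steps.
   Context: **Words.** $F_N$ ($N\ge2$) is the free group with fixed basis $A_N=\{a_0,\dots,a_{N-1}\}$; its elements are reduced finite words in $A_N\cup A_N^{-1}$. $\partial F_N$ is the set of infinite reduced words $V=V_0V_1\dots$, with $F_N$ acting by left translation; $\partial^2F_N=(\partial F_N\times\partial F_N)\setminus\Delta$ ($\Delta$ the diagonal), with the diagonal action. We write $u*u'$ for a product without cancellation. A word or boundary point is pure positive (pure negative) if it is non-empty and all its letters are in $A_N$ (in $A_N^{-1}$). **Automorphisms.** An automorphism $\varphi$ of $F_N$ is $A_N$-positive if $\varphi(a)$ is pure positive for every $a\in A_N$; such a $\varphi$ is primitive if for some $k\ge1$ every letter of $A_N$ occurs in $\varphi^k(a)$ for every $a\in A_N$. For an automorphism $\psi$ of $F_N$, $\partial^2\psi$ is the induced homeomorphism of $\partial^2F_N$. Put $i_w(u)=w^{-1}uw$ and $\Phi_\infty=\{i_w\circ\varphi^k: w\in F_N,\ k\ge1\}$. **Attracting subshift.** The shift is $S(X,Y)=(Y_0^{-1}X,Y_0^{-1}Y)$; on pairs $(U,V)$ with $U$ pure negative and $V$ pure positive its inverse is $S^{-1}(U,V)=(U_0^{-1}U,U_0^{-1}V)$. Choose $a\in A_N$ and $k\ge1$ with $\varphi^k(a)=p*a*s$, $p,s$ non-empty pure positive; let $X=\lim_n p^{-1}\varphi^k(p^{-1})\cdots\varphi^{nk}(p^{-1})$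 and $Y=\lim_n as\varphi^k(s)\cdots\varphi^{nk}(s)$. The attracting subshift is $\Sigma_\varphi=\overline{\{S^n(X,Y): n\in\mathbb{Z}\}}$ (independent of the choices). **Singularities.** A singularity (of $\varphi$) is a set $\Omega\subset\Sigma_\varphi$ with at least two elements such that: there is $\psi\in\Phi_\infty$ for which all points of $\Omega$ are fixed by $\partial^2\psi$, and for every $h\ge1$ every point of $\Sigma_\varphi$ fixed by $\partial^2\psi^h$ is in $\Omega$; and there are two points $(U,V),(U',V')\in\Omega$ with $V_0\ne V_0'$ or $U_0\ne U_0'$ (or both). *)

(* Defs.v *)
From HB Require Import structures.
From mathcomp Require Import all_boot.
From mathcomp.classical Require Import classical_sets.

Set Implicit Arguments.
Unset Strict Implicit.
Unset Printing Implicit Defensive.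

Local Open Scope classical_set_scope.
Local Open Scope group_scope.

(* [(i, false)] stands for a_i and [(i, true)] for its inverse. *)
Notation letter N := ('I_N * bool)%type.

Definition linv N (x : letter N) : letter N := (x.1, ~~ x.2).

Definition reduced N (s : seq (letter N)) : bool :=
  sorted (fun x y => y != linv x) s.

Record FN (N : nat) : Type :=
  Word { fword :> seq (letter N); fwordP : reduced fword }.
HB.instance Definition _ N := [isSub for @fword N].
HB.instance Definition _ N := [Choice of FN N by <:].

Section FreeGroup.
Variable N : nat.
Implicit Types (x : letter N) (s t r : seq (letter N)) (u v w : FN N).

Definition redcons x s : seq (letter N) :=
  if s is y :: s' then (if y == linv x then s' else x :: s) else [:: x].

Definition reduce s : seq (letter N) := foldr redcons [::] s.

Lemma linvK : involutive (@linv N).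
Proof. by case=> i b; rewrite /linv /= negbK. Qed.

Lemma redcons_reduced x s : reduced s -> reduced (redcons x s).
Proof.
case: s => [|y s] //= ys; case: ifPn => [_|yx] /=; first exact: path_sorted ys.
by rewrite yx.
Qed.

Lemma foldr_reduced s t : reduced t -> reduced (foldr redcons t s).
Proof. by move=> rt; elim: s => //= x s; apply: redcons_reduced. Qed.

Lemma reduce_reduced s : reduced (reduce s).
Proof. exact: foldr_reduced. Qed.

Lemma reduce_id s : reduced s -> reduce s = s.
Proof.
elim: s => //= x s IHs xs; rewrite IHs; last exact: path_sorted xs.
by case: s xs {IHs} => //= y s /andP[/negPf->].
Qed.

Lemma redconsK x s : reduced s -> redcons x (redcons (linv x) s) = s.
Proof.
case: s => [|y s] /= ; first by rewrite eqxx.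
rewrite linvK; case: eqP => [->|_] /=; last by rewrite eqxx.
by case: s => //= z s /andP[/negPf->].
Qed.

Lemma foldr_redcons x s t :
  reduced t -> foldr redcons t (redcons x s) = redcons x (foldr redcons t s).
Proof.
case: s => //= y s rt; case: eqP => [->|] //=.
by rewrite redconsK // foldr_reduced.
Qed.

Lemma foldr_reduce s t :
  reduced t -> foldr redcons t (reduce s) = foldr redcons t s.
Proof. by move=> rt; elim: s => //= x s IHs; rewrite foldr_redcons // IHs. Qed.

Lemma reduce_cat s t : reduce (s ++ t) = foldr redcons (reduce t) s.
Proof. exact: foldr_cat. Qed.

Definition winv s : seq (letter N) := rev (map (@linv N) s).

Lemma winv_reduced s : reduced s -> reduced (winv s).
Proof.
rewrite /winv /reduced rev_sorted sorted_map; apply: sub_sorted => x y.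
by apply: contra => /eqP/(can_inj linvK)->; rewrite linvK.
Qed.

Definition fmul u v : FN N := Word (reduce_reduced (u ++ v)).
Definition fone : FN N := @Word N [::] isT.
Definition finv u : FN N := Word (winv_reduced (fwordP u)).

Lemma fmulA : associative fmul.
Proof.
move=> u v w; apply: val_inj.
suff E r s t : reduce (r ++ reduce (s ++ t)) = reduce (reduce (r ++ s) ++ t).
  exact: E.
rewrite (reduce_cat r) (reduce_cat (reduce _)) reduce_id ?reduce_reduced //.
by rewrite foldr_reduce ?reduce_reduced // reduce_cat foldr_cat.
Qed.

Lemma fmul1g : left_id fone fmul.
Proof. by move=> u; apply: val_inj; rewrite /= reduce_id ?fwordP. Qed.

Lemma fmulg1 : right_id fone fmul.
Proof. by move=> u; apply: val_inj; rewrite /= cats0 reduce_id ?fwordP. Qed.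

Lemma fmulgV u : fmul u (finv u) = fone.
Proof.
suff E t : reduce (t ++ winv t) = [::] by apply: val_inj; apply: E.
elim: t => //= x t IHt; rewrite /winv map_cons rev_cons -cats1 catA.
by rewrite reduce_cat -foldr_reduce // IHt /= eqxx.
Qed.

Lemma finvK : involutive finv.
Proof.
move=> u; apply: val_inj; rewrite /= /winv map_rev revK -map_comp.
by apply: map_id_in => x _; apply: linvK.
Qed.

Lemma fmulVg u : fmul (finv u) u = fone.
Proof. by have := fmulgV (finv u); rewrite finvK. Qed.

End FreeGroup.

HB.instance Definition _ N :=
  isGroup.Build (FN N) (@fmulA N) (@fmul1g N) (@fmulg1 N)
    (@fmulVg N) (@fmulgV N).

Definition gen N (i : 'I_N) : FN N := @Word N [:: (i, false)] isT.

Definition pure_positive N (u : FN N) : bool :=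
  (u != 1) && all (fun x => ~~ x.2) u.
Definition pure_negative N (u : FN N) : bool :=
  (u != 1) && all (fun x => x.2) u.

Definition A_positive N (phi : FN N -> FN N) : Prop :=
  forall i : 'I_N, pure_positive (phi (gen i)).

Definition primitive N (phi : FN N -> FN N) : Prop :=
  exists2 k, 0 < k &
    forall i j : 'I_N, (j, false) \in fword (iter k phi (gen i)).

Definition inner N (w u : FN N) : FN N := w^-1 * u * w.

Definition Phi_inf N (phi : FN N -> FN N) : set (FN N -> FN N) :=
  [set psi | exists w k, 0 < k /\ psi = inner w \o iter k phi].

Record bd (N : nat) : Type :=
  Bd { bdletter :> nat -> letter N;
       bdP : forall n, bdletter n.+1 != linv (bdletter n) }.

Section Boundary.
Variable N : nat.
Implicit Types (x : letter N) (u g : FN N) (V W : bd N).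

Definition lact_fun x V (n : nat) : letter N :=
  if V 0 == linv x then V n.+1 else if n is m.+1 then V m else x.

Lemma lact_subproof x V n : lact_fun x V n.+1 != linv (lact_fun x V n).
Proof.
rewrite /lact_fun; case: ifPn => [_|Vx]; first exact: bdP.
by case: n => [|n] //; apply: bdP.
Qed.

Definition lact x V : bd N := Bd (lact_subproof x V).

(* [lact x] cancels or prepends a letter, so this is left translation. *)
Definition bdact g V : bd N := foldr lact V g.

Definition pref V (n : nat) : seq (letter N) := mkseq V n.

Lemma pref_reduced V n : reduced (pref V n).
Proof.
case: n => [|n] //; apply/(sortedP (V 0)) => i; rewrite size_mkseq => iSn.
by rewrite !nth_mkseq ?bdP // ltnW.
Qed.

Definition prefF V n : FN N := Word (pref_reduced V n).

(* Convergence of a sequence of finite reduced words to a boundary point: any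
   prefix of the limit is eventually a prefix of the terms. *)
Definition tends_to (g : nat -> FN N) V : Prop :=
  forall m, exists n0, forall n, n0 <= n -> prefix (pref V m) (g n).

(* For an automorphism psi, the induced homeomorphism of the boundary, given
   by its graph: it sends V to the limit of the images of the prefixes of V. *)
Definition bdmap (psi : FN N -> FN N) V W : Prop :=
  tends_to (fun n => psi (prefF V n)) W.

End Boundary.

Definition bd2 N : set (bd N * bd N) := [set P | P.1 <> P.2].

Definition fixes N (psi : FN N -> FN N) (P : bd N * bd N) : Prop :=
  bdmap psi P.1 P.1 /\ bdmap psi P.2 P.2.

Definition letterF N (x : letter N) : FN N := @Word N [:: x] isT.

Definition shift N (P : bd N * bd N) : bd N * bd N :=
  let g := (letterF (P.2 0))^-1 in (bdact g P.1, bdact g P.2).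
Definition unshift N (P : bd N * bd N) : bd N * bd N :=
  let g := (letterF (P.1 0))^-1 in (bdact g P.1, bdact g P.2).

Definition shift_orbit N (P : bd N * bd N) : set (bd N * bd N) :=
  [set Q | exists n, Q = iter n (@shift N) P \/ Q = iter n (@unshift N) P].

(* Closure in bd2: pairs of cylinders form a base of the topology. *)
Definition closure2 N (E : set (bd N * bd N)) : set (bd N * bd N) :=
  [set P | bd2 P /\ forall m, exists2 Q, E Q &
             pref Q.1 m = pref P.1 m /\ pref Q.2 m = pref P.2 m].

(* The choices (a_i, k, p, s) and the pair (X, Y) they determine. *)
Definition attracting_pair N (phi : FN N -> FN N) (P : bd N * bd N) : Prop :=
  exists (i : 'I_N) (k : nat) (p s : FN N),
    [/\ 0 < k, pure_positive p, pure_positive s &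
        iter k phi (gen i) = p * gen i * s] /\
    tends_to (fun n => \prod_(0 <= j < n.+1) iter (j * k) phi p^-1) P.1 /\
    tends_to (fun n => gen i * \prod_(0 <= j < n.+1) iter (j * k) phi s) P.2.

(* The closure of the orbit of (X, Y) does not depend on the choices, so the
   union over all of them is the attracting subshift. *)
Definition attracting_subshift N (phi : FN N -> FN N) : set (bd N * bd N) :=
  [set P | exists2 XY, attracting_pair phi XY & closure2 (shift_orbit XY) P].

Definition singularity N (phi : FN N -> FN N) (Omega : set (bd N * bd N)) :
    Prop :=
  [/\ Omega `<=` attracting_subshift phi,
      exists P Q, [/\ Omega P, Omega Q & P <> Q],
      exists2 psi, Phi_inf phi psi &
        (forall P, Omega P -> fixes psi P) /\
        (forall h P, 0 < h -> attracting_subshift phi P ->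
           fixes (iter h psi) P -> Omega P) &
      exists P Q, [/\ Omega P, Omega Q &
        P.2 0 <> Q.2 0 \/ P.1 0 <> Q.1 0]].

(* Finite descriptions of finite sets of pairs of infinite words: [(w, k, l)]
   stands for the pairs (lim_n f^n(u), lim_n f^n(v)), for (u, v) in the list
   [l], where f(x) = w^-1 phi^k(x).  In a valid description, u and v are proper
   prefixes of f(u) and f(v), all these words being pure; since phi is positive,
   the words f^n(u) and f^n(v) are then longer and longer prefixes of their
   limits, and can be computed. *)
Definition sdesc N : Type := (FN N * nat * seq (FN N * FN N))%type.

Definition sdesc_step N (phi : FN N -> FN N) (d : sdesc N) (x : FN N) : FN N :=
  d.1.1^-1 * iter d.1.2 phi x.

Definition proper_prefix (T : eqType) (s t : seq T) : bool :=
  prefix s t && (size s < size t).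

Definition sdesc_valid N (phi : FN N -> FN N) (d : sdesc N) : bool :=
  let f := sdesc_step phi d in
  (0 < d.1.2) &&
  all (fun uv =>
         [&& pure_negative uv.1, pure_negative (f uv.1),
             proper_prefix uv.1 (f uv.1), pure_positive uv.2,
             pure_positive (f uv.2) & proper_prefix uv.2 (f uv.2)]) d.2.

Definition sdesc_points N (phi : FN N -> FN N) (d : sdesc N) :
    set (bd N * bd N) :=
  [set P | exists uv, [/\ uv \in d.2,
     tends_to (fun n => iter n (sdesc_step phi d) uv.1) P.1 &
     tends_to (fun n => iter n (sdesc_step phi d) uv.2) P.2]].

(* Model of computation: while programs over binary trees with one variable (as
   in N. D. Jones, Computability and Complexity from a Programming Perspective,
   up to a combinator syntax); [Leaf] is false, every other tree is true. *)
Inductive tree : Type := Leaf | Node of tree & tree.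

Inductive prog : Type :=
| PId
| PLeaf
| PNode of prog & prog
| PLeft
| PRight
| PComp of prog & prog
| PIf of prog & prog & prog
| PWhile of prog & prog.

Definition lefttree t := if t is Node l _ then l else Leaf.
Definition righttree t := if t is Node _ r then r else Leaf.

(* [runs p x y]: on input x, the program p halts with output y. *)
Inductive runs : prog -> tree -> tree -> Prop :=
| RunId x : runs PId x x
| RunLeaf x : runs PLeaf x Leaf
| RunNode p q x y z : runs p x y -> runs q x z -> runs (PNode p q) x (Node y z)
| RunLeft x : runs PLeft x (lefttree x)
| RunRight x : runs PRight x (righttree x)
| RunComp p q x y z : runs q x y -> runs p y z -> runs (PComp p q) x z
| RunIfTrue b p q x l r y :
    runs b x (Node l r) -> runs p x y -> runs (PIf b p q) x y
| RunIfFalse b p q x y :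
    runs b x Leaf -> runs q x y -> runs (PIf b p q) x y
| RunWhileStop b p x : runs b x Leaf -> runs (PWhile b p) x x
| RunWhileStep b p x l r y z :
    runs b x (Node l r) -> runs p x y -> runs (PWhile b p) y z ->
    runs (PWhile b p) x z.

Lemma runs_det p x y : runs p x y -> forall z, runs p x z -> y = z.
Proof.
elim=> {p x y}.
- by move=> x z H; inversion H.
- by move=> x z H; inversion H.
- move=> p q x y z _ IHp _ IHq t H; inversion H; subst.
  by congr Node; [apply: IHp | apply: IHq].
- by move=> x z H; inversion H.
- by move=> x z H; inversion H.
- move=> p q x y z _ IHq _ IHp t H; inversion H as [| | | | |? ? ? y' ? Hq Hp| | | |].
  by subst; apply: IHp; rewrite (IHq _ Hq).
- move=> b p q x l r y _ IHb _ IHp z H; inversion H; subst; first exact: IHp.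
  by have := IHb _ ltac:(eassumption).
- move=> b p q x y _ IHb _ IHq z H; inversion H; subst; last exact: IHq.
  by have := IHb _ ltac:(eassumption).
- move=> b p x _ IHb z H; inversion H; subst; first by [].
  by have := IHb _ ltac:(eassumption).
- move=> b p x l r y z _ IHb _ IHp _ IHw t H.
  inversion H as [| | | | | | | |? ? ? Hb|? ? ? ? ? y' ? Hb Hp Hw]; subst.
    by have := IHb _ Hb.
  by apply: IHw; rewrite (IHp _ Hp).
Qed.

Definition enc_nat (n : nat) : tree := iter n (Node Leaf) Leaf.
Definition enc_bool (b : bool) : tree := if b then Node Leaf Leaf else Leaf.
Definition enc_pair A B (eA : A -> tree) (eB : B -> tree) (x : A * B) : tree :=
  Node (eA x.1) (eB x.2).
Definition enc_seq A (eA : A -> tree) (s : seq A) : tree :=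
  foldr (fun x t => Node (eA x) t) Leaf s.

Definition enc_letter N : letter N -> tree :=
  enc_pair (fun i : 'I_N => enc_nat i) enc_bool.
Definition enc_word N (u : FN N) : tree := enc_seq (@enc_letter N) u.

(* An endomorphism of F_N is input as the list of the images of the basis. *)
Definition enc_aut N (phi : FN N -> FN N) : tree :=
  enc_seq (@enc_word N) [seq phi (gen i) | i <- enum 'I_N].

Definition enc_sdesc N : sdesc N -> tree :=
  enc_pair (enc_pair (@enc_word N) enc_nat)
    (enc_seq (enc_pair (@enc_word N) (@enc_word N))).

(* Main.v *)
Require Import Defs.
From mathcomp Require Import all_boot zify.
From mathcomp.classical Require Import boolp classical_sets.

(** Some power of [phi] acts on positive words by a substitution [T] whose images
all contain all the letters.  Write [U] and [V] for the two rays of a point of the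
attracting subshift, which are negative and positive.  The point is fixed by the
map induced by [i_w o T^k] when [T^k (U) = w U] and [T^k (V) = w V]; since one of
the two products has no cancellation, [w] is a word of one sign ([fixes_pure]).

Let [w] be positive and not trivial.  The first equation then determines [U], so
the points fixed by the map share [U], and a singularity contains two points
whose rays [V] and [V'] differ at once: [w] is the longest common prefix of
[T^k (V)] and [T^k (V')].  As [phi] is an automorphism, cancellation is bounded
([bounded_cancellation]): for some length [L], the common prefix of [T (V)] and
[T (V')] and the next [L] letters of both behind it only depend on the prefixes of
length [L] of [V] and [V'].  So [T] acts on pairs of words of length [L] with
different first letters, and a singularity gives a periodic pair for this action
on a finite set ([window_fix]).  Conversely a periodic pair gives back [w] and the
two rays, as limits of iterates.  With [K] the factorial of the number of pairs,
the map [i_w o T^K] fixes every periodic point that goes with it.  What remains is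
to decide which words [w v] are factors of the subshift, and the factors of length
at most [m] are reached within as many iterates of [T] as there are words of that
length ([in_langP]).  The pairs found in this way give all the points that a power
of the map fixes, so they form a singularity ([branchings_maximal]).

If [w] is negative, the same applies to the substitution read backwards; [side_subst]
treats the two cases at once.  If [w] is trivial, the points fixed by the map are
determined by their two letters at the origin ([letter_pairs]), and these points
form at most one singularity.

Nothing is missed: a singularity is the set of the points that are fixed by a
power of any of its maps, so two singularities are equal as soon as powers of
their maps are ([singular_unique]), and the word that goes with a periodic pair
does not depend on the singularity it comes from ([branchings_complete]).

The program looks for the power of [phi] and for [L], which are the only unbounded
searches; they succeed because [phi] is primitive and because cancellation is
bounded.  Everything else is built from folds over lists and bounded iteration,
and [computable] is shown to be closed under these. *)

Set Implicit Arguments.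
Unset Strict Implicit.
Unset Printing Implicit Defensive.

(** * Functions computed by while programs *)

Class encoding (A : Type) := encode : A -> tree.

#[local] Instance encoding_bool : encoding bool := enc_bool.
#[local] Instance encoding_nat : encoding nat := enc_nat.
#[local] Instance encoding_pair A B {eA : encoding A} {eB : encoding B} :
  encoding (A * B) := enc_pair eA eB.
#[local] Instance encoding_seq A {eA : encoding A} : encoding (seq A) :=
  enc_seq eA.

(** The program depends on the function only, not on the size [N] of the basis:
this is why the letters that programs handle are natural numbers. *)
Definition computable A B {eA : encoding A} {eB : encoding B} (f : A -> B) :=
  exists p, forall x, runs p (encode x) (encode (f x)).

(** Loops over lists also serve to iterate over a number. *)
Lemma enc_nseq n : enc_nat n = enc_seq enc_bool (nseq n false).
Proof. by elim: n => //= n <-. Qed.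

Section BasicPrograms.
Context {A B X Y : Type} {eA : encoding A} {eB : encoding B}.
Context {eX : encoding X} {eY : encoding Y}.

Lemma cpt_ext (f g : A -> B) : f =1 g -> computable f -> computable g.
Proof. by move=> fg [p Hp]; exists p => x; rewrite -fg. Qed.

Lemma cpt_id : computable (fun x : A => x).
Proof. by exists PId => x; apply: RunId. Qed.

Lemma cpt_comp (f : A -> B) (g : B -> X) :
  computable g -> computable f -> computable (fun a => g (f a)).
Proof.
by case=> pg Hg [pf Hf]; exists (PComp pg pf) => x; apply: RunComp (Hf x) (Hg _).
Qed.

Lemma cpt_const (b : B) : computable (fun _ : A => b).
Proof.
rewrite /computable; elim: (encode b) => [|l [pl Hl] r [pr Hr]].
  by exists PLeaf => x; apply: RunLeaf.
by exists (PNode pl pr) => x; apply: RunNode.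
Qed.

Lemma cpt_pair (f : A -> B) (g : A -> X) :
  computable f -> computable g -> computable (fun a => (f a, g a)).
Proof.
by case=> pf Hf [pg Hg]; exists (PNode pf pg) => x; apply: RunNode.
Qed.

Lemma cpt_fst (f : A -> B * X) : computable f -> computable (fun a => (f a).1).
Proof.
case=> p Hp; exists (PComp PLeft p) => x; apply: RunComp (Hp x) _.
exact: (RunLeft (Node _ _)).
Qed.

Lemma cpt_snd (f : A -> B * X) : computable f -> computable (fun a => (f a).2).
Proof.
case=> p Hp; exists (PComp PRight p) => x; apply: RunComp (Hp x) _.
exact: (RunRight (Node _ _)).
Qed.

Lemma cpt_if (b : A -> bool) (f g : A -> B) :
  computable b -> computable f -> computable g ->
  computable (fun a => if b a then f a else g a).
Proof.
case=> pb Hb [pf Hf] [pg Hg]; exists (PIf pb pf pg) => x.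
by have := Hb x; case: (b x) => Hbx; [apply: RunIfTrue Hbx _ | apply: RunIfFalse].
Qed.

Lemma cpt_cons (f : A -> B) (g : A -> seq B) :
  computable f -> computable g -> computable (fun a => f a :: g a).
Proof.
by case=> pf Hf [pg Hg]; exists (PNode pf pg) => x; apply: RunNode.
Qed.

Lemma cpt_behead (f : A -> seq B) :
  computable f -> computable (fun a => behead (f a)).
Proof.
case=> p Hp; exists (PComp PRight p) => x; apply: RunComp (Hp x) _.
have -> : encode (behead (f x)) = righttree (encode (f x)) by case: (f x).
exact: RunRight.
Qed.

Lemma cpt_head (b : B) (f : A -> seq B) :
  computable f -> computable (fun a => head b (f a)).
Proof.
case=> p Hp; have [q Hq] := cpt_const b.
exists (PIf p (PComp PLeft p) q) => x; have := Hp x; have := Hq x.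
case: (f x) => [|y s] /= Hqx Hpx; first exact: RunIfFalse Hpx Hqx.
by apply: RunIfTrue (Hpx) _; apply: RunComp Hpx _; apply: (RunLeft (Node _ _)).
Qed.

Lemma cpt_S (f : A -> nat) : computable f -> computable (fun a => (f a).+1).
Proof.
case=> p Hp; exists (PNode PLeaf p) => x.
by apply: RunNode (Hp x); apply: RunLeaf.
Qed.

Lemma cpt_pred (f : A -> nat) : computable f -> computable (fun a => (f a).-1).
Proof.
case=> p Hp; exists (PComp PRight p) => x; apply: RunComp (Hp x) _.
have -> : encode (f x).-1 = righttree (encode (f x)) by case: (f x).
exact: RunRight.
Qed.

(** The loop keeps the argument of the function, the accumulator and the part of
the list that remains, and stops when that part is a leaf. *)
Lemma cpt_foldl (l : A -> seq X) (i : A -> B) (g : A -> B -> X -> B) :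
  computable l -> computable i ->
  computable (fun t : A * B * X => g t.1.1 t.1.2 t.2) ->
  computable (fun a => foldl (g a) (i a) (l a)).
Proof.
case=> pl Hl [pi Hi] [pg Hg].
pose body := PNode (PNode (PComp PLeft PLeft)
  (PComp pg (PNode PLeft (PComp PLeft PRight)))) (PComp PRight PRight).
exists (PComp (PComp PRight PLeft)
  (PComp (PWhile PRight body) (PNode (PNode PId pi) pl))) => a.
apply: RunComp (_ : runs _ _ (Node (Node (encode a) _) Leaf)) _; last first.
  apply: RunComp; first exact: RunLeft.
  exact: RunRight.
apply: RunComp.
  by apply: RunNode (Hl a); apply: RunNode (Hi a); apply: RunId.
elim: (l a) (i a) => [|x s IHs] b.
  by apply: RunWhileStop; apply: (RunRight (Node _ _)).
apply: RunWhileStep; first exact: (RunRight (Node _ (Node _ _))).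
  apply: RunNode.
    apply: RunNode; first by apply: RunComp; apply: RunLeft.
    apply: RunComp (Hg (a, b, x)).
    apply: RunNode; first exact: (RunLeft (Node _ _)).
    apply: RunComp; first exact: RunRight.
    exact: (RunLeft (Node _ _)).
  by apply: RunComp; apply: RunRight.
exact: IHs.
Qed.

(** The only loop whose number of rounds is not read off the input, hence the only
one whose termination depends on a hypothesis. *)
Lemma runs_search (t : A -> nat -> bool) :
  computable (fun u : A * nat => t u.1 u.2) ->
  exists p, forall a, (exists n, t a n) ->
    exists2 n, t a n & runs p (encode a) (encode (a, n)).
Proof.
case=> pt Ht.
pose body := PNode PLeft (PNode PLeaf PRight).
pose test := PIf pt PLeaf (PNode PLeaf PLeaf).
exists (PComp (PWhile test body) (PNode PId PLeaf)) => a [n0 tn0].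
pose E : A * nat -> tree := enc_pair eA enc_nat.
suff loop m k : k + m = n0 -> exists2 n, t a n &
    runs (PWhile test body) (E (a, k)) (E (a, n)).
  have [n tn Hn] := loop n0 0 erefl; exists n => //.
  by apply: RunComp Hn; apply: RunNode; [apply: RunId | apply: RunLeaf].
have test_true b : t a b -> runs test (encode (a, b)) Leaf.
  move=> tb; apply: RunIfTrue (RunLeaf _); have := Ht (a, b); rewrite /= tb.
  exact.
elim: m k => [|m IHm] k.
  rewrite addn0 => ->; exists n0 => //.
  by apply: RunWhileStop; apply: test_true.
case tk: (t a k) => Ek.
  by exists k => //; apply: RunWhileStop; apply: test_true.
have [|n tn Hn] := IHm k.+1; first by rewrite addSnnS.
exists n => //; apply: RunWhileStep Hn.
  apply: RunIfFalse; first by have := Ht (a, k); rewrite /= tk.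
  by apply: RunNode; apply: RunLeaf.
apply: RunNode; first exact: (RunLeft (Node _ _)).
by apply: RunNode; [apply: RunLeaf | apply: (RunRight (Node _ _))].
Qed.

End BasicPrograms.

Section LoopPrograms.
Context {A B X Y : Type} {eA : encoding A} {eB : encoding B}.
Context {eX : encoding X} {eY : encoding Y}.

Lemma cpt_iter (n : A -> nat) (i : A -> B) (g : A -> B -> B) :
  computable n -> computable i -> computable (fun t : A * B => g t.1 t.2) ->
  computable (fun a => iter (n a) (g a) (i a)).
Proof.
case=> pn Hn Hi Hg.
(* A number is encoded as the list of its units. *)
have Hl : computable (fun a => nseq (n a) false).
  by exists pn => a; have := Hn a; rewrite [X in runs _ _ X]enc_nseq.
apply: cpt_ext (cpt_foldl (g := fun a b _ => g a b) Hl Hi _).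
  by move=> a; elim: (n a) (i a) => //= m IHm b; rewrite IHm -iterSr.
exact: (cpt_comp Hg (cpt_fst cpt_id)).
Qed.

End LoopPrograms.

Section FoldPrograms.
Context {A B X Y : Type} {eA : encoding A} {eB : encoding B}.
Context {eX : encoding X} {eY : encoding Y}.

Lemma cpt_rev (l : A -> seq X) : computable l -> computable (fun a => rev (l a)).
Proof.
move=> Hl; apply: cpt_ext (cpt_foldl (g := fun _ r x => x :: r) Hl
  (cpt_const [::]) _).
  move=> a; rewrite /rev; elim: (l a) [::] => //=.
exact: cpt_cons (cpt_snd cpt_id) (cpt_snd (cpt_fst cpt_id)).
Qed.

Lemma cpt_size (l : A -> seq X) : computable l -> computable (fun a => size (l a)).
Proof.
move=> Hl; apply: cpt_ext (cpt_foldl (g := fun _ r _ => r.+1) Hl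
  (cpt_const 0) _).
  suff E s m : foldl (fun r (_ : X) => r.+1) m s = size s + m by move=> a;
    rewrite E addn0.
  by elim: s m => //= x s IHs m; rewrite IHs addnS.
exact: cpt_S (cpt_snd (cpt_fst cpt_id)).
Qed.

Lemma cpt_foldr (l : A -> seq X) (i : A -> B) (g : A -> X -> B -> B) :
  computable l -> computable i ->
  computable (fun t : A * B * X => g t.1.1 t.2 t.1.2) ->
  computable (fun a => foldr (g a) (i a) (l a)).
Proof.
move=> Hl Hi Hg.
apply: cpt_ext (cpt_foldl (g := fun a b x => g a x b) (cpt_rev Hl) Hi Hg) => a.
by rewrite foldl_rev.
Qed.

End FoldPrograms.

Section SequencePrograms.
Context {A B X Y : Type} {eA : encoding A} {eB : encoding B}.
Context {eX : encoding X} {eY : encoding Y}.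

Lemma cpt_map (l : A -> seq X) (g : A -> X -> B) :
  computable l -> computable (fun t : A * X => g t.1 t.2) ->
  computable (fun a => map (g a) (l a)).
Proof.
move=> Hl Hg.
apply: cpt_ext (cpt_foldr (g := fun a x r => g a x :: r) Hl (cpt_const [::]) _).
  by move=> a; elim: (l a) => //= x s ->.
apply: cpt_cons; last exact: cpt_snd (cpt_fst cpt_id).
exact: cpt_comp Hg (cpt_pair (cpt_fst (cpt_fst cpt_id)) (cpt_snd cpt_id)).
Qed.

Lemma cpt_filter (l : A -> seq X) (g : A -> X -> bool) :
  computable l -> computable (fun t : A * X => g t.1 t.2) ->
  computable (fun a => filter (g a) (l a)).
Proof.
move=> Hl Hg.
apply: cpt_ext (cpt_foldr (g := fun a x r => if g a x then x :: r else r) Hl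
  (cpt_const [::]) _) => [a|].
  by elim: (l a) => //= x s ->.
apply: cpt_if.
- exact: cpt_comp Hg (cpt_pair (cpt_fst (cpt_fst cpt_id)) (cpt_snd cpt_id)).
- exact: cpt_cons (cpt_snd cpt_id) (cpt_snd (cpt_fst cpt_id)).
- exact: cpt_snd (cpt_fst cpt_id).
Qed.

Lemma cpt_all (l : A -> seq X) (g : A -> X -> bool) :
  computable l -> computable (fun t : A * X => g t.1 t.2) ->
  computable (fun a => all (g a) (l a)).
Proof.
move=> Hl Hg.
apply: cpt_ext (cpt_foldr (g := fun a x r => if g a x then r else false) Hl
  (cpt_const true) _) => [a|].
  by elim: (l a) => //= x s ->.
apply: cpt_if; last exact: cpt_const.
- exact: cpt_comp Hg (cpt_pair (cpt_fst (cpt_fst cpt_id)) (cpt_snd cpt_id)).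
- exact: cpt_snd (cpt_fst cpt_id).
Qed.

Lemma cpt_has (l : A -> seq X) (g : A -> X -> bool) :
  computable l -> computable (fun t : A * X => g t.1 t.2) ->
  computable (fun a => has (g a) (l a)).
Proof.
move=> Hl Hg.
apply: cpt_ext (cpt_foldr (g := fun a x r => if g a x then true else r) Hl
  (cpt_const false) _) => [a|].
  by elim: (l a) => //= x s ->.
apply: cpt_if; first last.
- exact: cpt_snd (cpt_fst cpt_id).
- exact: cpt_const.
- exact: cpt_comp Hg (cpt_pair (cpt_fst (cpt_fst cpt_id)) (cpt_snd cpt_id)).
Qed.

Lemma cpt_cat (l1 l2 : A -> seq X) :
  computable l1 -> computable l2 -> computable (fun a => l1 a ++ l2 a).
Proof.
move=> H1 H2; apply: cpt_ext (cpt_foldr (g := fun _ => cons) H1 H2 _).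
  by move=> a; elim: (l1 a) => //= x s ->.
exact: cpt_cons (cpt_snd cpt_id) (cpt_snd (cpt_fst cpt_id)).
Qed.

Lemma cpt_drop (n : A -> nat) (l : A -> seq X) :
  computable n -> computable l -> computable (fun a => drop (n a) (l a)).
Proof.
move=> Hn Hl.
apply: cpt_ext (cpt_iter (g := fun=> behead) Hn Hl (cpt_behead (cpt_snd cpt_id))).
by move=> a; elim: (n a) (l a) => //= [|m IHm] [|x s] //;
  rewrite -iterS iterSr IHm //= drop_oversize.
Qed.

Lemma cpt_nth (x : X) (l : A -> seq X) (n : A -> nat) :
  computable l -> computable n -> computable (fun a => nth x (l a) (n a)).
Proof.
move=> Hl Hn; apply: cpt_ext (cpt_head x (cpt_drop Hn Hl)) => a.
by rewrite -nth0 nth_drop addn0.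
Qed.

Lemma cpt_sub (m n : A -> nat) :
  computable m -> computable n -> computable (fun a => m a - n a).
Proof.
move=> Hm Hn.
apply: cpt_ext (cpt_iter (g := fun=> predn) Hn Hm (cpt_pred (cpt_snd cpt_id))).
by move=> a; elim: (n a) => [|k IHk] /=; rewrite ?subn0 // IHk subnS.
Qed.

Lemma cpt_add (m n : A -> nat) :
  computable m -> computable n -> computable (fun a => m a + n a).
Proof.
move=> Hm Hn.
apply: cpt_ext (cpt_iter (g := fun=> succn) Hm Hn (cpt_S (cpt_snd cpt_id))).
by move=> a; elim: (m a) => //= k ->.
Qed.

End SequencePrograms.

Section TestPrograms.
Context {A B X Y : Type} {eA : encoding A} {eB : encoding B}.
Context {eX : encoding X} {eY : encoding Y}.

Lemma cpt_leq (m n : A -> nat) :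
  computable m -> computable n -> computable (fun a => m a <= n a).
Proof.
move=> Hm Hn.
apply: cpt_ext (cpt_head (B := bool) true (cpt_map (B := bool)
  (g := fun _ _ => false) (l := fun a => nseq (m a - n a) false) _ _)).
- by move=> a; rewrite map_nseq /leq; case: (_ - _).
- have [p Hp] := cpt_sub Hm Hn; exists p => a.
  by have := Hp a; rewrite [X in runs _ _ X]enc_nseq.
- exact: cpt_const.
Qed.

Lemma cpt_andb (b c : A -> bool) :
  computable b -> computable c -> computable (fun a => b a && c a).
Proof.
move=> Hb Hc; apply: cpt_ext (cpt_if Hb Hc (cpt_const false)) => a.
by case: (b a).
Qed.

Lemma cpt_negb (b : A -> bool) : computable b -> computable (fun a => ~~ b a).
Proof.
move=> Hb; apply: cpt_ext (cpt_if Hb (cpt_const false) (cpt_const true)) => a.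
by case: (b a).
Qed.

End TestPrograms.

Section ArithmeticPrograms.
Context {A X Y : Type} {eA : encoding A} {eX : encoding X} {eY : encoding Y}.

Lemma cpt_eqn (m n : A -> nat) :
  computable m -> computable n -> computable (fun a => m a == n a).
Proof.
move=> Hm Hn; apply: cpt_ext (cpt_andb (cpt_leq Hm Hn) (cpt_leq Hn Hm)) => a.
by rewrite eqn_leq.
Qed.

Lemma cpt_flatten (l : A -> seq (seq X)) :
  computable l -> computable (fun a => flatten (l a)).
Proof.
move=> Hl; apply: cpt_foldr Hl (cpt_const _) _.
exact: cpt_cat (cpt_snd cpt_id) (cpt_snd (cpt_fst cpt_id)).
Qed.

Lemma cpt_take (n : A -> nat) (l : A -> seq X) :
  computable n -> computable l -> computable (fun a => take (n a) (l a)).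
Proof.
move=> Hn Hl; apply: cpt_ext (cpt_rev (cpt_drop
  (cpt_sub (cpt_size Hl) Hn) (cpt_rev Hl))) => a.
rewrite drop_rev revK; case: (leqP (n a) (size (l a))) => H; first by rewrite subKn.
by rewrite (take_oversize (ltnW H)) take_oversize //; lia.
Qed.

Lemma cpt_iota (m n : A -> nat) :
  computable m -> computable n -> computable (fun a => iota (m a) (n a)).
Proof.
move=> Hm Hn.
apply: cpt_ext (cpt_rev (cpt_snd (cpt_iter
  (g := fun _ (t : nat * seq nat) => (t.1.+1, t.1 :: t.2)) Hn
  (cpt_pair Hm (cpt_const [::])) _))) => [a|].
  suff -> : iter (n a) (fun t : nat * seq nat => (t.1.+1, t.1 :: t.2))
    (m a, [::]) = (m a + n a, rev (iota (m a) (n a))) by rewrite revK.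
  elim: (n a) => [|k IHk]; first by rewrite addn0.
  by rewrite iterS IHk -[k.+1]addn1 iotaD rev_cat addnA addn1.
have H1 : computable (fun t : A * (nat * seq nat) => t.2.1).
  exact: cpt_fst (cpt_snd cpt_id).
exact: cpt_pair (cpt_S H1) (cpt_cons H1 (cpt_snd (cpt_snd cpt_id))).
Qed.

End ArithmeticPrograms.

Section EqualityPrograms.
Context {A X Y : Type} {eA : encoding A} {eX : encoding X} {eY : encoding Y}.

Lemma cpt_eqseq (u v : A -> seq nat) :
  computable u -> computable v -> computable (fun a => u a == v a).
Proof.
move=> Hu Hv.
have Hz : computable (fun a => all (fun i => nth 0 (u a) i == nth 0 (v a) i)
    (iota 0 (size (u a)))).
  apply: cpt_all (cpt_iota (cpt_const 0) (cpt_size Hu)) _.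
  apply: cpt_eqn; apply: cpt_nth (cpt_snd cpt_id).
    exact: cpt_comp Hu (cpt_fst cpt_id).
  exact: cpt_comp Hv (cpt_fst cpt_id).
apply: cpt_ext (cpt_andb (cpt_eqn (cpt_size Hu) (cpt_size Hv)) Hz) => a.
apply/andP/eqP => [[/eqP Es /allP Hall]|->]; last by split=> //; apply/allP.
apply: (@eq_from_nth _ 0) => // i iu.
by apply/eqP/Hall; rewrite mem_iota.
Qed.

Lemma cpt_mem (x : A -> nat) (l : A -> seq nat) :
  computable x -> computable l -> computable (fun a => x a \in l a).
Proof.
move=> Hx Hl.
apply: cpt_ext (cpt_has (g := fun a y => y == x a) Hl _) => [a|].
  by rewrite has_pred1.
exact: cpt_eqn (cpt_snd cpt_id) (cpt_comp Hx (cpt_fst cpt_id)).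
Qed.

Lemma cpt_muln (m n : A -> nat) :
  computable m -> computable n -> computable (fun a => m a * n a).
Proof.
move=> Hm Hn; apply: cpt_ext (cpt_iter (g := fun a r => n a + r) Hm
  (cpt_const 0) (cpt_add (cpt_comp Hn (cpt_fst cpt_id)) (cpt_snd cpt_id))) => a.
by elim: (m a) => //= k ->; rewrite mulSn.
Qed.

Lemma cpt_prefix (u v : A -> seq nat) :
  computable u -> computable v -> computable (fun a => prefix (u a) (v a)).
Proof.
move=> Hu Hv; apply: cpt_ext (cpt_eqseq (cpt_take (cpt_size Hu) Hv) Hu) => a.
by rewrite prefixE.
Qed.

End EqualityPrograms.

Section FactorPrograms.
Context {A X Y : Type} {eA : encoding A} {eX : encoding X} {eY : encoding Y}.

Lemma cpt_infix (u v : A -> seq nat) :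
  computable u -> computable v -> computable (fun a => infix (u a) (v a)).
Proof.
move=> Hu Hv; apply: cpt_ext (cpt_has (g := fun a i => prefix (u a) (drop i (v a)))
  (cpt_iota (cpt_const 0) (cpt_S (cpt_size Hv))) _) => [a|].
  apply/hasP/infixP => [[i _ /prefixP[s Es]]|[s [s' Es]]].
    by exists (take i (v a)), s; rewrite -Es cat_take_drop.
  exists (size s); first by rewrite mem_iota Es !size_cat leq0n add0n ltnS leq_addr.
  by rewrite Es drop_size_cat // prefix_prefix.
apply: cpt_prefix; first exact: cpt_comp Hu (cpt_fst cpt_id).
exact: cpt_drop (cpt_snd cpt_id) (cpt_comp Hv (cpt_fst cpt_id)).
Qed.

End FactorPrograms.

Lemma cpt_fact A {eA : encoding A} (n : A -> nat) :
  computable n -> computable (fun a => (n a)`!).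
Proof.
move=> Hn; apply: cpt_ext (cpt_snd (cpt_iter
  (g := fun _ (t : nat * nat) => (t.1.+1, t.1.+1 * t.2)) Hn
  (cpt_const (0, 1)) _)) => [a|].
  suff -> : iter (n a) (fun t : nat * nat => (t.1.+1, t.1.+1 * t.2)) (0, 1)
    = (n a, (n a)`!) by [].
  by elim: (n a) => // k IHk; rewrite iterS IHk.
have H1 : computable (fun t : A * (nat * nat) => t.2.1.+1).
  exact: cpt_S (cpt_fst (cpt_snd cpt_id)).
exact: cpt_pair H1 (cpt_muln H1 (cpt_snd (cpt_snd cpt_id))).
Qed.

(** * Words, substitutions and infinite words *)

Definition sub (s : seq (seq nat)) (x : seq nat) : seq nat :=
  flatten [seq nth [::] s i | i <- x].

Definition inalph (N : nat) (x : seq nat) : bool := all (gtn N) x.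

Definition full (s : seq (seq nat)) : bool :=
  all (fun t => all (fun j => j \in t) (iota 0 (size s))) s.

(** Primitivity with exponent one, which holds after passing to a power. *)
Definition primitive_subst s : bool :=
  [&& 1 < size s, all (inalph (size s)) s & full s].

Definition mirror (s : seq (seq nat)) : seq (seq nat) := map rev s.

Definition starts (x : seq nat) (V : nat -> nat) : Prop := mkseq V (size x) = x.

Fixpoint lcp (x y : seq nat) : seq nat :=
  match x, y with
  | a :: x', b :: y' => if a == b then a :: lcp x' y' else [::]
  | _, _ => [::]
  end.

(** The equation [T^j (V) = w V] between infinite words, tested on the prefixes of
[V], so that no infinite concatenation is needed. *)
Definition fixes_forward s j (w : seq nat) (V : nat -> nat) : Prop :=
  forall m, exists2 y, starts y V & prefix (iter j (sub s) (mkseq V m)) (w ++ y).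

(** The equation [T^j (U) = w U] when [w] and [U] have opposite signs.  The letters
of [U] are read from the origin outwards, hence the mirrored substitution and
the reversed [w]; nothing cancels in [w^-1 T^j (U) = U]. *)
Definition fixes_backward s j (w : seq nat) (U : nat -> nat) : Prop :=
  forall x, starts x U -> starts (rev w ++ iter j (sub (mirror s)) x) U.

Definition lang s x : Prop := exists n, infix x (iter n (sub s) [:: 0]).

(** The word that goes with a power: the [h]-th power of [i_w o T^j] is
[i_(wpow s j w h) o T^(j h)]. *)
Definition wpow s j (w : seq nat) h : seq nat :=
  iter h (fun u => iter j (sub s) u ++ w) [::].

Lemma sub_cat s x y : sub s (x ++ y) = sub s x ++ sub s y.
Proof. by rewrite /sub map_cat flatten_cat. Qed.

Lemma sub_cons s i x : sub s (i :: x) = nth [::] s i ++ sub s x.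
Proof. by []. Qed.

Lemma iter_sub_cat s j x y :
  iter j (sub s) (x ++ y) = iter j (sub s) x ++ iter j (sub s) y.
Proof. by elim: j => //= j ->; rewrite sub_cat. Qed.

Lemma iter_sub_nil s j : iter j (sub s) [::] = [::].
Proof. by elim: j => //= j ->. Qed.

Lemma prefix_iter_sub s j x y :
  prefix x y -> prefix (iter j (sub s) x) (iter j (sub s) y).
Proof. by case/prefixP=> z ->; rewrite iter_sub_cat prefix_prefix. Qed.

Lemma infix_iter_sub s j x y :
  infix x y -> infix (iter j (sub s) x) (iter j (sub s) y).
Proof.
by case/infixP=> z [z' ->]; rewrite !iter_sub_cat; apply/infixP; do 2!eexists.
Qed.

Lemma mirrorK : involutive mirror.
Proof. by move=> s; rewrite /mirror -map_comp map_id_in // => x _ /=;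
  rewrite revK. Qed.

Lemma sub_mirror s x : sub (mirror s) x = rev (sub s (rev x)).
Proof.
rewrite /sub map_rev rev_flatten map_rev revK -map_comp; congr flatten.
apply: eq_map => i /=; case: (ltnP i (size s)) => i_s;
  first by rewrite (nth_map [::]).
by rewrite !nth_default ?size_map.
Qed.

Lemma iter_sub_mirror s j x :
  iter j (sub (mirror s)) x = rev (iter j (sub s) (rev x)).
Proof. by elim: j => [|j IHj] /=; rewrite ?revK // IHj sub_mirror revK. Qed.

Lemma lang_mirror s x : lang (mirror s) (rev x) <-> lang s x.
Proof.
by split=> -[n xn]; exists n; move: xn; rewrite iter_sub_mirror infix_rev.
Qed.

Lemma lang_infix s x y : infix x y -> lang s y -> lang s x.
Proof. by move=> xy [n yn]; exists n; apply: infix_trans yn. Qed.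

Lemma lang_iter_sub s j x : lang s x -> lang s (iter j (sub s) x).
Proof. by case=> n xn; exists (j + n); rewrite iterD infix_iter_sub. Qed.

Lemma starts_mkseq V m : starts (mkseq V m) V.
Proof. by rewrite /starts size_mkseq. Qed.

Lemma take_mkseq (V : nat -> nat) m n : m <= n -> take m (mkseq V n) = mkseq V m.
Proof. by move=> mn; rewrite /mkseq -map_take take_iota (minn_idPl mn). Qed.

Lemma starts_prefix x y V : prefix x y -> starts y V -> starts x V.
Proof.
rewrite /starts => xy yV; rewrite -(@take_mkseq V _ (size y)) ?size_prefix // yV.
by apply/eqP; rewrite -prefixE.
Qed.

Lemma starts_comp x y V : starts x V -> starts y V -> size x <= size y ->
  prefix x y.
Proof. by move=> xV yV xy; rewrite prefixE -yV take_mkseq // xV. Qed.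

Lemma starts_nth x V i : starts x V -> i < size x -> nth 0 x i = V i.
Proof. by move=> <-; rewrite size_mkseq => ix; rewrite nth_mkseq. Qed.

Lemma starts_nil V : starts [::] V. Proof. by []. Qed.

Lemma prefix_total (T : eqType) (x y z : seq T) :
  prefix x z -> prefix y z -> size x <= size y -> prefix x y.
Proof.
move=> xz /prefixP[y' Ez] xy; move: xz; rewrite !prefixE => /eqP xz.
by rewrite -{2}xz Ez takel_cat.
Qed.

Lemma starts_eqfun V W : (forall m, starts (mkseq V m) W) -> V =1 W.
Proof. by move=> VW n; rewrite -(starts_nth (VW n.+1)) ?size_mkseq ?nth_mkseq. Qed.

Lemma eq_starts f g x : f =1 g -> starts x f -> starts x g.
Proof. by move=> fg; rewrite /starts (eq_mkseq fg). Qed.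

Lemma lim_exists (f : nat -> seq nat) :
  (forall n, prefix (f n) (f n.+1)) -> (forall n, n <= size (f n)) ->
  exists V, forall n, starts (f n) V.
Proof.
move=> chain long; exists (fun i => nth 0 (f i.+1) i) => n.
have mono m k : prefix (f m) (f (m + k)).
  elim: k => [|k IHk]; first by rewrite addn0 prefix_refl.
  by rewrite addnS; apply: prefix_trans IHk (chain _).
rewrite /starts; apply: (@eq_from_nth _ 0); rewrite size_mkseq // => i i_n.
rewrite nth_mkseq //; have li := long i.+1.
have nth_prefix x y : prefix x y -> i < size x -> nth 0 x i = nth 0 y i.
  by case/prefixP=> z -> ix; rewrite nth_cat ix.
case: (leqP n i.+1) => h.
  by have := mono n (i.+1 - n); rewrite subnKC // => /nth_prefix->.
by have := mono i.+1 (n - i.+1); rewrite subnKC 1?ltnW // => /nth_prefix->.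
Qed.

Lemma cat_split (T : Type) (a b c d : seq T) : a ++ b = c ++ d ->
  size a <= size c -> exists2 e, c = a ++ e & b = e ++ d.
Proof.
elim: a c => [|x a IHa] c /=; first by move=> -> _; exists c.
by case: c => [|y c] //= [-> /IHa h] /h[e -> ->]; exists e.
Qed.

Lemma lcp_prefixl x y : prefix (lcp x y) x.
Proof.
by elim: x y => [|a x IHx] [|b y] //=; case: eqP => //= _; rewrite eqxx IHx.
Qed.

Lemma lcp_prefixr x y : prefix (lcp x y) y.
Proof.
by elim: x y => [|a x IHx] [|b y] //=; case: eqP => //= ->; rewrite eqxx IHx.
Qed.

Lemma lcpC x y : lcp x y = lcp y x.
Proof.
by elim: x y => [|a x IHx] [|b y] //=; rewrite eq_sym; case: eqP => // ->;
  rewrite IHx.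
Qed.

Lemma lcp_neq x y :
  size (lcp x y) < size x -> size (lcp x y) < size y ->
  nth 0 x (size (lcp x y)) != nth 0 y (size (lcp x y)).
Proof.
elim: x y => [|a x IHx] [|b y] //=; case: eqP => [_|/eqP ab] //=.
exact: IHx.
Qed.

Section Substitution.
Variable s : seq (seq nat).
Local Notation N := (size s).
Local Notation T j := (iter j (sub s)).
Hypothesis Hs : primitive_subst s.

Lemma N_gt1 : 1 < N. Proof. by case/and3P: Hs. Qed.
Lemma N_gt0 : 0 < N. Proof. exact: ltnW N_gt1. Qed.

Lemma image_inalph i : inalph N (nth [::] s i).
Proof.
case: (ltnP i N) => iN; last by rewrite nth_default.
by case/and3P: Hs => _ /allP H _; apply/H/mem_nth.
Qed.

Lemma sub_inalph x : inalph N (sub s x).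
Proof.
elim: x => //= i x IHx; rewrite sub_cons /inalph all_cat; apply/andP.
by split; [apply: image_inalph | apply: IHx].
Qed.

Lemma iter_sub_inalph j x : inalph N x -> inalph N (T j x).
Proof. by case: j => //= j _; apply: sub_inalph. Qed.

Lemma image_full i j : i < N -> j < N -> j \in nth [::] s i.
Proof.
case/and3P: Hs => _ _ /allP H iN jN; have /allP := H _ (mem_nth [::] iN); apply.
by rewrite mem_iota.
Qed.

Lemma image_size i : i < N -> 1 < size (nth [::] s i).
Proof.
move=> iN; have := image_full iN N_gt0; have := image_full iN N_gt1.
case: (nth _ _ _) => [|a [|b t]] //; rewrite !inE => /eqP<-.
by [].
Qed.

Lemma size_sub x : inalph N x -> (size x).*2 <= size (sub s x).
Proof.
elim: x => //= i x IHx /andP[iN /IHx]; rewrite sub_cons size_cat doubleS.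
by have := image_size iN; lia.
Qed.

Lemma size_iter_sub j x : inalph N x -> size x <= size (T j x).
Proof.
move=> Hx; elim: j => //= j IHj; have := size_sub (iter_sub_inalph j Hx); lia.
Qed.

Lemma size_iter_sub2 j x : inalph N x -> 0 < j -> (size x).*2 <= size (T j x).
Proof.
move=> Hx; case: j => // j _; rewrite iterSr.
by apply: leq_trans (size_sub Hx) (size_iter_sub _ (sub_inalph _)).
Qed.

Lemma size_iter_subS j i : i < N -> j < size (T j [:: i]).
Proof.
move=> iN; have Hi : inalph N [:: i] by rewrite /inalph /= iN.
elim: j => //= j IHj; have := size_sub (iter_sub_inalph j Hi); lia.
Qed.

Lemma iter_sub_growing n : infix (T n [:: 0]) (T n.+1 [:: 0]).
Proof.
rewrite iterSr; apply: infix_iter_sub.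
by rewrite /sub /= cats0 infix1s image_full // N_gt0.
Qed.

Lemma lang_inalph x : lang s x -> inalph N x.
Proof.
case=> n /mem_infix xn; apply/allP => i /xn; apply/allP/iter_sub_inalph.
by rewrite /inalph /= N_gt0.
Qed.

Lemma lang_letter i : i < N -> lang s [:: i].
Proof. by move=> iN; exists 1;
  rewrite /sub /= cats0 infix1s image_full // N_gt0. Qed.

Lemma prefix_cover x z : inalph N z -> prefix x (sub s z) ->
  exists2 y, prefix y z & (size y <= size x) && prefix x (sub s y).
Proof.
move=> Hz xz; exists (take (size x) z); first exact: prefix_take.
have Hy : inalph N (take (size x) z).
  by apply/allP => i /mem_take; apply: (allP Hz).
have pyz : prefix (sub s (take (size x) z)) (sub s z).
  by rewrite -{2}(cat_take_drop (size x) z) sub_cat prefix_prefix.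
rewrite size_take_min geq_minl /=.
case: (ltnP (size x) (size z)) => h; last by rewrite take_oversize.
apply: prefix_total xz pyz _; apply: leq_trans (size_sub Hy).
by rewrite size_take_min; lia.
Qed.

(** A factor of an image lies in the image of a factor that is not longer,
because the images of letters are not empty. *)
Lemma infix_cover x z : inalph N z -> infix x (sub s z) ->
  exists2 y, infix y z & (size y <= size x) && infix x (sub s y).
Proof.
elim: z => [|a z IHz] Hz.
  by rewrite /sub /= => /eqP->; exists [::].
case: (altP (x =P [::])) => [-> _|x_nil]; first by exists [::].
have [aN Hz'] := andP Hz; rewrite sub_cons => /infixP[p [q E]].
case: (leqP (size (nth [::] s a)) (size p)) => h.
  have [e _ E'] := cat_split E h.
  have [|y yz Hy] := IHz Hz' _; first by apply/infixP; exists e, q.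
  by exists y => //; apply: infix_trans yz (infix_cons _ _).
have [r Er {}E] := cat_split (esym E) (ltnW h).
case: (leqP (size x) (size r)) => xr.
  have [e Ee _] := cat_split E xr.
  exists [:: a]; first by rewrite -(cat1s a z) prefix_infix.
  rewrite /= lt0n size_eq0 x_nil /sub /= cats0 Er Ee; apply: infix_catl.
  exact: prefix_infix.
have [e Ee /esym Ez] := cat_split (esym E) (ltnW xr).
have : prefix e (sub s z) by rewrite -Ez prefix_prefix.
case/(prefix_cover Hz') => y yz /andP[sye ey].
have r_gt0 : 0 < size r by move: h;
  rewrite Er size_cat -[X in X < _]addn0 ltn_add2l.
exists (a :: y); first by apply: prefixW; rewrite prefix_cons eqxx.
rewrite Ee; apply/andP; split; first by rewrite size_cat /= -add1n leq_add.
rewrite sub_cons Er -catA; apply: infix_catl; apply: prefixW.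
by rewrite prefix_catr // eqxx.
Qed.

End Substitution.

(** * Languages, periods and limits of expanding windows *)

Definition words (N L : nat) : seq (seq nat) :=
  iter L (fun W => flatten [seq [seq i :: w | w <- W] | i <- iota 0 N]) [:: [::]].

Definition words_upto (N m : nat) : seq (seq nat) :=
  flatten [seq words N i | i <- iota 0 m.+1].

Definition in_lang s x : bool :=
  infix x (iter (size (words_upto (size s) (size x))).+1 (sub s) [:: 0]).

Lemma mem_words N L x : (x \in words N L) = (size x == L) && inalph N x.
Proof.
elim: L x => [|L IHL] x; first by rewrite inE; case: x.
apply/flatten_mapP/idP => [[i]|].
  rewrite mem_iota /= add0n => iN /mapP[w]; rewrite IHL => /andP[/eqP<- Hw] ->.
  by rewrite /= eqxx /= iN.
case: x => // i w /andP[]; rewrite /= eqSS => wL /andP[iN Hw].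
by exists i; rewrite ?mem_iota //; apply: map_f; rewrite IHL wL.
Qed.

Lemma mem_words_upto N m x :
  (x \in words_upto N m) = (size x <= m) && inalph N x.
Proof.
apply/flatten_mapP/andP => [[i]|[xm Hx]].
  by rewrite mem_iota mem_words /= add0n ltnS => im /andP[/eqP-> ->].
by exists (size x); rewrite ?mem_iota // mem_words eqxx.
Qed.

Lemma plateau (f : nat -> nat) B :
  (forall n, f n <= f n.+1) -> (forall n, f n <= B) ->
  exists2 n, n <= B & f n.+1 = f n.
Proof.
move=> f_le f_B; suff H k : (exists2 n, n < k & f n.+1 = f n) \/ k <= f k.
  by case: (H B.+1) => //; have := f_B B.+1; lia.
elim: k => [|k IHk]; first by right.
case: (ltnP (f k) (f k.+1)) => h.
  by case: IHk => [[n nk En]|kf]; [left; exists n => //; lia | right; lia].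
by left; exists k => //; have := f_le k; lia.
Qed.

Lemma count_eq_in (T : eqType) (a b : pred T) W : (forall x, a x -> b x) ->
  count b W <= count a W -> {in W, forall x, b x -> a x}.
Proof.
move=> ab; elim: W => //= y W IHW h x; rewrite inE.
have hW := sub_count ab W; have hy := ab y.
case/predU1P => [->|xW].
  by move=> b_y; move: h hy; rewrite b_y; case: (a y) => // h _; lia.
by apply: IHW => //; move: h hy; case: (a y); case: (b y) => //; lia.
Qed.

(** A period of a point of [W] is at most [size W], hence divides the factorial. *)
Lemma period_fact (T : eqType) (f : T -> T) (W : seq T) x n :
  (forall y, y \in W -> f y \in W) -> x \in W -> 0 < n -> iter n f x = x ->
  iter (size W)`! f x = x.
Proof.
move=> fW xW n_gt0 fx.
have per m : iter (n * m) f x = x.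
  by elim: m => [|m IHm]; rewrite ?muln0 // mulnS iterD IHm.
have itW m : iter m f x \in W by elim: m => //= m; apply: fW.
have : looping f x (size W).
  rewrite -[looping _ _ _]negbK -looping_uniq; apply/negP => U.
  have := uniq_leq_size U; rewrite size_traject => /(_ W) H.
  suff : size W < size W by rewrite ltnn.
  by apply: H => y /trajectP[i _ ->].
move=> /trajectP[i iW Ei].
pose p := size W - i.
have px : iter p f x = x.
  have [m Em] : exists m, n * m = m * n /\ i <= n * m.
    by exists i; split; [lia | nia].
  case: Em => _ im.
  have : iter (n * m - i) f (iter (size W) f x) = x.
    by rewrite Ei -iterD subnK // per.
  rewrite -iterD (_ : n * m - i + size W = p + n * m); last by rewrite /p; lia.
  by rewrite iterD per.
have p_gt0 : 0 < p by rewrite subn_gt0.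
have /dvdnP[q ->] : p %| (size W)`! by apply: dvdn_fact; rewrite p_gt0 leq_subr.
by elim: q => // q IHq; rewrite mulSn iterD IHq.
Qed.

Lemma wpowS s j w h : wpow s j w h.+1 = iter j (sub s) (wpow s j w h) ++ w.
Proof. by []. Qed.

Lemma wpowD s j w a b : wpow s j w (a + b) =
  iter (j * a) (sub s) (wpow s j w b) ++ wpow s j w a.
Proof.
elim: a => [|a IHa]; first by rewrite muln0 cats0.
by rewrite addSn !wpowS IHa iter_sub_cat mulnS iterD catA.
Qed.

Lemma wpow1 s j w : wpow s j w 1 = w.
Proof. by rewrite wpowS /= iter_sub_nil. Qed.

Lemma wpowSr s j w h : wpow s j w h.+1 = iter (j * h) (sub s) w ++ wpow s j w h.
Proof. by rewrite -addn1 wpowD wpow1. Qed.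

Lemma wpowM s j w h k : wpow s j w (h * k) = wpow s (j * h) (wpow s j w h) k.
Proof.
elim: k => [|k IHk]; first by rewrite muln0.
by rewrite mulnS wpowD IHk.
Qed.

Lemma wpow_nil s j h : wpow s j [::] h = [::].
Proof. by elim: h => // h IHh; rewrite wpowS IHh iter_sub_nil. Qed.

Lemma size_wpow_cat s j u w h :
  size (wpow s j (u ++ w) h) = size (wpow s j u h) + size (wpow s j w h).
Proof. by elim: h => // h IHh; rewrite !wpowSr iter_sub_cat !size_cat IHh; lia. Qed.

Lemma size_wpow_gt0 s j w h : 0 < h -> size w <= size (wpow s j w h).
Proof. by case: h => // h _; rewrite wpowS size_cat leq_addl. Qed.

(** Both [u] and [w] are suffixes of the common power; if [w] were longer by [e],
its power would be longer by the power of [e]. *)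
Lemma wpow_inj s j u w h : 0 < h -> wpow s j u h = wpow s j w h -> u = w.
Proof.
case: h => // h _; wlog uw : u w / size u <= size w => [H E|].
  by case/orP: (leq_total (size u) (size w)) => /H; [apply | move=> <-].
move=> E; have Eh := E; move: E; rewrite !wpowS.
move/(congr1 rev); rewrite !rev_cat => E.
have [|e Ew _] := cat_split E _; first by rewrite !size_rev.
have {}Ew : w = rev e ++ u by rewrite -[w]revK Ew rev_cat revK.
have := congr1 size Eh; rewrite Ew size_wpow_cat.
have := size_wpow_gt0 s j (rev e) (ltn0Sn h); rewrite size_rev => he Es.
by have : size e = 0 by [lia]; move/size0nil => ->.
Qed.

Lemma fixes_forward_pow s j w V h : fixes_forward s j w V ->
  fixes_forward s (j * h) (wpow s j w h) V.
Proof.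
move=> fV; elim: h => [|h IHh] m.
  by exists (mkseq V m); [apply: starts_mkseq | rewrite muln0 prefix_refl].
have [y yV Hy] := IHh m; have [z zV Hz] := fV (size y).
exists z => //; rewrite wpowS mulnS iterD.
apply: prefix_trans (prefix_iter_sub s j Hy) _.
by rewrite iter_sub_cat -catA prefix_catr // eqxx -yV.
Qed.

Lemma fixes_backward_pow s j w U h : fixes_backward s j w U ->
  fixes_backward s (j * h) (wpow s j w h) U.
Proof.
move=> fU; elim: h => [|h IHh] x xU; first by rewrite muln0.
rewrite wpowS mulnS iterD rev_cat -catA.
have := fU _ (IHh _ xU); rewrite iter_sub_cat.
by rewrite [X in rev w ++ (X ++ _)]iter_sub_mirror revK.
Qed.

Lemma fixes_backward_wpow s j w U h : fixes_backward s j w U ->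
  starts (rev (wpow s j w h)) U.
Proof.
by move/(fixes_backward_pow h)/(_ [::] (starts_nil U)); rewrite iter_sub_nil cats0.
Qed.

Lemma fixes_backward_forward s j U : fixes_backward s j [::] U <->
  fixes_forward (mirror s) j [::] U.
Proof.
split=> fU.
  move=> m; exists (iter j (sub (mirror s)) (mkseq U m)).
    by apply: fU; apply: starts_mkseq.
  by rewrite prefix_refl.
by move=> x xU; have [y yU] := fU (size x); rewrite xU => /starts_prefix; apply.
Qed.

Definition admissible s (U V : nat -> nat) : Prop :=
  forall m, lang s (rev (mkseq U m) ++ mkseq V m).

Lemma admissible_starts s U V a b :
  admissible s U V -> starts a U -> starts b V -> lang s (rev a ++ b).
Proof.
move=> gUV aU bV; apply: lang_infix (gUV (maxn (size a) (size b))).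
have := starts_comp aU (starts_mkseq U (maxn (size a) (size b))).
have := starts_comp bV (starts_mkseq V (maxn (size a) (size b))).
rewrite !size_mkseq => /(_ (leq_maxr _ _))/prefixP[b' ->].
move=> /(_ (leq_maxl _ _))/prefixP[a' ->].
by rewrite rev_cat -catA; apply: infix_catl; rewrite catA prefix_infix.
Qed.

Lemma admissible_long s U V :
  (forall m, exists a b, [/\ starts a U, starts b V, m <= size a, m <= size b &
     lang s (rev a ++ b)]) -> admissible s U V.
Proof.
move=> H m; have [a [b [aU bV ma mb ab]]] := H m; apply: lang_infix ab.
have := starts_comp (starts_mkseq U m) aU;
  have := starts_comp (starts_mkseq V m) bV.
rewrite !size_mkseq => /(_ mb)/prefixP[b' ->] /(_ ma)/prefixP[a' ->].
by rewrite rev_cat -catA; apply: infix_catl; rewrite catA prefix_infix.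
Qed.

Lemma admissible_mirror s U V : admissible (mirror s) V U <-> admissible s U V.
Proof.
suff H s' U' V' : admissible s' U' V' -> admissible (mirror s') V' U'.
  by split=> [/H|/H //]; rewrite mirrorK.
move=> g m; rewrite -[mkseq U' m]revK -rev_cat.
by apply/lang_mirror; apply: g.
Qed.

(** The window [v] comes back behind [w] in its image and is followed by more
letters: then the iterates of [return_step] are longer and longer prefixes of the
ray [V] with [T^K (V) = w V]. *)
Definition returns s K (w v : seq nat) : Prop :=
  inalph (size s) v /\ exists e, [/\ inalph (size s) e, 0 < size e &
    iter K (sub s) v = w ++ v ++ e].

Section Windows.
Variable s : seq (seq nat).
Local Notation N := (size s).
Local Notation T j := (iter j (sub s)).
Hypothesis Hs : primitive_subst s.

(** The set of factors of bounded length of [T^i (0)] increases with [i], and by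
[infix_cover] it determines the next one, so it is constant from the first step
at which it does not grow. *)
Lemma in_langP x : reflect (lang s x) (in_lang s x).
Proof.
apply: (iffP idP) => [xn|[n xn]]; first by eexists; apply: xn.
have Hx : inalph N x by apply: (lang_inalph Hs); exists n.
rewrite /in_lang; set W := words_upto _ _.
have grow m k : infix (T m [:: 0]) (T (m + k) [:: 0]).
  elim: k => [|k IHk]; first by rewrite addn0 infix_refl.
  by rewrite addnS; apply: infix_trans IHk (iter_sub_growing Hs _).
pose f m := count (fun y => infix y (T m [:: 0])) W.
have [m mW Em] : exists2 m, m <= size W & f m.+1 = f m.
  apply: plateau => m; last exact: count_size.
  by apply: sub_count => y ym; apply: infix_trans ym (iter_sub_growing Hs _).
have stable : {in W, forall y, infix y (T m.+1 [:: 0]) -> infix y (T m [:: 0])}.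
  apply: count_eq_in; last by rewrite -/(f m) -/(f m.+1) Em.
  by move=> y ym; apply: infix_trans ym (iter_sub_growing Hs _).
have H0 : inalph N [:: 0] by rewrite /inalph /= (N_gt0 Hs).
have down k y : y \in W -> infix y (T (m + k) [:: 0]) -> infix y (T m [:: 0]).
  elim: k y => [|k IHk] y yW; first by rewrite addn0.
  rewrite addnS => /(infix_cover Hs (iter_sub_inalph Hs _ H0)).
  case=> z zk /andP[zy yz]; apply: stable => //; apply: infix_trans yz _.
  have zW : z \in W.
    move: yW; rewrite !mem_words_upto => /andP[yx _]; rewrite (leq_trans zy yx) /=.
    apply/allP => i /(mem_infix zk); apply/allP.
    exact: (iter_sub_inalph Hs).
  exact: (infix_iter_sub s 1 (IHk _ zW zk)).
have xm : infix x (T m [:: 0]).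
  apply: (down n); first by rewrite mem_words_upto leqnn.
  by rewrite addnC; apply: infix_trans xn (grow _ _).
apply: infix_trans xm _; have := grow m ((size W).+1 - m).
by rewrite subnKC // ltnW.
Qed.

Section Expand.
Variables (K : nat) (w v : seq nat).
Hypothesis (Hv : returns s K w v).

Definition return_step (x : seq nat) := drop (size w) (T K x).
Local Notation f := return_step.

Lemma return_spec n : exists e', [/\ inalph N e', 0 < size e',
  T K (iter n f v) = w ++ iter n.+1 f v &
  iter n.+1 f v = iter n f v ++ e'].
Proof.
suff [e' [He' e'0 E]] : exists e', [/\ inalph N e', 0 < size e' &
    T K (iter n f v) = w ++ iter n f v ++ e'].
  have E' : iter n.+1 f v = iter n f v ++ e' by rewrite iterS {1}/f E drop_size_cat.
  by exists e'; rewrite E'.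
elim: n => [|n [e' [He' e'0 E]]]; first by case: Hv.
have E' : iter n.+1 f v = iter n f v ++ e' by rewrite iterS {1}/f E drop_size_cat.
exists (T K e'); split; first exact: iter_sub_inalph.
  exact: leq_trans e'0 (size_iter_sub Hs K He').
by rewrite E' iter_sub_cat E -!catA.
Qed.

Lemma return_chain n : prefix (iter n f v) (iter n.+1 f v).
Proof. by have [e' [_ _ _ ->]] := return_spec n; apply: prefix_prefix. Qed.

Lemma return_long n : size v + n <= size (iter n f v).
Proof.
elim: n => [|n IHn]; first by rewrite addn0.
by have [e' [_ h _ ->]] := return_spec n; rewrite size_cat; lia.
Qed.

Lemma return_inalph n : inalph N (iter n f v).
Proof.
case: n => [|n]; first by case: Hv.
apply/allP => i /mem_drop; apply/allP.
elim: n => [|n IHn]; first by apply: iter_sub_inalph => //; case: Hv.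
apply: iter_sub_inalph => //; apply/allP => j /mem_drop; exact/allP.
Qed.

Lemma return_fixes_forward V : (forall n, starts (iter n f v) V) ->
  fixes_forward s K w V.
Proof.
move=> vV m; exists (iter m.+1 f v) => //.
have [e' [_ _ <- _]] := return_spec m; apply: prefix_iter_sub.
apply: starts_comp (starts_mkseq V m) (vV m) _; rewrite size_mkseq.
by apply: leq_trans (return_long m); rewrite leq_addl.
Qed.

Lemma fixes_forward_return V : fixes_forward s K w V -> starts v V ->
  forall n, starts (iter n f v) V.
Proof.
move=> fV vV; elim=> // n IHn.
have [y yV] := fV (size (iter n f v)); rewrite IHn.
have [e' [_ _ -> _]] := return_spec n.
by rewrite prefix_catr // eqxx /= => /starts_prefix; apply.
Qed.

Lemma return_lim : exists V, forall n, starts (iter n f v) V.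
Proof.
apply: lim_exists return_chain _ => n; apply: leq_trans (return_long n).
exact: leq_addl.
Qed.

Lemma return_iter n : T (K * n) v = wpow s K w n ++ iter n f v.
Proof.
elim: n => [|n IHn]; first by rewrite muln0.
have [e' [_ _ E _]] := return_spec n.
by rewrite mulnS iterD IHn iter_sub_cat E catA.
Qed.

End Expand.

Lemma size_wpow K w n : inalph N w -> 0 < size w -> n <= size (wpow s K w n).
Proof.
move=> Hw w_gt0; elim: n => // n IHn; rewrite wpowSr size_cat.
have := size_iter_sub Hs (K * n) Hw; lia.
Qed.

Lemma wpow_fixes_backward K w U : inalph N w -> 0 < size w ->
  (forall n, starts (rev (wpow s K w n)) U) -> fixes_backward s K w U.
Proof.
move=> Hw w_gt0 wU x xU; apply: starts_prefix (wU (size x).+1).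
rewrite wpowS rev_cat prefix_catr // eqxx /=.
rewrite -[X in rev (T K X)]revK -iter_sub_mirror; apply: prefix_iter_sub.
by apply: starts_comp xU (wU _) _; rewrite size_rev size_wpow.
Qed.

Lemma wpow_lim K w : inalph N w -> 0 < size w ->
  exists U, forall n, starts (rev (wpow s K w n)) U.
Proof.
move=> Hw w_gt0; apply: lim_exists => n; last by rewrite size_rev size_wpow.
by rewrite wpowSr rev_cat prefix_prefix.
Qed.

(** The words [rev U_n ++ V_n] that approximate the point are factors of the
iterates of [w ++ v]. *)
Lemma wpow_return_admissible K w v U V : inalph N w -> 0 < size w ->
  returns s K w v ->
  lang s (w ++ v) -> (forall n, starts (rev (wpow s K w n)) U) ->
  (forall n, starts (iter n (return_step K w) v) V) -> admissible s U V.
Proof.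
move=> Hw w_gt0 Hv Lwv wU vV; apply: admissible_long => m.
exists (rev (wpow s K w m.+1)), (iter m (return_step K w) v); split=> //.
- by rewrite size_rev; apply: leq_trans (leqnSn m) (size_wpow K m.+1 Hw w_gt0).
- exact: leq_trans (leq_addl _ _) (return_long Hv m).
have := lang_iter_sub (K * m) Lwv.
by rewrite iter_sub_cat (return_iter Hv) catA -wpowSr revK.
Qed.

End Windows.

Section ReturnsPowers.
Variable s : seq (seq nat).
Hypothesis Hs : primitive_subst s.

Lemma returns_pow K w v h :
  0 < h -> returns s K w v -> returns s (K * h) (wpow s K w h) v.
Proof.
move=> h0 rv; split; first by case: rv.
have /prefixP[e Ee] : prefix v (iter h (return_step s K w) v).
  by elim: (h) => [|j IHj];
    [rewrite prefix_refl | apply: prefix_trans IHj (return_chain Hs rv j)].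
exists e; rewrite (return_iter Hs rv) Ee; split=> //.
  by have := return_inalph Hs rv h; rewrite Ee /inalph all_cat => /andP[].
have le : size v + h <= size v + size e by rewrite -size_cat -Ee (return_long Hs rv).
by rewrite leq_add2l in le; apply: leq_trans le.
Qed.

(** A ray that a power fixes agrees with the limit computed from the map itself:
both are the limit computed from the power. *)
Lemma returns_unique K w v h V : 0 < h -> returns s K w v ->
  fixes_forward s (K * h) (wpow s K w h) V -> starts v V ->
  forall m, starts (iter m (return_step s K w) v) V.
Proof.
move=> h0 rv fV vV m; have rh := returns_pow h0 rv.
have [V1 V1P] := return_lim Hs rv.
have f1 := fixes_forward_pow h (return_fixes_forward Hs rv V1P).
have pV := fixes_forward_return Hs rh fV vV;
  have pV1 := fixes_forward_return Hs rh f1 (V1P 0).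
apply: (eq_starts _ (V1P m)); apply: starts_eqfun => j.
apply: starts_prefix (pV j); apply: starts_comp (starts_mkseq V1 j) (pV1 j) _.
by rewrite size_mkseq; apply: leq_trans (leq_addl _ _) (return_long Hs rh j).
Qed.

Lemma fixes_backward_unique K w h U : 0 < h ->
  fixes_backward s (K * h) (wpow s K w h) U ->
  forall m, starts (rev (wpow s K w m)) U.
Proof.
move=> h0 fU m; have := fixes_backward_wpow m fU; rewrite -wpowM;
  apply: starts_prefix.
have -> : h * m = m + (h.-1 * m) by rewrite -mulSn prednK.
by rewrite wpowD rev_cat prefix_prefix.
Qed.

End ReturnsPowers.

(** * Periodic pairs of windows *)

Definition windows (s : seq (seq nat)) L : seq (seq nat * seq nat) :=
  [seq d <- [seq (v, v') | v <- words (size s) L, v' <- words (size s) L]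
     | head 0 d.1 != head 0 d.2].

(** Windows of this length can be iterated: behind the common prefix of the images
of two windows, [L] letters remain on both sides, and one more, which makes the
iterates of a window grow. *)
Definition cancel_length (s : seq (seq nat)) L : bool :=
  (0 < L) && all (fun d =>
     let c := size (lcp (sub s d.1) (sub s d.2)) in
     (L + c < size (sub s d.1)) && (L + c < size (sub s d.2))) (windows s L).

(** The first component accumulates the common prefixes that are removed; after [j]
steps it is the word [w] of the map [i_w o T^j]. *)
Definition window_step (s : seq (seq nat)) L (r : seq nat * (seq nat * seq nat)) :=
  let c := lcp (sub s r.2.1) (sub s r.2.2) in
  (sub s r.1 ++ c, (take L (drop (size c) (sub s r.2.1)),
                    take L (drop (size c) (sub s r.2.2)))).

Definition window_iter (s : seq (seq nat)) L j d :=
  iter j (window_step s L) ([::], d).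

(** A common multiple of the periods of all pairs of windows. *)
Definition period_exp (s : seq (seq nat)) L : nat := (size (windows s L))`!.

Definition periodic_windows (s : seq (seq nat)) L : seq (seq nat * seq nat) :=
  [seq ((window_iter s L (period_exp s L) d).1, d.1)
     | d <- windows s L & (window_iter s L (period_exp s L) d).2 == d].

(** The second window of a pair only witnesses that the first one is periodic: it
need not occur behind [w] in the subshift. *)
Definition branches (s : seq (seq nat)) L w : seq (seq nat) :=
  [seq p.2 | p <- periodic_windows s L & (p.1 == w) && in_lang s (w ++ p.2)].

(** A word [w] with its windows gives a singularity if two of the windows differ at
once.  The trivial [w] is excluded because it does not determine the other ray. *)
Definition branchings (s : seq (seq nat)) L : seq (seq nat * seq (seq nat)) :=
  [seq (w, branches s L w) | w <- [seq p.1 | p <- periodic_windows s L] &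
     (w != [::]) && has (fun v => has (fun v' => head 0 v != head 0 v')
       (branches s L w)) (branches s L w)].

Section WindowPairs.
Implicit Types (d : seq nat * seq nat) (v w : seq nat).
Variables (s : seq (seq nat)) (L : nat).
Local Notation N := (size s).
Local Notation T j := (iter j (sub s)).
Local Notation D := (windows s L).
Local Notation W := (window_iter s L).
Local Notation K := (period_exp s L).
Hypotheses (Hs : primitive_subst s) (HL : cancel_length s L).

Let L_gt0 : 0 < L. Proof. by case/andP: HL. Qed.

Lemma period_exp_gt0 : 0 < K. Proof. exact: fact_gt0. Qed.

Lemma windowsP d : reflect
  [/\ head 0 d.1 != head 0 d.2, size d.1 = L, size d.2 = L,
      inalph N d.1 & inalph N d.2] (d \in D).
Proof.
rewrite mem_filter; apply: (iffP andP) => [[dd /allpairsP[[v v'] /= [vw v'w E]]]|].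
  move: vw v'w dd; rewrite !mem_words E /= => /andP[/eqP-> ->] /andP[/eqP-> ->].
  by split.
case: d => v v' /= [dd vL v'L Hv Hv']; split => //.
by apply: allpairs_f; rewrite mem_words ?vL ?v'L eqxx.
Qed.

Lemma window_stepP d : d \in D -> let c := lcp (sub s d.1) (sub s d.2) in
  let d' := (window_step s L ([::], d)).2 in
  d' \in D /\ exists e e', [/\ 0 < size e, 0 < size e',
    sub s d.1 = c ++ d'.1 ++ e & sub s d.2 = c ++ d'.2 ++ e'].
Proof.
move=> dD c d'; have [_ _ _ Hv Hv'] := windowsP _ dD.
case/andP: HL => _ /allP /(_ _ dD) /=; rewrite -/c => /andP[h h'].
have Ec (a : seq nat) : prefix c a ->
  a = c ++ take L (drop (size c) a) ++ drop L (drop (size c) a).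
  by move/prefixP=> [b ->]; rewrite drop_size_cat // cat_take_drop.
have hd (a : seq nat) : head 0 (take L (drop (size c) a)) = nth 0 a (size c).
  by rewrite -nth0 nth_take // nth_drop addn0.
split; last first.
  exists (drop L (drop (size c) (sub s d.1))), (drop L (drop (size c) (sub s d.2))).
  split; rewrite ?size_drop; try lia.
    exact: Ec (lcp_prefixl _ _).
  exact: Ec (lcp_prefixr _ _).
have sub_take i a : inalph N a -> inalph N (take L (drop i a)).
  move=> Ha; apply/allP => j /mem_take/mem_drop; exact/allP.
apply/windowsP; split.
- by rewrite /d' /= !hd lcp_neq // -/c; lia.
- by rewrite /d' /= size_take_min size_drop -/c; lia.
- by rewrite /d' /= size_take_min size_drop -/c; lia.
- exact/sub_take/sub_inalph.
- exact/sub_take/sub_inalph.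
Qed.

Lemma window_iterS j d : W j.+1 d =
  (sub s (W j d).1 ++ lcp (sub s (W j d).2.1) (sub s (W j d).2.2),
   (window_step s L ([::], (W j d).2)).2).
Proof. by []. Qed.

(** The first component collects what the pair of windows has in common after
[j] steps: it is the longest common prefix of the images under [T j] of any two
infinite words that start with the two windows. *)
Lemma window_iterP j d : d \in D -> (W j d).2 \in D /\
  exists e e', [/\ 0 < j -> 0 < size e /\ 0 < size e',
    T j d.1 = (W j d).1 ++ (W j d).2.1 ++ e &
    T j d.2 = (W j d).1 ++ (W j d).2.2 ++ e'].
Proof.
move=> dD; elim: j => [|j [IHD [e [e' [_ E E']]]]].
  by split=> //; exists [::], [::]; rewrite !cats0.
have [D' [a [a' [a0 a0' Ea Ea']]]] := window_stepP IHD.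
split=> //; exists (a ++ sub s e), (a' ++ sub s e').
rewrite window_iterS !iterS E E' !sub_cat.
split; first by rewrite !size_cat; lia.
  by rewrite {1}Ea -!catA.
by rewrite {1}Ea' -!catA.
Qed.

Lemma window_iter_inalph j d : d \in D -> inalph N (W j d).1.
Proof.
move=> dD; have [_ [e [e' [_ E _]]]] := window_iterP j dD.
have [_ _ _ Hv _] := windowsP _ dD.
by have := iter_sub_inalph Hs j Hv; rewrite E /inalph all_cat => /andP[].
Qed.

Lemma window_iter_shift j w d :
  iter j (window_step s L) (w, d) = (T j w ++ (W j d).1, (W j d).2).
Proof.
elim: j => [|j IHj]; first by rewrite cats0.
by rewrite iterS IHj window_iterS /window_step /= sub_cat -catA.
Qed.

Lemma window_iter_wpow j h d : (W j d).2 = d ->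
  W (j * h) d = (wpow s j (W j d).1 h, d).
Proof.
move=> jd; elim: h => [|h IHh]; first by rewrite muln0.
rewrite mulnS /window_iter iterD -/(window_iter s L (j * h) d) IHh.
by rewrite window_iter_shift jd wpowS.
Qed.

Lemma window_iter2 j d :
  (W j d).2 = iter j (fun d => (window_step s L ([::], d)).2) d.
Proof. by elim: j => //= j <-. Qed.

Lemma window_iter_sym j v v' : W j (v', v) =
  ((W j (v, v')).1, ((W j (v, v')).2.2, (W j (v, v')).2.1)).
Proof.
by elim: j => // j IHj; rewrite /window_iter !iterS -!/(window_iter _ _ _ _) IHj
  /window_step /= lcpC.
Qed.

Lemma window_period j d : d \in D -> 0 < j -> (W j d).2 = d -> (W K d).2 = d.
Proof.
rewrite !window_iter2 => dD j0; apply: period_fact => // d' d'D.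
by have [] := window_stepP d'D.
Qed.

(** As [V] and [V'] differ at once, [w] is exactly what their images share; hence it
is the word that the windows accumulate, and the windows come back. *)
Lemma window_fix j w V V' : (forall m, inalph N (mkseq V m)) ->
  (forall m, inalph N (mkseq V' m)) -> V 0 != V' 0 ->
  fixes_forward s j w V -> fixes_forward s j w V' ->
  (mkseq V L, mkseq V' L) \in D /\
  W j (mkseq V L, mkseq V' L) = (w, (mkseq V L, mkseq V' L)).
Proof.
move=> HV HV' V0 fV fV'.
have hd (Z : nat -> nat) : head 0 (mkseq Z L) = Z 0 by rewrite -nth0 nth_mkseq.
have dD : (mkseq V L, mkseq V' L) \in D.
  by apply/windowsP; rewrite /= !hd !size_mkseq.
split=> //; have [/windowsP D' [e [e' [_ E E']]]] := window_iterP j dD.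
have [y yV] := fV L; have [y' y'V] := fV' L; move: E E'.
case: (W j _) D' => w1 [u u'] /= [uu' uL u'L _ _] -> -> py' py.
have y'_nth i : i < size y' -> nth 0 y' i = V' i by apply: starts_nth.
have y_nth i : i < size y -> nth 0 y i = V i by apply: starts_nth.
have sz : size (w1 ++ u ++ e) <= size (w ++ y) := size_prefix py.
have sz' : size (w1 ++ u' ++ e') <= size (w ++ y') := size_prefix py'.
rewrite !size_cat uL u'L in sz sz'.
have hu (z : seq nat) : nth 0 (w1 ++ z) (size w1) = head 0 z.
  by rewrite nth_cat ltnn subnn nth0.
have hw (z : seq nat) : nth 0 (w ++ z) (size w) = head 0 z.
  by rewrite nth_cat ltnn subnn nth0.
have hd_cat (a b : seq nat) : 0 < size a -> head 0 (a ++ b) = head 0 a by case: a.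
have np i : i < size w1 + L -> nth 0 (w1 ++ u ++ e) i = nth 0 (w ++ y) i.
  by move=> iL; case/prefixP: py => z ->; rewrite [RHS]nth_cat !size_cat uL;
    case: ltnP => //; lia.
have np' i : i < size w1 + L -> nth 0 (w1 ++ u' ++ e') i = nth 0 (w ++ y') i.
  by move=> iL; case/prefixP: py' => z ->; rewrite [RHS]nth_cat !size_cat u'L;
    case: ltnP => //; lia.
have Ew : size w1 = size w.
  case: (ltngtP (size w) (size w1)) => // h.
    have E : nth 0 y 0 = nth 0 w1 (size w).
      by have := np (size w); rewrite hw nth0 nth_cat h => <- //; lia.
    have E' : nth 0 y' 0 = nth 0 w1 (size w).
      by have := np' (size w); rewrite hw nth0 nth_cat h => <- //; lia.
    case/eqP: V0; rewrite -(y_nth 0) -?(y'_nth 0) ?E ?E' //; lia.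
  have E : head 0 u = nth 0 w (size w1).
    by have := np (size w1); rewrite hu nth_cat h -(hd_cat u e) ?uL // => -> //;
      lia.
  have E' : head 0 u' = nth 0 w (size w1).
    by have := np' (size w1);
      rewrite hu nth_cat h -(hd_cat u' e') ?u'L // => -> //; lia.
  by case/eqP: uu'; rewrite E E'.
have Ew1 : w1 = w.
  by case/prefixP: (py) => z /eqP; rewrite -!catA eqseq_cat // => /andP[/eqP].
move: py py'; rewrite Ew1 !prefix_catr // eqxx /= => py py'.
have pu a b (Z : nat -> nat) z : size a = L -> prefix (a ++ b) z -> starts z Z ->
  a = mkseq Z L.
  move=> aL /catl_prefix az zZ; by have := starts_prefix az zZ; rewrite /starts aL.
by rewrite (pu _ _ _ _ uL py yV) (pu _ _ _ _ u'L py' y'V).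
Qed.

Lemma periodic_windowsP w v : reflect
  (exists v', [/\ (v, v') \in D & W K (v, v') = (w, (v, v'))])
  ((w, v) \in periodic_windows s L).
Proof.
apply: (iffP mapP) => [[[u u']]|[v' [vD E]]].
  rewrite mem_filter => /andP[/eqP E uD] [-> ->]; exists u'; split => //.
  by rewrite {1}[W _ _]surjective_pairing E.
by exists (v, v'); [rewrite mem_filter /= E eqxx | rewrite /= E].
Qed.

Lemma branchesP w v : reflect
  ((w, v) \in periodic_windows s L /\ lang s (w ++ v)) (v \in branches s L w).
Proof.
apply: (iffP mapP) => [[[w' u]]|[wv lwv]].
  by rewrite mem_filter /= => /andP[/andP[/eqP-> /(in_langP Hs) lwu] wu] ->.
by exists (w, v) => //; rewrite mem_filter wv eqxx andbT; apply/in_langP.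
Qed.

Lemma branches_return w v : v \in branches s L w ->
  [/\ returns s K w v, lang s (w ++ v), size v = L & inalph N w].
Proof.
case/branchesP => /periodic_windowsP[v' [vD E]] lwv.
have [_ vL _ Hv _] := windowsP _ vD.
have Hw : inalph N w by have := window_iter_inalph K vD; rewrite E.
split=> //; split=> //.
have [_ [e [e' []]]] := window_iterP K vD;
  rewrite E /= => /(_ period_exp_gt0)[e0 _] Ev _.
exists e; split=> //; have := iter_sub_inalph Hs K Hv.
by rewrite Ev /inalph !all_cat => /and3P[].
Qed.

Lemma branchingsP w l : (w, l) \in branchings s L ->
  [/\ w != [::], inalph N w, l = branches s L w &
      exists v v', [/\ v \in l, v' \in l & head 0 v != head 0 v']].
Proof.
case/mapP=> w'; rewrite mem_filter =>
  /andP[/andP[w0 /hasP[v vl /hasP[v' v'l vv']]] _].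
case=> -> ->; split=> //; last by exists v, v'.
by have [] := branches_return vl.
Qed.

(** Every point fixed by a power of the map that goes with [w] is listed: it
differs at the origin from some listed point, and the two then form a periodic
pair of windows, whose common part over [K] steps is [w] again. *)
Lemma branchings_maximal w l h U V : (w, l) \in branchings s L -> 0 < h ->
  admissible s U V -> fixes_forward s (K * h) (wpow s K w h) V ->
  fixes_backward s (K * h) (wpow s K w h) U -> exists2 v, v \in l & starts v V.
Proof.
case/branchingsP => w0 Hw El [v1 [v2 [v1l v2l v12]]] h0 gUV fV fU.
have [v [vl vV]] : exists v, v \in l /\ V 0 != head 0 v.
  case: (eqVneq (V 0) (head 0 v1)) => [E|]; last by exists v1.
  by exists v2; rewrite E.
move: vl; rewrite El => vl; have [rv _ vL _] := branches_return vl.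
have [V1 V1P] := return_lim Hs rv.
have fV1 := fixes_forward_pow h (return_fixes_forward Hs rv V1P).
have pV1 : starts v V1 := V1P 0.
have HV m : inalph N (mkseq V m).
  have /(lang_inalph Hs) := gUV m; rewrite /inalph all_cat => /andP[] //.
have HV1 m : inalph N (mkseq V1 m).
  have /allP Hm := return_inalph Hs rv m; apply/allP => i im; apply: Hm.
  apply: mem_infix im; apply: prefixW;
    apply: starts_comp (starts_mkseq _ _) (V1P m) _.
  rewrite size_mkseq; exact: leq_trans (leq_addl _ _) (return_long Hs rv m).
have V01 : V 0 != V1 0.
  suff <- : head 0 v = V1 0 by [].
  by rewrite -nth0; apply: starts_nth pV1 _; rewrite vL.
have [dD Wd] := window_fix HV HV1 V01 fV fV1.
have Wd2 : (W (K * h) (mkseq V L, mkseq V1 L)).2 = (mkseq V L, mkseq V1 L).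
  by rewrite Wd.
have WK := window_period dD _ Wd2; rewrite muln_gt0 period_exp_gt0 in WK.
have := window_iter_wpow h (WK h0); rewrite Wd => -[E].
have {}E := wpow_inj h0 E.
exists (mkseq V L); last exact: starts_mkseq.
apply/branchesP; split.
  apply/periodic_windowsP; exists (mkseq V1 L); split=> //.
  by rewrite [W K _]surjective_pairing WK // -E.
have wU : starts (rev w) U.
  have := fU _ (starts_nil U); rewrite iter_sub_nil cats0.
  by case: h h0 {fV fU fV1 Wd Wd2 WK E} => // h _; rewrite wpowS rev_cat;
    apply: starts_prefix (prefix_prefix _ _).
by have := admissible_starts gUV wU (starts_mkseq V L); rewrite revK.
Qed.

(** After [K k] steps the windows have accumulated both the [k]-th power of the
listed word [w1] and the [K]-th power of [w]. *)
Lemma branchings_complete k w U V V' : 0 < k -> w != [::] ->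
  admissible s U V -> admissible s U V' -> V 0 != V' 0 ->
  fixes_forward s k w V -> fixes_forward s k w V' -> fixes_backward s k w U ->
  exists w1, (w1, branches s L w1) \in branchings s L /\ wpow s K w1 k =
    wpow s k w K.
Proof.
move=> k0 w0 gV gV' V0 fV fV' fU.
have HV Z m : admissible s U Z -> inalph N (mkseq Z m).
  by move/(_ m)/(lang_inalph Hs); rewrite /inalph all_cat => /andP[].
have [dD Wd] := window_fix (fun m => HV _ m gV) (fun m => HV _ m gV') V0 fV fV'.
have dD' : (mkseq V' L, mkseq V L) \in D.
  by move: dD => /windowsP[/= h1 h2 h3 h4 h5]; apply/windowsP; rewrite eq_sym.
have Wd2 : (W k (mkseq V L, mkseq V' L)).2 = (mkseq V L, mkseq V' L).
  by rewrite Wd.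
have WK := window_period dD k0 Wd2.
have E1 := window_iter_wpow k WK; have E2 := window_iter_wpow K Wd2.
set w1 := (W K (mkseq V L, mkseq V' L)).1 in E1.
have E : wpow s K w1 k = wpow s k w K.
  by move: E1; rewrite mulnC E2 Wd => -[].
exists w1; split => //.
have w1U : starts (rev w1) U.
  have := fixes_backward_wpow K fU; rewrite -E.
  by case: (k) k0 => // k' _; rewrite wpowS rev_cat;
    apply: starts_prefix (prefix_prefix _ _).
have inl Z Z' : admissible s U Z -> (mkseq Z L, mkseq Z' L) \in D ->
    W K (mkseq Z L, mkseq Z' L) = (w1, (mkseq Z L, mkseq Z' L)) ->
    mkseq Z L \in branches s L w1.
  move=> gZ zD EZ; apply/branchesP; split.
    by apply/periodic_windowsP; exists (mkseq Z' L).
  by have := admissible_starts gZ w1U (starts_mkseq Z L); rewrite revK.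
have WV : W K (mkseq V L, mkseq V' L) = (w1, (mkseq V L, mkseq V' L)).
  by rewrite [LHS]surjective_pairing WK.
have l1 := inl _ _ gV dD WV.
have l2 : mkseq V' L \in branches s L w1.
  by apply: inl gV' dD' _; rewrite window_iter_sym WV.
apply/mapP; exists w1 => //; rewrite mem_filter; apply/andP; split.
  apply/andP; split.
    apply: contra_neq w0 => w1nil; apply: (@wpow_inj s k _ _ K period_exp_gt0).
    by rewrite -E w1nil !wpow_nil.
  apply/hasP; exists (mkseq V L) => //; apply/hasP; exists (mkseq V' L) => //.
  by rewrite -!nth0 !nth_mkseq.
apply/mapP; exists (w1, mkseq V L) => //.
by apply/periodic_windowsP; exists (mkseq V' L).
Qed.

End WindowPairs.

(** * Periodic pairs of letters *)

(** The letters on the two sides of the origin at the points that a power of the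
substitution itself fixes. *)
Definition letter_pairs (s : seq (seq nat)) : seq (nat * nat) :=
  let K := (size s)`! in
  [seq p <- [seq (x, y) | x <- iota 0 (size s), y <- iota 0 (size s)] |
     [&& in_lang s [:: p.1; p.2], head 0 (iter K (sub s) [:: p.2]) == p.2 &
         head 0 (iter K (sub (mirror s)) [:: p.1]) == p.1]].

Lemma primitive_mirror s : primitive_subst s -> primitive_subst (mirror s).
Proof.
case/and3P=> N1 /allP Ha /allP Hf; rewrite /primitive_subst size_map N1 /=.
apply/andP; split; apply/allP => _ /mapP[t ts ->].
  by apply/allP => i; rewrite mem_rev; apply/allP/Ha.
rewrite size_map; apply/allP => j jN; rewrite mem_rev.
by have /allP := Hf _ ts; apply.
Qed.

Section FirstLetters.
Variable (s : seq (seq nat)).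
Local Notation N := (size s).
Local Notation T j := (iter j (sub s)).
Local Notation K := (size s)`!.
Hypothesis Hs : primitive_subst s.

Lemma head_returns y j : y < N -> 0 < j -> head 0 (T j [:: y]) = y ->
  returns s j [::] [:: y].
Proof.
move=> yN j0; have Hy : inalph N [:: y] by rewrite /inalph /= yN.
rewrite /returns; have := size_iter_sub2 Hs Hy j0.
have := iter_sub_inalph Hs j Hy; case: (T j _) => //= z e /andP[_ He] he Ez.
by split=> //; exists e; rewrite Ez; split=> //; case: e he {He}.
Qed.

Lemma returns_head y j : returns s j [::] [:: y] -> head 0 (T j [:: y]) = y.
Proof. by case=> _ [e [_ _ ->]]. Qed.

(** The first letter of an image only depends on the first letter, so on first
letters a substitution acts as a map of the finite alphabet to itself. *)
Lemma head_iter_sub y j : y < N ->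
  head 0 (T j [:: y]) = iter j (fun i => head 0 (nth [::] s i)) y.
Proof.
move=> yN; have Hy : inalph N [:: y] by rewrite /inalph /= yN.
elim: j => //= j <-; have := iter_sub_inalph Hs j Hy.
have := size_iter_sub Hs j Hy; case: (T j _) => //= z e _ /andP[zN _].
by rewrite sub_cons; have := image_size Hs zN; case: (nth _ _ _).
Qed.

Lemma returns_period y j :
  0 < j -> returns s j [::] [:: y] -> returns s K [::] [:: y].
Proof.
move=> j0 ry; have yN : y < N by case: ry => /andP[].
have := returns_head ry; rewrite head_iter_sub // => Ej.
apply: head_returns; rewrite ?fact_gt0 // head_iter_sub //.
rewrite -[in X in X`!](size_iota 0 N); apply: period_fact Ej => //.
  move=> i; rewrite !mem_iota /= !add0n => iN.
  have := image_size Hs iN; have := image_inalph Hs i.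
  by case: (nth _ _ _) => //= z e /andP[].
by rewrite mem_iota.
Qed.

Lemma fixes_forward_returns j V : (forall m, inalph N (mkseq V m)) -> 0 < j ->
  fixes_forward s j [::] V -> returns s j [::] [:: V 0].
Proof.
move=> HV j0 fV; have VN : V 0 < N by have := HV 1; rewrite /inalph /= andbT.
apply: head_returns => //; have [y yV /=] := fV 1.
have Hy : inalph N [:: V 0] by rewrite /inalph /= VN.
have := size_iter_sub2 Hs Hy j0; rewrite /mkseq /=.
case: (T j _) => //= z e _ /prefixP[e' Ey].
by have := @starts_nth _ _ 0 yV; rewrite Ey /=; apply.
Qed.

End FirstLetters.

Section PeriodicLetters.
Variable (s : seq (seq nat)).
Local Notation N := (size s).
Local Notation K := (size s)`!.
Hypothesis Hs : primitive_subst s.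

Lemma letter_pairsP x y : reflect [/\ lang s [:: x; y],
    returns s K [::] [:: y] & returns (mirror s) K [::] [:: x]]
  ((x, y) \in letter_pairs s).
Proof.
have Hm := primitive_mirror Hs.
rewrite mem_filter; apply: (iffP andP) => /=.
  case=> /and3P[/(in_langP Hs) Lxy /eqP hy /eqP hx] _.
  have /and3P[xN yN _] := lang_inalph Hs Lxy.
  split=> //; apply: head_returns; rewrite ?fact_gt0 ?size_map //.
case=> Lxy ry rx; have /and3P[xN yN _] := lang_inalph Hs Lxy.
split; last by apply: allpairs_f; rewrite mem_iota.
by rewrite (returns_head ry) (returns_head rx) !eqxx !andbT; apply/in_langP.
Qed.

Lemma letter_pairs_maximal h U V : 0 < h -> admissible s U V ->
  fixes_forward s h [::] V -> fixes_forward (mirror s) h [::] U ->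
    (U 0, V 0) \in letter_pairs s.
Proof.
move=> h0 gUV fV fU; have Hm := primitive_mirror Hs.
have HU m : inalph (size (mirror s)) (mkseq U m).
  have /(lang_inalph Hs) := gUV m; rewrite /inalph all_cat size_map => /andP[].
  by rewrite all_rev.
have HV m : inalph (size s) (mkseq V m).
  by have /(lang_inalph Hs) := gUV m; rewrite /inalph all_cat => /andP[].
apply/letter_pairsP; split; first exact: gUV 1.
  exact: returns_period h0 (fixes_forward_returns Hs HV h0 fV).
by have := returns_period Hm h0 (fixes_forward_returns Hm HU h0 fU);
  rewrite size_map.
Qed.

Lemma letter_pairs_admissible x y U V : (x, y) \in letter_pairs s ->
  (forall n, starts (iter n (return_step (mirror s) K [::]) [:: x]) U) ->
  (forall n, starts (iter n (return_step s K [::]) [:: y]) V) -> admissible s U V.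
Proof.
case/letter_pairsP => Lxy ry rx xU yV; apply: admissible_long => m.
have Hm := primitive_mirror Hs.
exists (iter m (return_step (mirror s) K [::]) [:: x]),
  (iter m (return_step s K [::]) [:: y]).
split=> //.
- exact: leq_trans (leq_addl _ _) (return_long Hm rx m).
- exact: leq_trans (leq_addl _ _) (return_long Hs ry m).
have := lang_iter_sub (K * m) Lxy.
rewrite -cat1s iter_sub_cat (return_iter Hs ry) wpow_nil.
by rewrite -[iter _ _ [:: x]]revK -(iter_sub_mirror s (K * m) [:: x]) (return_iter Hm rx) wpow_nil.
Qed.

End PeriodicLetters.

(** * Mirror images and powers of substitutions *)

Definition nonerasing (s : seq (seq nat)) : bool :=
  all (fun t => inalph (size s) t && (t != [::])) s.

Lemma nonerasing_mirror s : nonerasing s -> nonerasing (mirror s).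
Proof.
move=> /allP H; apply/allP => _ /mapP[t /H /andP[Ht t0] ->].
by rewrite size_map /inalph all_rev -size_eq0 size_rev size_eq0 t0 andbT.
Qed.

Section Nonerasing.
Variable s : seq (seq nat).
Hypothesis Hs : nonerasing s.
Local Notation N := (size s).

Lemma nonerasing_sub x : inalph N (sub s x).
Proof.
elim: x => //= i x IHx; rewrite sub_cons /inalph all_cat; apply/andP; split=> //.
case: (ltnP i N) => iN; last by rewrite nth_default.
by have /andP[] := allP Hs _ (mem_nth [::] iN).
Qed.

Lemma nonerasing_iter k x : inalph N x -> inalph N (iter k (sub s) x).
Proof. by case: k => //= k _; apply: nonerasing_sub. Qed.

Lemma nonerasing_size k x :
  inalph N x -> size x <= size (iter k (sub s) x).
Proof.
move=> Hx; have Hk := nonerasing_iter _ Hx; elim: k => //= k /leq_trans -> //.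
elim: (iter k _ _) (Hk k) => //= i y IHy /andP[iN /IHy h].
rewrite sub_cons size_cat -add1n leq_add // lt0n size_eq0.
by have /andP[] := allP Hs _ (mem_nth [::] iN).
Qed.

End Nonerasing.

Lemma primitive_nonerasing s : primitive_subst s -> nonerasing s.
Proof.
move=> Hs; apply/(all_nthP [::]) => i iN; rewrite image_inalph //=.
by rewrite -size_eq0 -lt0n ltnW // image_size.
Qed.

(** The action on words of one sign: inverting a word reverses it, so negative words
are substituted in mirror image. *)
Definition side_subst (s : seq (seq nat)) (b : bool) := if b then mirror s else s.

Lemma side_substN s b : side_subst s (~~ b) = mirror (side_subst s b).
Proof. by case: b; rewrite //= mirrorK. Qed.

Lemma size_side_subst s b : size (side_subst s b) = size s.
Proof. by case: b; rewrite //= size_map. Qed.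

Lemma primitive_side s b : primitive_subst s -> primitive_subst (side_subst s b).
Proof. by case: b => //; apply: primitive_mirror. Qed.

Lemma nonerasing_side s b : nonerasing s -> nonerasing (side_subst s b).
Proof. by case: b => //; apply: nonerasing_mirror. Qed.

Definition subst_power (s : seq (seq nat)) k : seq (seq nat) :=
  [seq iter k (sub s) [:: i] | i <- iota 0 (size s)].

Section Power.
Variable s : seq (seq nat).
Hypothesis Hs : nonerasing s.
Local Notation N := (size s).

Lemma size_subst_power k : size (subst_power s k) = N.
Proof. by rewrite size_map size_iota. Qed.

Lemma sub_subst_power k x :
  inalph N x -> sub (subst_power s k) x = iter k (sub s) x.
Proof.
elim: x => [|i x IHx] /=; first by rewrite iter_sub_nil.
move=> /andP[iN /IHx E]; rewrite sub_cons E -cat1s iter_sub_cat; congr (_ ++ _).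
by rewrite (nth_map 0) ?size_iota // nth_iota.
Qed.

Lemma iter_subst_power k m x : inalph N x ->
  iter m (sub (subst_power s k)) x = iter (m * k) (sub s) x.
Proof.
move=> Hx; elim: m => // m IHm.
by rewrite iterS IHm sub_subst_power ?nonerasing_iter // mulSn iterD.
Qed.

Lemma mirror_subst_power k :
  mirror (subst_power s k) = subst_power (mirror s) k.
Proof.
rewrite /mirror /subst_power size_map -map_comp; apply: eq_map => i /=.
by rewrite -/(mirror s) iter_sub_mirror.
Qed.

Variable k : nat.
Hypotheses (k_gt0 : 0 < k) (Hp : primitive_subst (subst_power s k)).
Local Notation p := (subst_power s k).

(** An iterate of the substitution is a factor of any iterate of the power that is
late enough for the letter [0] to have appeared. *)
Lemma lang_subst_power x : lang p x <-> lang s x.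
Proof.
have N0 : 0 < N by rewrite -(size_subst_power k) (N_gt0 Hp).
have H0 : inalph N [:: 0] by rewrite /inalph /= N0.
split=> [[m xm]|[j xj]].
  by exists (m * k); rewrite -iter_subst_power.
exists j.+1; rewrite iter_subst_power //.
have -> : j.+1 * k = j + (k + (j * k - j)) by nia.
rewrite iterD; apply: infix_trans xj _; apply: infix_iter_sub; rewrite iterD.
have := nonerasing_size Hs (j * k - j) H0;
  have := nonerasing_iter Hs (j * k - j) H0.
case: (iter (j * k - j) _ _) => //= i y Hiy _.
rewrite -sub_subst_power // sub_cons; have /andP[iN _] := Hiy.
apply: infix_catr; rewrite infix1s image_full // size_subst_power //.
Qed.

End Power.

Lemma prefix_sub_split s m c x : (forall i, size (nth [::] s i) <= m) ->
  prefix c (sub s x) -> exists x1 r,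
    [/\ prefix x1 x, c = sub s x1 ++ r & size r <= m].
Proof.
move=> sm; elim: x c => [|a x IHx] c.
  by case: c => // _; exists [::], [::].
rewrite sub_cons => /prefixP[d E].
case: (leqP (size (nth [::] s a)) (size c)) => h.
  have [c' Ec Ex] := cat_split E h.
  have [|x1 [r [x1x Ec' rm]]] := IHx c'; first by rewrite Ex prefix_prefix.
  by exists (a :: x1), r; rewrite prefix_cons eqxx x1x Ec Ec' sub_cons catA.
by exists [::], c; split=> //; apply: leq_trans (ltnW h) (sm a).
Qed.

Lemma size_sub_le s m x : (forall i, size (nth [::] s i) <= m) ->
  size (sub s x) <= m * size x.
Proof.
move=> sm; elim: x => //= a x IHx; rewrite sub_cons size_cat mulnS leq_add //.
Qed.

Lemma size_nth_max (s : seq (seq nat)) i :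
  size (nth [::] s i) <= \max_(t <- s) size t.
Proof.
case: (ltnP i (size s)) => h; last by rewrite nth_default.
by apply: (@leq_bigmax_seq _ _ predT) => //; apply: mem_nth.
Qed.

(** * The algorithm *)

Lemma cpt_eqpair A {eA : encoding A} (u v : A -> seq nat * seq nat) :
  computable u -> computable v -> computable (fun a => u a == v a).
Proof.
move=> Hu Hv; apply: cpt_ext (cpt_andb (cpt_eqseq (cpt_fst Hu) (cpt_fst Hv))
  (cpt_eqseq (cpt_snd Hu) (cpt_snd Hv))) => a.
by rewrite -xpair_eqE -!surjective_pairing.
Qed.

Create HintDb cpt discriminated.

(** Computability is proved by following the syntax of the function; the hints
[cpt] refer to the functions already treated. *)
Ltac cpt_step :=
  lazymatch goal with
  | |- computable (fun _ => ?c) => exact: (cpt_const c)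
  | |- computable (fun a => a) => exact: cpt_id
  | |- computable (fun a => (@?f a).1) => apply: (cpt_fst (f := f))
  | |- computable (fun a => (@?f a).2) => apply: (cpt_snd (f := f))
  | |- computable (fun a => (@?f a, @?g a)) => apply: (cpt_pair (f := f) (g := g))
  | |- computable (fun a => @?f a :: @?g a) => apply: (cpt_cons (f := f) (g := g))
  | |- computable (fun a => (@?f a).+1) => apply: (cpt_S (f := f))
  | |- computable (fun a => head ?b (@?f a)) => apply: (cpt_head b (f := f))
  | |- computable (fun a => @?f a && @?g a) => apply: (cpt_andb (b := f) (c := g))
  | |- computable (fun a => ~~ @?f a) => apply: (cpt_negb (b := f))
  | |- computable (fun a => @?f a <= @?g a) => apply: (cpt_leq (m := f) (n := g))
  | |- computable (fun a => @?f a == @?g a) =>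
      first [apply: (cpt_eqn (m := f) (n := g)) | apply: (cpt_eqseq (u := f) (v := g))
        | apply: (cpt_eqpair (u := f) (v := g))]
  | |- computable (fun a => in_mem (@?f a) (mem (@?g a))) =>
      apply: (cpt_mem (x := f) (l := g))
  | |- computable (fun a => infix (@?f a) (@?g a)) =>
      apply: (cpt_infix (u := f) (v := g))
  | |- computable (fun a => iota (@?f a) (@?g a)) =>
      apply: (cpt_iota (m := f) (n := g))
  | |- computable (fun a => size (@?f a)) => apply: (cpt_size (l := f))
  | |- computable (fun a => @?f a ++ @?g a) => apply: (cpt_cat (l1 := f) (l2 := g))
  | |- computable (fun a => rev (@?f a)) => apply: (cpt_rev (l := f))
  | |- computable (fun a => take (@?f a) (@?g a)) =>
      apply: (cpt_take (n := f) (l := g))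
  | |- computable (fun a => drop (@?f a) (@?g a)) =>
      apply: (cpt_drop (n := f) (l := g))
  | |- computable (fun a => nth ?d (@?f a) (@?g a)) =>
      apply: (cpt_nth d (l := f) (n := g))
  | |- computable (fun a => (@?f a)`!) => apply: (cpt_fact (n := f))
  | |- computable (fun a => (@?f a * @?g a)%N) => apply: (cpt_muln (m := f) (n := g))
  | |- computable (fun a => (@?f a + @?g a)%N) => apply: (cpt_add (m := f) (n := g))
  | |- computable (fun a => flatten (@?f a)) => apply: (cpt_flatten (l := f))
  | |- computable (fun a => map (@?g a) (@?l a)) => apply: (cpt_map (l := l) (g := g))
  | |- computable (fun a => filter (@?g a) (@?l a)) =>
      apply: (cpt_filter (l := l) (g := g))
  | |- computable (fun a => all (@?g a) (@?l a)) => apply: (cpt_all (l := l) (g := g))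
  | |- computable (fun a => has (@?g a) (@?l a)) => apply: (cpt_has (l := l) (g := g))
  | |- computable (fun a => iter (@?n a) (@?g a) (@?i a)) =>
      apply: (cpt_iter (n := n) (i := i) (g := g))
  | H : computable ?f |- computable ?f => exact: H
  | H : computable ?f |- computable (fun a => ?f (@?g a)) =>
      apply: (cpt_comp (f := g) H)
  | _ => solve [auto 1 with cpt nocore]
  end.
Ltac cpt := cbv beta zeta; repeat (cpt_step; cbv beta zeta).

Lemma cpt_sub_word A {eA : encoding A} (s : A -> seq (seq nat)) (x : A -> seq nat) :
  computable s -> computable x -> computable (fun a => sub (s a) (x a)).
Proof. by move=> Hs Hx; rewrite /sub; cpt. Qed.
#[local] Hint Extern 0 (computable (fun a => sub (@?f a) (@?g a))) =>
  (apply: (@cpt_sub_word _ _ f g); cpt) : cpt.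

Lemma cpt_mirror A {eA : encoding A} (s : A -> seq (seq nat)) :
  computable s -> computable (fun a => mirror (s a)).
Proof. by move=> Hs; rewrite /mirror; cpt. Qed.
#[local] Hint Extern 0 (computable (fun a => mirror (@?f a))) =>
  (apply: (@cpt_mirror _ _ f); cpt) : cpt.

Lemma cpt_subst_power A {eA : encoding A} (s : A -> seq (seq nat)) (k : A -> nat) :
  computable s -> computable k -> computable (fun a => subst_power (s a) (k a)).
Proof. by move=> Hs Hk; rewrite /subst_power; cpt. Qed.
#[local] Hint Extern 0 (computable (fun a => subst_power (@?f a) (@?g a))) =>
  (apply: (@cpt_subst_power _ _ f g); cpt) : cpt.

Lemma cpt_primitive A {eA : encoding A} (s : A -> seq (seq nat)) :
  computable s -> computable (fun a => primitive_subst (s a)).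
Proof.
move=> Hs; rewrite /primitive_subst /full /inalph.
change (computable (fun a => [&& 1 < size (s a),
  all (fun t => all (fun i => i < size (s a)) t) (s a) &
  all (fun t => all (fun j => j \in t) (iota 0 (size (s a)))) (s a)])).
by cpt.
Qed.
#[local] Hint Extern 0 (computable (fun a => primitive_subst (@?f a))) =>
  (apply: (@cpt_primitive _ _ f); cpt) : cpt.

(** Both words are traversed in one loop over the first: the state holds the common
prefix in reverse, the rest of the second word, and whether they still agree. *)
Lemma cpt_lcp A {eA : encoding A} (x y : A -> seq nat) :
  computable x -> computable y -> computable (fun a => lcp (x a) (y a)).
Proof.
move=> Hx Hy.
pose step (t : seq nat * (seq nat * bool)) (i : nat) :=
  if t.2.2 && (head 0 (rcons t.2.1 i.+1) == i)
  then (i :: t.1, (behead t.2.1, true)) else (t.1, (t.2.1, false)).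
apply: cpt_ext (cpt_rev (cpt_fst (cpt_foldl (g := fun _ => step) Hx
  (cpt_pair (cpt_const [::]) (cpt_pair Hy (cpt_const true))) _))) => [a|].
  have stop l acc z : foldl step (acc, (z, false)) l = (acc, (z, false)).
    by elim: l.
  suff E l acc z : (foldl step (acc, (z, true)) l).1 = rev (lcp l z) ++ acc.
    by rewrite E cats0 revK.
  elim: l acc z => //= i l IHl acc [|j z]; rewrite /step /=.
    by rewrite gtn_eqF // stop.
  rewrite eq_sym; case: eqP => // _; last by rewrite stop.
  by rewrite IHl rev_cons cat_rcons.
have Hr : forall B (eB : encoding B) (u : B -> seq nat) (i : B -> nat),
    computable u -> computable i -> computable (fun b => rcons (u b) (i b)).
  move=> B eB u i Hu Hi;
    apply: cpt_ext (cpt_cat Hu (cpt_cons Hi (cpt_const [::]))) => b.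
  by rewrite cats1.
rewrite /step; apply: cpt_if; cpt; last first.
- by apply: cpt_behead; cpt.
- by apply: Hr; cpt.
Qed.
#[local] Hint Extern 0 (computable (fun a => lcp (@?f a) (@?g a))) =>
  (apply: (@cpt_lcp _ _ f g); cpt) : cpt.

Lemma cpt_words A {eA : encoding A} (m k : A -> nat) :
  computable m -> computable k -> computable (fun a => words (m a) (k a)).
Proof. by move=> Hm Hk; rewrite /words; cpt. Qed.
#[local] Hint Extern 0 (computable (fun a => words (@?f a) (@?g a))) =>
  (apply: (@cpt_words _ _ f g); cpt) : cpt.

Lemma cpt_in_lang A {eA : encoding A} (s : A -> seq (seq nat)) (x : A -> seq nat) :
  computable s -> computable x -> computable (fun a => in_lang (s a) (x a)).
Proof. by move=> Hs Hx; rewrite /in_lang /words_upto; cpt. Qed.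
#[local] Hint Extern 0 (computable (fun a => in_lang (@?f a) (@?g a))) =>
  (apply: (@cpt_in_lang _ _ f g); cpt) : cpt.

Lemma cpt_windows A {eA : encoding A} (s : A -> seq (seq nat)) (L : A -> nat) :
  computable s -> computable L -> computable (fun a => windows (s a) (L a)).
Proof. by move=> Hs HL; rewrite /windows; cpt. Qed.
#[local] Hint Extern 0 (computable (fun a => windows (@?f a) (@?g a))) =>
  (apply: (@cpt_windows _ _ f g); cpt) : cpt.

Lemma cpt_window_iter A {eA : encoding A} (s : A -> seq (seq nat)) (L j : A -> nat)
    (d : A -> seq nat * seq nat) :
  computable s -> computable L -> computable j -> computable d ->
  computable (fun a => window_iter (s a) (L a) (j a) (d a)).
Proof. by move=> Hs HL Hj Hd; rewrite /window_iter /window_step; cpt. Qed.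
#[local] Hint Extern 0 (computable (fun a =>
  window_iter (@?f a) (@?g a) (@?h a) (@?d a))) =>
  (apply: (@cpt_window_iter _ _ f g h d); cpt) : cpt.

Lemma cpt_cancel_length A {eA : encoding A} (s : A -> seq (seq nat)) (L : A -> nat) :
  computable s -> computable L -> computable (fun a => cancel_length (s a) (L a)).
Proof. by move=> Hs HL; rewrite /cancel_length; cpt. Qed.
#[local] Hint Extern 0 (computable (fun a => cancel_length (@?f a) (@?g a))) =>
  (apply: (@cpt_cancel_length _ _ f g); cpt) : cpt.

Lemma cpt_periodic_windows A {eA : encoding A} (s : A -> seq (seq nat)) (L : A -> nat) :
  computable s -> computable L ->
    computable (fun a => periodic_windows (s a) (L a)).
Proof. by move=> Hs HL; rewrite /periodic_windows /period_exp; cpt. Qed.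
#[local] Hint Extern 0 (computable (fun a => periodic_windows (@?f a) (@?g a))) =>
  (apply: (@cpt_periodic_windows _ _ f g); cpt) : cpt.

Lemma cpt_branches A {eA : encoding A} (s : A -> seq (seq nat)) (L : A -> nat)
    (w : A -> seq nat) : computable s -> computable L -> computable w ->
  computable (fun a => branches (s a) (L a) (w a)).
Proof.
by move=> Hs HL Hw; rewrite /branches; cpt.
Qed.
#[local] Hint Extern 0 (computable (fun a => branches (@?f a) (@?g a) (@?h a))) =>
  (apply: (@cpt_branches _ _ f g h); cpt) : cpt.

Lemma cpt_branchings A {eA : encoding A} (s : A -> seq (seq nat)) (L : A -> nat) :
  computable s -> computable L -> computable (fun a => branchings (s a) (L a)).
Proof.
by move=> Hs HL; rewrite /branchings; cpt.
Qed.
#[local] Hint Extern 0 (computable (fun a => branchings (@?f a) (@?g a))) =>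
  (apply: (@cpt_branchings _ _ f g); cpt) : cpt.

Lemma cpt_letter_pairs A {eA : encoding A} (s : A -> seq (seq nat)) :
  computable s -> computable (fun a => letter_pairs (s a)).
Proof. by move=> Hs; rewrite /letter_pairs; cpt. Qed.
#[local] Hint Extern 0 (computable (fun a => letter_pairs (@?f a))) =>
  (apply: (@cpt_letter_pairs _ _ f); cpt) : cpt.

Notation signed_word := (seq (nat * bool)).
Notation raw_desc := (signed_word * nat * seq (signed_word * signed_word))%type.

Definition sign_word b (x : seq nat) : signed_word := [seq (i, b) | i <- x].

(** The output as the program sees it, with numbers for letters. *)
Definition raw_descs b (s : seq (seq nat)) k L : seq raw_desc :=
  [seq ((sign_word b c.1, period_exp (side_subst s b) L * k),
        [seq (if b then (sign_word true v, sign_word false (rev c.1))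
              else (sign_word true (rev c.1), sign_word false v)) | v <- c.2])
     | c <- branchings (side_subst s b) L].

Definition raw_letter_descs (s : seq (seq nat)) k : seq raw_desc :=
  [seq d <- [:: (([::], (size s)`! * k),
        [seq ([:: (p.1, true)], [:: (p.2, false)]) | p <- letter_pairs s])] |
     has (fun p => has (fun q => ~~ ((p.1 == q.1) && (p.2 == q.2)))
       (letter_pairs s)) (letter_pairs s)].

Definition subst_of (a : seq signed_word) : seq (seq nat) := map (map fst) a.

Definition raw_output (t : seq signed_word * nat * nat) : seq raw_desc :=
  let s := subst_power (subst_of t.1.1) t.1.2 in
  raw_descs false s t.1.2 t.2 ++ raw_descs true s t.1.2 t.2 ++
  raw_letter_descs s t.1.2.

Lemma cpt_raw_output : computable raw_output.
Proof.
change (computable (fun t => raw_output t)).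
rewrite /raw_output /raw_descs /raw_letter_descs /subst_of /sign_word /period_exp /side_subst.
by cpt.
Qed.

Definition power_test (a : seq signed_word) k : bool :=
  (0 < k) && primitive_subst (subst_power (subst_of a) k).

Definition length_test (t : seq signed_word * nat) L : bool :=
  let s := subst_power (subst_of t.1) t.2 in
  cancel_length s L && cancel_length (mirror s) L.

Lemma cpt_power_test :
  computable (fun t : seq signed_word * nat => power_test t.1 t.2).
Proof. by rewrite /power_test /subst_of; cpt. Qed.

Lemma cpt_length_test :
  computable (fun t : seq signed_word * nat * nat => length_test t.1 t.2).
Proof. by rewrite /length_test /subst_of; cpt. Qed.

Lemma algorithm_exists : exists algo : prog, forall a : seq signed_word,
  (exists k, power_test a k) ->
  (forall k, power_test a k -> exists L, length_test (a, k) L) ->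
  exists k L, [/\ power_test a k, length_test (a, k) L &
    runs algo (encode a) (encode (raw_output (a, k, L)))].
Proof.
have [p1 H1] := runs_search cpt_power_test.
have [p2 H2] := runs_search cpt_length_test.
have [p3 H3] := cpt_raw_output.
exists (PComp p3 (PComp p2 p1)) => a ex1 ex2.
have [k tk Rk] := H1 a ex1; have [L tL RL] := H2 (a, k) (ex2 k tk).
exists k, L; split=> //.
by apply: RunComp (H3 (a, k, L)); apply: RunComp Rk RL.
Qed.

Local Open Scope classical_set_scope.
Local Open Scope group_scope.

(** * Words of one sign in the free group *)

Section PureWords.
Variable n : nat.
Local Notation N := n.+1.
Implicit Types (u v w : FN N) (b : bool) (x y : seq nat) (l : letter N).

Definition pure_seq b x : seq (letter N) := [seq (inord i, b) | i <- x].

Definition letters_of (t : seq (letter N)) : seq nat := [seq val l.1 | l <- t].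

Definition pure b (t : seq (letter N)) := all (fun l => l.2 == b) t.

Lemma pure_seq_pure b x : pure b (pure_seq b x).
Proof. by elim: x => //= i x ->; rewrite eqxx. Qed.

Lemma pure_reduced b t : pure b t -> reduced t.
Proof.
elim: t => //= l t IHt /andP[/eqP lb tb]; have := IHt tb.
case: t tb {IHt} => //= l' t /andP[/eqP l'b _] ->; rewrite andbT.
by apply/eqP => E; move: l'b; rewrite E /= lb; case: (b).
Qed.

Definition pure_word b x : FN N := Word (pure_reduced (pure_seq_pure b x)).

Lemma letters_ofK b x : inalph N x -> letters_of (pure_seq b x) = x.
Proof.
by elim: x => //= i x IHx /andP[iN /IHx ->]; rewrite inordK.
Qed.

Lemma pure_seq_letters b t : pure b t -> pure_seq b (letters_of t) = t.
Proof.
elim: t => //= -[i c] t IHt /andP[/= /eqP -> /IHt ->].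
by rewrite inord_val.
Qed.

Lemma letters_of_inalph t : inalph N (letters_of t).
Proof. by elim: t => //= l t ->; rewrite ltn_ord. Qed.

Lemma pure_word_letters b u : pure b u -> pure_word b (letters_of u) = u.
Proof. by move=> ub; apply: val_inj; apply: pure_seq_letters. Qed.

Lemma size_pw b x : size (pure_seq b x) = size x. Proof. exact: size_map. Qed.

Lemma pure_seq_cat b x y : pure_seq b (x ++ y) = pure_seq b x ++ pure_seq b y.
Proof. exact: map_cat. Qed.

Lemma reduced_mul u v : reduced (u ++ v) -> fword (u * v) = u ++ v.
Proof. by move=> uv; rewrite /= reduce_id. Qed.

Lemma pure_word_cat b x y : pure_word b (x ++ y) = pure_word b x * pure_word b y.
Proof.
apply: val_inj; rewrite [RHS]reduced_mul; first by rewrite [LHS]pure_seq_cat.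
by rewrite -pure_seq_cat; apply: pure_reduced (pure_seq_pure b _).
Qed.

Lemma pure_word_nil b : pure_word b [::] = 1. Proof. exact: val_inj. Qed.

Lemma winv_pw b x : winv (pure_seq b x) = pure_seq (~~ b) (rev x).
Proof. by rewrite /winv -map_comp /pure_seq map_rev. Qed.

Lemma pure_word_inv b x : (pure_word b x)^-1 = pure_word (~~ b) (rev x).
Proof. by apply: val_inj; apply: winv_pw. Qed.

Lemma prefix_pw b x y : prefix x y -> prefix (pure_seq b x) (pure_seq b y).
Proof. by case/prefixP=> z ->; rewrite pure_seq_cat prefix_prefix. Qed.

Lemma prefix_letters_of (t r : seq (letter N)) : prefix t r ->
  prefix (letters_of t) (letters_of r).
Proof. by case/prefixP=> z ->; rewrite /letters_of map_cat prefix_prefix. Qed.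

Lemma pure_seq_prefix b x y : inalph N x -> inalph N y ->
  prefix (pure_seq b x) (pure_seq b y) -> prefix x y.
Proof. by move=> Hx Hy /prefix_letters_of; rewrite !letters_ofK. Qed.

Lemma pure_word_inj b x y : inalph N x -> inalph N y ->
  pure_word b x = pure_word b y -> x = y.
Proof.
by move=> Hx Hy /(congr1 (@fword N)) /= /(congr1 letters_of); rewrite !letters_ofK.
Qed.

Lemma reduced_cat (t r : seq (letter N)) l :
  reduced t -> reduced r -> (t != [::] -> head l r != linv (last l t)) ->
  reduced (t ++ r).
Proof.
case: t => //= a t ta; case: r => [|c r] /= rr h; first by rewrite cats0.
by rewrite cat_path /= rr andbT ta h.
Qed.

(** Multiplication by one letter adds or removes one letter at the end. *)
Lemma mul_prefix (t : seq (letter N)) u v :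
  prefix t u -> size t + size v <= size u -> prefix t (u * v).
Proof.
have [m] := ubnP (size v); elim: m u v => // m IHm u [[|x v] rv] /= ltm tu h.
  by rewrite cats0 reduce_id ?fwordP.
have rv' : reduced v by apply: path_sorted rv.
have -> : reduce (u ++ x :: v) = (u * letterF x) * Word rv' :> seq _.
  have E : letterF x * Word rv' = Word rv by apply: val_inj; apply: reduced_mul.
  by rewrite -mulgA E.
have [t' Eu] : exists t', fword u = t' by exists (fword u).
case/lastP: t' Eu => [|u' y] Eu.
  by move: h; rewrite Eu /= addnS.
have ru' : reduced u'.
  by have := fwordP u; rewrite Eu; apply: prefix_sorted (prefix_rcons _ _).
move: tu h; rewrite Eu size_rcons addnS ltnS => tu h.
have tu' : prefix t u'.
  by apply: prefix_total tu (prefix_rcons _ _) _; apply: leq_trans h;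
    apply: leq_addr.
case: (eqVneq x (linv y)) => [Ex|xy].
  have Eu' : u * letterF x = Word ru'.
    have -> : u = Word ru' * letterF y.
      apply: val_inj; rewrite [RHS]reduced_mul; first by rewrite [LHS]Eu cats1.
      by rewrite /= cats1 -Eu fwordP.
    rewrite -mulgA (_ : letterF y * _ = 1) ?mulg1 //.
    by apply: val_inj; rewrite /= Ex eqxx.
  by rewrite Eu'; apply: IHm.
have Eux : fword (u * letterF x) = rcons u x.
  rewrite reduced_mul /= cats1 // Eu -cats1.
  apply: (@reduced_cat _ _ y) => //; first by rewrite -Eu fwordP.
  by rewrite last_rcons.
apply: IHm => //; rewrite Eux Eu.
  exact: prefix_trans tu (prefix_rcons _ _).
by rewrite !size_rcons; apply: leq_trans h _; rewrite ltnW.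
Qed.

Lemma size_mul u v : size (u * v) <= size u + size v.
Proof.
rewrite /= -size_cat; elim: (u ++ v) => //= x t IHt.
by case: (reduce t) IHt => //= y r h; case: ifP => //= _; lia.
Qed.

Lemma size_inv u : size u^-1 = size u.
Proof. by rewrite /= /winv size_rev size_map. Qed.

End PureWords.

(** * Rays of one sign and the maps that fix them *)

Section SignedRays.
Variable n : nat.
Local Notation N := n.+1.
Implicit Types (b : bool) (w x y z : seq nat) (V U : bd N).

Definition ray_letters V (m : nat) : nat := val (V m).1.

Definition signed b V : Prop := forall m, (V m).2 = b.

Lemma ray_letters_inalph V m : inalph N (mkseq (ray_letters V) m).
Proof. by apply/allP => _ /mapP[i _ ->]; apply: ltn_ord. Qed.

Lemma starts_inalph V x : starts x (ray_letters V) -> inalph N x.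
Proof. by move=> <-; apply: ray_letters_inalph. Qed.

Lemma pref_signed b V m : signed b V ->
  pref V m = pure_seq n b (mkseq (ray_letters V) m).
Proof.
move=> Vb; rewrite /pref /pure_seq /mkseq -map_comp; apply: eq_map => i /=.
by rewrite inord_val -(Vb i) -surjective_pairing.
Qed.

Lemma prefF_signed b V m :
  signed b V -> prefF V m = pure_word n b (mkseq (ray_letters V) m).
Proof. by move=> Vb; apply: val_inj; apply: pref_signed. Qed.

Lemma bd_ext V U : (forall m, V m = U m) -> V = U.
Proof.
case: V U => [V HV] [U HU] /= /funext E; move: HV; rewrite E => HV.
by rewrite (Prop_irrelevance HV HU).
Qed.

Lemma signed_ray_ext b V U : signed b V -> signed b U ->
  ray_letters V =1 ray_letters U -> V = U.
Proof.
move=> Vb Ub VU; apply: bd_ext => m; rewrite [V m]surjective_pairing.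
rewrite [U m]surjective_pairing Vb Ub; congr (_, _).
by apply: val_inj; apply: VU.
Qed.

Lemma ray_subproof b (f : nat -> nat) m :
  (inord (f m.+1), b) != linv ((inord (f m), b) : letter N).
Proof. by apply/eqP => -[_]; case: (b). Qed.

Definition ray b (f : nat -> nat) : bd N := Bd (ray_subproof b f).

Lemma ray_letters_ray b f : (forall m, f m < N) -> ray_letters (ray b f) =1 f.
Proof. by move=> fN m; rewrite /ray_letters /= inordK. Qed.

Lemma tends_to_pw b V (s : nat -> seq nat) : signed b V ->
  (forall m, exists n0, forall i, n0 <= i ->
    prefix (mkseq (ray_letters V) m) (s i)) ->
  tends_to (fun i => pure_word n b (s i)) V.
Proof.
move=> Vb H m; have [n0 Hn0] := H m; exists n0 => i /Hn0 h.
by rewrite (pref_signed _ Vb); apply: prefix_pw.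
Qed.

Lemma tends_to_starts b V (s : nat -> seq nat) : signed b V ->
  (forall i, starts (s i) (ray_letters V)) -> (forall i, i <= size (s i)) ->
  tends_to (fun i => pure_word n b (s i)) V.
Proof.
move=> Vb Hs long; apply: (tends_to_pw Vb) => m; exists m => i mi.
apply: starts_comp (starts_mkseq _ m) (Hs i) _.
by rewrite size_mkseq; apply: leq_trans (long i).
Qed.

(** A limit only knows about the late terms; the chain brings their common prefixes
back to the early ones. *)
Lemma tends_to_chain b V (s : nat -> seq nat) :
  (forall i, prefix (s i) (s i.+1)) -> (forall i, i <= size (s i)) ->
  (forall i, inalph N (s i)) -> tends_to (fun i => pure_word n b (s i)) V ->
  signed b V /\ forall i, starts (s i) (ray_letters V).
Proof.
move=> chain long Hs sV.
have Vb : signed b V.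
  move=> m; have [n0 /(_ _ (leqnn _))] := sV m.+1.
  case/prefixP=> t Et; have E : pure_seq n b (s n0) = pref V m.+1 ++ t := Et.
  have : nth (V 0) (pure_seq n b (s n0)) m = V m.
    by rewrite E nth_cat size_mkseq ltnSn nth_mkseq.
  have : m < size (pure_seq n b (s n0)) by rewrite E size_cat size_mkseq; lia.
  rewrite size_pw => mn <-; rewrite (nth_map 0) //.
split=> // i; have [n0 H] := sV (size (s i)).
have mono k : prefix (s i) (s (i + k)).
  elim: k => [|k IHk]; first by rewrite addn0 prefix_refl.
  by rewrite addnS; apply: prefix_trans IHk (chain _).
have := H _ (leq_addl i n0); rewrite (pref_signed _ Vb).
move/pure_seq_prefix => /(_ (ray_letters_inalph _ _) (Hs _)) h.
have := prefix_total h (mono n0); rewrite size_mkseq => /(_ (leqnn _)).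
rewrite prefixE size_mkseq take_size => /eqP E.
by rewrite /starts -E.
Qed.

Section Fixed.
Variables (s : seq (seq nat)) (k : nat) (f : FN N -> FN N).
Hypotheses (Hs : nonerasing s) (sN : size s = N).
Hypothesis f_pw : forall b x, inalph N x ->
  f (pure_word n b x) = pure_word n b (iter k (sub (side_subst s b)) x).

Let Hsg b : nonerasing (side_subst s b). Proof. exact: nonerasing_side. Qed.

Let T b := iter k (sub (side_subst s b)).

Let T_inalph b x : inalph N x -> inalph N (T b x).
Proof.
by move=> Hx; have := nonerasing_iter (Hsg b) k; rewrite size_side_subst sN; apply.
Qed.

Let T_size b x : inalph N x -> size x <= size (T b x).
Proof.
by move=> Hx; have := nonerasing_size (Hsg b) k; rewrite size_side_subst sN; apply.
Qed.

(** Otherwise some letter of [w^-1], of the wrong sign, stays at the front. *)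
Lemma inner_prefix b w z (l : letter N) : inalph N w -> inalph N z ->
  size w <= size z -> l.2 = b ->
  prefix [:: l] ((pure_word n b w)^-1 * pure_word n b z * pure_word n b w) ->
    prefix w z.
Proof.
move=> Hw Hz wz lb.
have [z1 Ez] := prefixP (lcp_prefixr w z).
have [w1 Ew] := prefixP (lcp_prefixl w z).
set c := lcp w z in Ez Ew.
have -> : (pure_word n b w)^-1 * pure_word n b z * pure_word n b w =
    pure_word n (~~ b) (rev w1) * pure_word n b (z1 ++ w).
  rewrite {1}Ew Ez !pure_word_cat invgM -pure_word_inv !mulgA; congr (_ * _ * _).
  by rewrite mulgVK.
case: w1 Ew => [|i w1] Ew; first by rewrite cats0 in Ew;
  rewrite Ew Ez prefix_prefix.
case: z1 Ez => [|j z1] Ez.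
  by move: wz; rewrite Ez Ew !size_cat /=; lia.
have ij : i != j.
  have := @lcp_neq w z; rewrite -/c Ew Ez !size_cat !nth_cat !ltnn !subnn /=.
  by apply; lia.
have lp : pure (~~ b) (pure_seq n (~~ b) (rev (i :: w1))) := pure_seq_pure _ _ _.
rewrite reduced_mul; last first.
  apply: (@reduced_cat _ _ _ (inord i, b)); try exact: fwordP.
  move=> _; rewrite /= rev_cons /pure_seq map_rcons last_rcons /linv /= negbK.
  apply: contra ij => /eqP[/(congr1 val)]; rewrite /= !inordK => [->//||].
    by move: Hw; rewrite Ew /inalph all_cat /= => /and3P[].
  by move: Hz; rewrite Ez /inalph all_cat /= => /and3P[].
rewrite /= rev_cons; case: (rev w1) => [|i1 w2] /= /andP[/eqP E _].
  by move: lb; rewrite E /=; case: (b).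
by move: lb; rewrite E /=; case: (b).
Qed.

(** The factor [w] at the end of the conjugate has bounded length, so it does not
affect the limit. *)
Lemma inner_positive b V w : signed b V -> inalph N w ->
  bdmap (inner (pure_word n b w) \o f) V V <->
    fixes_forward (side_subst s b) k w (ray_letters V).
Proof.
move=> Vb Hw; pose z m := T b (mkseq (ray_letters V) m).
have Hz m : inalph N (z m) by apply/T_inalph/ray_letters_inalph.
have sz m : m <= size (z m).
  by have := T_size b (ray_letters_inalph V m); rewrite size_mkseq.
have zmono i j : i <= j -> prefix (z i) (z j).
  move=> ij; apply: prefix_iter_sub;
    apply: starts_comp (starts_mkseq _ _) (starts_mkseq _ _) _.
  by rewrite !size_mkseq.
have Ez m : (inner (pure_word n b w) \o f) (prefF V m) =
    (pure_word n b w)^-1 * pure_word n b (z m) * pure_word n b w.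
  by rewrite /= (prefF_signed _ Vb) f_pw ?ray_letters_inalph.
have Ezt m t : z m = w ++ t ->
  (inner (pure_word n b w) \o f) (prefF V m) = pure_word n b (t ++ w).
  by move=> E; rewrite Ez E !pure_word_cat mulKg.
split=> [tV|fV].
  have [n1 H1] := tV 1%N.
  have wz m : size w + n1 <= m -> prefix w (z m).
    move=> wm; have := H1 m; rewrite Ez => H.
    apply: (@inner_prefix b _ _ (V 0)) (Vb 0) (H _) => //; last by lia.
    by apply: leq_trans (sz m); lia.
  move=> m; pose m' := maxn m (size w + n1).
  have [t Et] := prefixP (wz _ (leq_maxr m _)); rewrite -/m' in Et.
  exists t; last by rewrite -Et; apply: zmono (leq_maxl _ _).
  have [n2 H2] := tV (size t); pose m2 := maxn n2 m'.
  have [t2 Et2] : exists t2, z m2 = w ++ t ++ t2.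
    have /prefixP[t2 ->] := zmono _ _ (leq_maxr n2 m').
    by exists t2; rewrite Et catA.
  have Ht2 : inalph N (t ++ t2 ++ w).
    by have := Hz m2; rewrite Et2 /inalph !all_cat => /and3P[_ -> ->] /=.
  have := H2 _ (leq_maxl n2 m');
    rewrite -/m2 (Ezt _ _ Et2) -catA (pref_signed _ Vb).
  move/pure_seq_prefix => /(_ (ray_letters_inalph _ _) Ht2).
  move/prefix_total => /(_ t (prefix_prefix _ _)); rewrite size_mkseq leqnn.
  move=> /(_ isT); rewrite prefixE size_mkseq take_size => /eqP E.
  by rewrite /starts -E.
move=> m; exists (size w + m) => i mi; have [y yV zy'] := fV i.
have zy : prefix (z i) (w ++ y) := zy'.
have wz : prefix w (z i).
  apply: prefix_total (prefix_prefix w y) zy _.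
  exact: leq_trans (leq_trans (leq_addr _ _) mi) (sz i).
have [t Et] := prefixP wz; rewrite (Ezt _ _ Et) pure_word_cat (pref_signed _ Vb).
have tV : starts t (ray_letters V).
  by apply: starts_prefix yV; move: zy; rewrite Et prefix_catr // eqxx.
have sz' : i <= size w + size t by rewrite -size_cat -Et.
have tm : m <= size t by rewrite -(leq_add2l (size w)); apply: leq_trans mi sz'.
have Ht := starts_inalph tV.
rewrite -pure_word_cat /= pure_seq_cat; apply: prefix_catl; apply: prefix_pw.
by apply: starts_comp (starts_mkseq _ _) tV _; rewrite size_mkseq.
Qed.

(** Here the factor [w] at the end cancels, but only against a bounded number of
letters. *)
Lemma inner_negative b V w : signed (~~ b) V -> inalph N w ->
  bdmap (inner (pure_word n b w) \o f) V V <->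
    fixes_backward (side_subst s b) k w (ray_letters V).
Proof.
move=> Vb Hw; pose z m := rev w ++ T (~~ b) (mkseq (ray_letters V) m).
have Hz m : inalph N (z m).
  rewrite /inalph all_cat all_rev; apply/andP; split=> //.
  exact/T_inalph/ray_letters_inalph.
have sz m : size w + m <= size (z m).
  by have := T_size (~~ b) (ray_letters_inalph V m);
    rewrite size_mkseq size_cat size_rev leq_add2l.
have zmono i j : i <= j -> prefix (z i) (z j).
  move=> ij; rewrite prefix_catr // eqxx; apply: prefix_iter_sub.
  by apply: starts_comp (starts_mkseq _ _) (starts_mkseq _ _) _;
    rewrite !size_mkseq.
have Ez m : (inner (pure_word n b w) \o f) (prefF V m) =
    pure_word n (~~ b) (z m) * pure_word n b w.
  by rewrite /= /inner (prefF_signed _ Vb) f_pw ?ray_letters_inalph // pure_word_inv -pure_word_cat.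
have Ezp t m : prefix t (z m) -> size t + size w <= size (z m) ->
    prefix (pure_seq n (~~ b) t) ((inner (pure_word n b w) \o f) (prefF V m)).
  by move=> tz st; rewrite Ez; apply: mul_prefix;
    [apply: prefix_pw | rewrite !size_pw].
split=> [tV x xV|fV m].
  have [n1 H1] := tV (size (z (size x))).
  pose m := maxn n1 (size w + size (z (size x))).
  have := H1 m (leq_maxl _ _).
  have := Ezp (z (size x)) m; rewrite (pref_signed _ Vb).
  have -> : prefix (z (size x)) (z m).
    apply: zmono; apply: leq_trans (leq_maxr _ _).
    by apply: leq_trans (leq_trans (sz _) (leq_addl _ _)); rewrite leq_addl.
  have -> : size (z (size x)) + size w <= size (z m).
    by apply: leq_trans (sz m); rewrite addnC;
      have := leq_maxr n1 (size w + size (z (size x))); rewrite -/m; lia.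
  move=> /(_ isT isT) h1 h2.
  have := prefix_total h2 h1; rewrite !size_pw size_mkseq leqnn => /(_ isT).
  move/pure_seq_prefix=> /(_ (ray_letters_inalph _ _) (Hz _)).
  rewrite prefixE size_mkseq take_size => /eqP E.
  by move: E; rewrite /z /T xV side_substN /starts => <-.
exists (size w + m) => i mi; rewrite (pref_signed _ Vb).
have zV : starts (z i) (ray_letters V) by rewrite /z /T side_substN; apply: fV;
  apply: starts_mkseq.
apply: Ezp; last by rewrite size_mkseq; have := sz i; lia.
by apply: starts_comp (starts_mkseq _ _) zV _; rewrite size_mkseq; have := sz i;
  lia.
Qed.

(** On a pair of rays of opposite signs one of the two rays cannot cancel
against the last letter of the conjugating word. *)
Lemma inner_pure (w : FN N) U V : signed true U -> signed false V ->
  bdmap (inner w \o f) U U -> bdmap (inner w \o f) V V ->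
  exists b x, inalph N x /\ w = pure_word n b x.
Proof.
move=> Ut Vf fU fV.
have [t Et] : exists t, fword w = t by exists (fword w).
case/lastP: t Et => [|t l] Et.
  by exists true, [::]; split=> //; apply: val_inj.
suff wz b V0 : signed b V0 -> bdmap (inner w \o f) V0 V0 -> l.2 = b ->
    exists x, inalph N x /\ w = pure_word n b x.
  case El : l.2; first by exists true; apply: wz El.
  by exists false; apply: wz El.
move=> Vb fV0 lb; have [n1 H1] := fV0 1%N.
pose m := maxn n1 (size w + size w).+1.
pose z := T b (mkseq (ray_letters V0) m).
have Hz : inalph N z by apply/T_inalph/ray_letters_inalph.
have sz : m <= size z.
  by have := T_size b (ray_letters_inalph V0 m); rewrite size_mkseq.
have E0 : (inner w \o f) (prefF V0 m) = w^-1 * pure_word n b z * w.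
  by rewrite /= (prefF_signed _ Vb) f_pw ?ray_letters_inalph.
have := H1 m (leq_maxl _ _); rewrite E0; set r := w^-1 * _ => h.
have Er : w * r = pure_word n b z by rewrite mulVKg.
have szr : size w < size r.
  have := size_mul w r; rewrite Er size_pw.
  by have := leq_maxr n1 (size w + size w).+1; rewrite -/m; lia.
have {}h : prefix [:: V0 0] r.
  have r0 : 0 < size r by apply: leq_ltn_trans szr.
  have h1 : prefix (take 1 r) (r * w).
    by apply: mul_prefix; rewrite ?prefix_take // size_take_min (minn_idPl _).
  have := prefix_total h h1; rewrite size_take_min (minn_idPl r0) => /(_ isT) h2.
  exact: prefix_trans h2 (prefix_take _ _).
have rwr : reduced (w ++ r).
  apply: (@reduced_cat _ _ _ l); try exact: fwordP.
  move=> _; rewrite Et last_rcons; case/prefixP: h => r' ->/=.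
  by apply/eqP => E; have := Vb 0; rewrite E /= lb; case: (b).
have := reduced_mul rwr; rewrite Er => E.
have wb : pure b w by have := pure_seq_pure n b z;
  rewrite [pure_seq _ _ _]E /pure all_cat => /andP[].
by exists (letters_of w); rewrite letters_of_inalph pure_word_letters.
Qed.

End Fixed.
End SignedRays.

(** * Pairs of rays of opposite signs *)

Section PositiveEndomorphism.
Variable n : nat.
Local Notation N := n.+1.
Variables (s : seq (seq nat)) (phi : FN N -> FN N).
Hypotheses (Hs : nonerasing s) (sN : size s = N).
Hypothesis phiM : {morph phi : u v / u * v}.
Hypothesis phi_pw : forall b x, inalph N x ->
  phi (pure_word n b x) = pure_word n b (sub (side_subst s b) x).
Implicit Types (b c : bool) (P Q : bd N * bd N) (w x y : seq nat).

Definition side b P : bd N := if b then P.1 else P.2.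

Definition opposite P : Prop := forall c, signed c (side c P).

Lemma endo_iterM k : {morph iter k phi : u v / u * v}.
Proof. by elim: k => // k IHk u v; rewrite !iterS IHk phiM. Qed.

Lemma endo_iterV k u : iter k phi u^-1 = (iter k phi u)^-1.
Proof.
have E1 : iter k phi 1 = 1.
  by apply: (mulgI (iter k phi 1)); rewrite -endo_iterM !mulg1.
by apply/esym/mulg1_eq; rewrite -endo_iterM mulgV.
Qed.

Lemma endo_inalph k b x : inalph N x -> inalph N (iter k (sub (side_subst s b)) x).
Proof.
by move=> Hx; have := nonerasing_iter (nonerasing_side b Hs) k;
  rewrite size_side_subst sN; apply.
Qed.

Lemma endo_iter_pw k b x : inalph N x ->
  iter k phi (pure_word n b x) = pure_word n b (iter k (sub (side_subst s b)) x).
Proof.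
move=> Hx; elim: k => // k IHk; rewrite !iterS IHk; apply: phi_pw.
exact: endo_inalph.
Qed.

Lemma wpow_inalph b k w m : inalph N w -> inalph N (wpow (side_subst s b) k w m).
Proof.
move=> Hw; elim: m => // m IHm; rewrite wpowS /inalph all_cat; apply/andP.
by split=> //; apply: endo_inalph.
Qed.

Lemma inner_iter b w k h :
  inalph N w -> iter h (inner (pure_word n b w) \o iter k phi) =
  inner (pure_word n b (wpow (side_subst s b) k w h)) \o iter (k * h) phi.
Proof.
move=> Hw; apply: funext => u; elim: h => [|h IHh].
  by rewrite muln0 /= /inner pure_word_nil invg1 mulg1 mul1g.
have Hwh := wpow_inalph b k h Hw.
rewrite iterS IHh /= /inner !endo_iterM endo_iterV mulnS iterD endo_iter_pw //.
by rewrite pure_word_cat invgM !mulgA.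
Qed.

Lemma inner_iter_exists (w : FN N) k h : exists v : FN N,
  iter h (inner w \o iter k phi) = inner v \o iter (k * h) phi.
Proof.
elim: h => [|h [v IHh]].
  by exists 1; apply: funext => u; rewrite muln0 /= /inner invg1 mulg1 mul1g.
exists (iter k phi v * w); apply: funext => u; rewrite iterS IHh /= /inner.
by rewrite !endo_iterM endo_iterV mulnS iterD invgM !mulgA.
Qed.

Lemma fixesP b w k P : inalph N w -> opposite P ->
  fixes (inner (pure_word n b w) \o iter k phi) P <->
  fixes_forward (side_subst s b) k w (ray_letters (side b P)) /\
  fixes_backward (side_subst s b) k w (ray_letters (side (~~ b) P)).
Proof.
move=> Hw oP; have fk c x := @endo_iter_pw k c x.
rewrite -(inner_positive Hs sN fk (oP b) Hw).
rewrite -(inner_negative Hs sN fk (oP (~~ b)) Hw).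
by rewrite /fixes; case: (b) => /=; split=> -[].
Qed.

Lemma fixes_pure (w : FN N) k P :
  opposite P -> fixes (inner w \o iter k phi) P ->
  exists b x, inalph N x /\ w = pure_word n b x.
Proof.
move=> oP [f1 f2]; have fk c x := @endo_iter_pw k c x.
exact: (inner_pure Hs sN fk (oP true) (oP false) f1 f2).
Qed.

Lemma fixes_iter (w : FN N) k h P : opposite P ->
  fixes (inner w \o iter k phi) P -> fixes (iter h (inner w \o iter k phi)) P.
Proof.
move=> oP fP; have [b [x [Hx Ew]]] := fixes_pure oP fP.
move: fP; rewrite Ew => /(fixesP _ _ Hx oP)[fV fU].
rewrite inner_iter //; apply/fixesP => //; first exact: wpow_inalph.
by split; [apply: fixes_forward_pow | apply: fixes_backward_pow].
Qed.

End PositiveEndomorphism.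

(** * Singularities and their descriptions *)

Section Singularities.
Variable n : nat.
Local Notation N := n.+1.
Variables (s : seq (seq nat)) (phi : FN N -> FN N).
Hypotheses (Hs : primitive_subst s) (sN : size s = N).
Hypothesis phiM : {morph phi : u v / u * v}.
Hypothesis phi_pw : forall b x, inalph N x ->
  phi (pure_word n b x) = pure_word n b (sub (side_subst s b) x).
Implicit Types (b c : bool) (P Q : bd N * bd N) (w x y : seq nat).
Implicit Types (psi : FN N -> FN N).
Implicit Types (Omega : set (bd N * bd N)).

Definition subshift_point P : Prop := [/\ signed true P.1, signed false P.2 &
  admissible s (ray_letters P.1) (ray_letters P.2)].

(** A singularity with its map fixed; that it has two elements follows from the
condition on letters. *)
Definition singular_for psi Omega : Prop :=
  [/\ Omega `<=` subshift_point,
      exists P Q, [/\ Omega P, Omega Q & P.2 0 <> Q.2 0 \/ P.1 0 <> Q.1 0],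
      forall P, Omega P -> fixes psi P &
      forall h P, 0 < h -> subshift_point P -> fixes (iter h psi) P -> Omega P].

Lemma subshift_signed b P : subshift_point P -> signed b (side b P).
Proof. by case=> h1 h2 _; case: b. Qed.

Lemma subshift_side b P :
  subshift_point P ->
    admissible (side_subst s b) (ray_letters (side (~~ b) P)) (ray_letters (side b P)).
Proof. by case=> _ _ gP; case: b => //=; apply/admissible_mirror. Qed.

Lemma side_subshift b P : (forall c, signed c (side c P)) ->
  admissible (side_subst s b) (ray_letters (side (~~ b) P)) (ray_letters (side b P)) -> subshift_point P.
Proof.
move=> Ps gP; split; [exact: Ps true | exact: Ps false |].
by case: b gP => //= /admissible_mirror.
Qed.

Lemma subshift_opposite P : subshift_point P -> opposite P.
Proof. by case=> h1 h2 _ []. Qed.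

Let Hne : nonerasing s. Proof. exact: primitive_nonerasing. Qed.

Let iter_phi_pw := endo_iter_pw Hne sN phi_pw.
Let iter_inner := inner_iter Hne sN phiM phi_pw.

Let wpow_inalph b K w m : inalph N w -> inalph N (wpow (side_subst s b) K w m).
Proof. exact: wpow_inalph. Qed.

Let fixes_pw b w k P (Hw : inalph N w) (gP : subshift_point P) :=
  fixesP Hne sN phi_pw b k Hw (subshift_opposite gP).

(** A singularity is the set of all points that are periodic under any one of
the maps it is fixed by, so a common power of two such maps identifies the two
singularities. *)
Lemma singular_unique (w w1 : FN N) k k1 i j Omega Omega1 : 0 < i -> 0 < j ->
  singular_for (inner w \o iter k phi) Omega ->
    singular_for (inner w1 \o iter k1 phi) Omega1 ->
  iter i (inner w \o iter k phi) = iter j (inner w1 \o iter k1 phi) ->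
  Omega = Omega1.
Proof.
move=> i0 j0 [g _ f m] [g1 _ f1 m1] E; apply/seteqP; split=> P OP.
  apply: (m1 j) => //; first exact: g.
  by rewrite -E; apply: (fixes_iter Hne sN phiM phi_pw _ (subshift_opposite (g _ OP))); apply: f.
apply: (m i) => //; first exact: g1.
by rewrite E; apply: (fixes_iter Hne sN phiM phi_pw _ (subshift_opposite (g1 _ OP))); apply: f1.
Qed.

Variables (phi0 : FN N -> FN N) (k0 : nat).
Hypotheses (k0_gt0 : 0 < k0) (phi0_phi : iter k0 phi0 = phi).

(** The entries of a description list the negative ray first. *)
Definition signed_pair b (u v : FN N) := if b then (u, v) else (v, u).

Definition branching_desc b K w (vs : seq (seq nat)) : sdesc N :=
  (pure_word n b w, (K * k0)%N,
   [seq signed_pair b (pure_word n b v) (pure_word n (~~ b) (rev w)) | v <- vs]).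

Definition letter_desc K (l : seq (nat * nat)) : sdesc N :=
  (1, (K * k0)%N,
   [seq (pure_word n true [:: p.1], pure_word n false [:: p.2]) | p <- l]).

Lemma stepE u K l (x : FN N) :
  sdesc_step phi0 (u, (K * k0)%N, l) x = u^-1 * iter K phi x.
Proof. by rewrite /sdesc_step /= iterM phi0_phi. Qed.

Lemma tends_to_iter b (f : FN N -> FN N) u (A : nat -> seq nat) V :
  (forall m, iter m f u = pure_word n b (A m)) ->
  (forall m, prefix (A m) (A m.+1)) -> (forall m, m <= size (A m)) ->
  (forall m, inalph N (A m)) ->
  tends_to (fun m => iter m f u) V <->
  signed b V /\ forall m, starts (A m) (ray_letters V).
Proof.
move=> fA chain long HA;
  have -> : (fun m => iter m f u) = fun m => pure_word n b (A m).
  by apply: funext.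
by split=> [|[Vb AV]]; [apply: tends_to_chain | apply: tends_to_starts].
Qed.

Lemma side_inalph b w : inalph (size (side_subst s b)) w = inalph N w.
Proof. by rewrite size_side_subst sN. Qed.

Lemma step_returns b K w v l m : inalph N w -> returns (side_subst s b) K w v ->
  iter m (sdesc_step phi0 (pure_word n b w, (K * k0)%N, l)) (pure_word n b v) =
  pure_word n b (iter m (return_step (side_subst s b) K w) v).
Proof.
move=> Hw rv; have Hb := primitive_side b Hs.
elim: m => // m IHm; rewrite iterS IHm stepE iter_phi_pw; last first.
  by have := return_inalph Hb rv m; rewrite side_inalph.
by have [e [_ _ -> _]] := return_spec Hb rv m; rewrite pure_word_cat mulKg.
Qed.

Lemma step_wpow b K w l m : inalph N w ->
  iter m (sdesc_step phi0 (pure_word n b w, (K * k0)%N,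
    l)) (pure_word n (~~ b) (rev w)) =
  pure_word n (~~ b) (rev (wpow (side_subst s b) K w m.+1)).
Proof.
move=> Hw; have Hb := primitive_side b Hs.
elim: m => [|m IHm]; first by rewrite wpow1.
rewrite iterS IHm stepE -2!pure_word_inv (endo_iterV phiM) iter_phi_pw ?wpow_inalph //.
by rewrite -invgM -pure_word_cat -wpowS.
Qed.

Definition valid_entry (f : FN N -> FN N) (uv : FN N * FN N) :=
  [&& pure_negative uv.1, pure_negative (f uv.1), proper_prefix uv.1 (f uv.1),
      pure_positive uv.2, pure_positive (f uv.2) & proper_prefix uv.2 (f uv.2)].

Definition valid_side b (f : FN N -> FN N) (u : FN N) :=
  if b then [&& pure_negative u, pure_negative (f u) & proper_prefix u (f u)]
  else [&& pure_positive u, pure_positive (f u) & proper_prefix u (f u)].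

Lemma valid_entryE b f u v :
  valid_entry f (signed_pair b u v) = valid_side b f u && valid_side (~~ b) f v.
Proof.
by case: b; rewrite /valid_entry /valid_side /=; first rewrite -!andbA //;
  rewrite [RHS]andbC -!andbA.
Qed.

Lemma valid_sideP b f x y : f (pure_word n b x) = pure_word n b y -> prefix x y ->
  0 < size x < size y -> valid_side b f (pure_word n b x).
Proof.
move=> E xy /andP[x0 sxy]; have y0 := ltn_trans x0 sxy.
have nz c z : 0 < size z -> pure_word n c z != 1.
  by move=> z0; apply: contraTneq z0 => /(congr1 (@fword N))/(congr1 size) /=;
    rewrite size_map => ->.
have pz c z : all (fun l : letter N => l.2 == c) (pure_seq n c z) :=
  pure_seq_pure n c z.
have pt z : all (fun l : letter N => l.2) (pure_seq n true z).
  by apply: sub_all (pz true z) => l /eqP.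
have pf z : all (fun l : letter N => ~~ l.2) (pure_seq n false z).
  by apply: sub_all (pz false z) => l /eqP->.
have pp : proper_prefix (pure_word n b x) (pure_word n b y).
  by rewrite /proper_prefix prefix_pw // !size_pw.
by rewrite /valid_side E; case: b pp {E} => ->; rewrite andbT;
  rewrite /pure_negative /pure_positive !nz //= ?pt ?pf.
Qed.

Lemma branching_desc_valid L b w (vs : seq (seq nat)) :
  cancel_length (side_subst s b) L ->
  (w, vs) \in branchings (side_subst s b) L ->
  sdesc_valid phi0 (branching_desc b (period_exp (side_subst s b) L) w vs).
Proof.
move=> HL wvs; have Hb := primitive_side b Hs.
have [w0 Hw El _] := branchingsP Hb HL wvs; rewrite side_inalph in Hw.
set K := period_exp _ _; have K0 : 0 < K := period_exp_gt0 _ _.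
rewrite /sdesc_valid /= muln_gt0 K0 k0_gt0 /=.
set f := sdesc_step _ _; apply/allP => _ /mapP[v vl ->].
rewrite El in vl; have [rv _ vL _] := branches_return Hb HL vl.
have v0 : 0 < size v by rewrite vL; case/andP: HL.
have Vv : valid_side b f (pure_word n b v).
  apply: (valid_sideP (step_returns _ 1 Hw rv));
    first exact: (return_chain Hb rv 0).
  by rewrite v0 /=; have := return_long Hb rv 1; rewrite addn1.
have Vw : valid_side (~~ b) f (pure_word n (~~ b) (rev w)).
  apply: (valid_sideP (@step_wpow b K w _ 1%N Hw)).
    by rewrite wpowS wpow1 rev_cat prefix_prefix.
  rewrite !size_rev wpowS wpow1 size_cat lt0n size_eq0 w0 /=.
  have := size_iter_sub Hb K (_ : inalph (size (side_subst s b)) w).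
  rewrite side_inalph => /(_ Hw); have : 0 < size w by rewrite lt0n size_eq0.
  by lia.
change (valid_entry f (signed_pair b (pure_word n b v) (pure_word n (~~ b) (rev w)))).
by rewrite valid_entryE Vv Vw.
Qed.

Lemma branching_desc_pointsP L b w (vs : seq (seq nat)) P :
  cancel_length (side_subst s b) L ->
  (w, vs) \in branchings (side_subst s b) L ->
    let K := period_exp (side_subst s b) L in
  sdesc_points phi0 (branching_desc b K w vs) P <->
  exists2 v, v \in vs & [/\ forall c, signed c (side c P),
    forall m, starts (iter m (return_step (side_subst s b) K w) v) (ray_letters (side b P)) &
    forall m, starts (rev (wpow (side_subst s b) K w m)) (ray_letters (side (~~ b) P))].
Proof.
move=> HL wvs K; have Hb := primitive_side b Hs.
have [w0 Hw El _] := branchingsP Hb HL wvs.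
have w_gt0 : 0 < size w by rewrite lt0n size_eq0.
set f := sdesc_step phi0 (branching_desc b K w vs).
have Ew V : tends_to (fun m => iter m f (pure_word n (~~ b) (rev w))) V <->
    signed (~~ b) V /\ forall m,
      starts (rev (wpow (side_subst s b) K w m)) (ray_letters V).
  have Hw' : inalph N w by rewrite -(side_inalph b).
  rewrite (tends_to_iter V (fun m => step_wpow b K _ m Hw')); last first.
  - by move=> m; rewrite /inalph all_rev; apply: wpow_inalph.
  - by move=> m; rewrite size_rev;
    apply: leq_trans (leqnSn m) (size_wpow Hb K _ Hw w_gt0).
  - by move=> m; rewrite [in X in prefix _ X]wpowSr rev_cat prefix_prefix.
  split=> -[sV H]; split=> // m; apply: starts_prefix (H m).
  by rewrite wpowSr rev_cat prefix_prefix.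
have Ev v V : v \in vs -> tends_to (fun m => iter m f (pure_word n b v)) V <->
    signed b V /\ forall m,
      starts (iter m (return_step (side_subst s b) K w) v) (ray_letters V).
  rewrite El => vl; have [rv _ _ _] := branches_return Hb HL vl.
  apply: tends_to_iter => m.
  - by apply: step_returns; rewrite -?(side_inalph b).
  - exact: return_chain.
  - exact: leq_trans (leq_addl _ _) (return_long Hb rv m).
  - by rewrite -(side_inalph b); apply: return_inalph.
split=> [[_ [/mapP[v vl ->]]]|[v vl [sP vP wP]]].
  case: P => U V; case: (b) @f Ew Ev => f /= Ew Ev h1 h2.
    have [sV hV] := (Ew _).1 h2; have [sU hU] := (Ev _ _ vl).1 h1.
    by exists v => //; split=> // -[].
  have [sV hV] := (Ew _).1 h1; have [sU hU] := (Ev _ _ vl).1 h2.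
  by exists v => //; split=> // -[].
exists (signed_pair b (pure_word n b v) (pure_word n (~~ b) (rev w))).
rewrite (map_f (fun v => signed_pair b (pure_word n b v) _) vl).
have hv := (Ev _ (side b P) vl).2 (conj (sP b) vP).
have hw := (Ew (side (~~ b) P)).2 (conj (sP (~~ b)) wP).
by split=> //; case: (b) @f hv hw {Ew Ev} => f /=.
Qed.

Lemma pair_side b (U V : bd N) : exists P, side b P = V /\ side (~~ b) P = U.
Proof. by case: b; [exists (V, U) | exists (U, V)]. Qed.

Lemma side_neq b P Q : ray_letters (side b P) 0 != ray_letters (side b Q) 0 ->
  P.2 0 <> Q.2 0 \/ P.1 0 <> Q.1 0.
Proof.
rewrite /ray_letters; case: b => /= PQ; [right | left]; move=> E.
  by rewrite E eqxx in PQ.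
by rewrite E eqxx in PQ.
Qed.

Lemma neq_side P Q : (forall c, signed c (side c P)) ->
  (forall c, signed c (side c Q)) -> P.2 0 <> Q.2 0 \/ P.1 0 <> Q.1 0 ->
  exists b, ray_letters (side b P) 0 != ray_letters (side b Q) 0.
Proof.
have H (b : bool) (U V : bd N) : signed b U -> signed b V -> U 0 <> V 0 ->
  ray_letters U 0 != ray_letters V 0.
  move=> Ub Vb UV; apply/eqP => /val_inj E; apply: UV.
  by rewrite [U 0]surjective_pairing [V 0]surjective_pairing Ub Vb E.
by move=> sP sQ [h|h]; [exists false | exists true];
  apply: H h; do 1?[exact: sP false | exact: sQ false | exact: sP true |
    exact: sQ true].
Qed.

Lemma branching_desc_singular L b w (vs : seq (seq nat)) :
  cancel_length (side_subst s b) L ->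
  (w, vs) \in branchings (side_subst s b) L ->
    let K := period_exp (side_subst s b) L in
  singular_for (inner (pure_word n b w) \o iter K phi) (sdesc_points phi0 (branching_desc b K w vs)).
Proof.
move=> HL wvs K; have Hb := primitive_side b Hs.
have [w0 Hw El [v1 [v2 [v1l v2l v12]]]] := branchingsP Hb HL wvs.
have w_gt0 : 0 < size w by rewrite lt0n size_eq0.
have ptP P := branching_desc_pointsP P HL wvs.
have rP v : v \in vs ->
  [/\ returns (side_subst s b) K w v, lang (side_subst s b) (w ++ v) & size v = L].
  by rewrite El => /(branches_return Hb HL)[].
have gd P : sdesc_points phi0 (branching_desc b K w vs) P -> subshift_point P.
  case/ptP => v vl [sP vP wP]; apply: (side_subshift (b := b)) => //.
  have [rv lv _] := rP _ vl.
  exact: (wpow_return_admissible Hb Hw w_gt0 rv lv wP vP).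
split=> //.
- have [U Up] := wpow_lim Hb K Hw w_gt0.
  have pt v : v \in vs -> exists2 P, sdesc_points phi0 (branching_desc b K w vs) P &
      ray_letters (side b P) 0 = head 0 v.
    move=> vl; have [rv lv vL] := rP _ vl; have [V Vp] := return_lim Hb rv.
    have VN m : V m < N.
      have := return_inalph Hb rv m.+1; rewrite side_inalph => /allP; apply.
      rewrite -(starts_nth (Vp m.+1)) ?mem_nth //;
      by apply: leq_trans (leq_addl _ _) (return_long Hb rv m.+1).
    have UN m : U m < N.
      have := wpow_inalph b K m.+1 (_ : inalph N w);
        rewrite -(side_inalph b) => /(_ Hw)/allP.
      apply; rewrite -mem_rev -(starts_nth (Up m.+1)) ?mem_nth // ?size_rev;
      by apply: (size_wpow Hb K m.+1 Hw w_gt0).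
    have [P [Eb EN]] := pair_side b (ray n (~~ b) U) (ray n b V).
    exists P.
      apply/ptP; exists v => //; split; last 2 first.
      - by move=> m; rewrite Eb; apply: eq_starts (Vp m) => j;
        rewrite ray_letters_ray.
      - by move=> m; rewrite EN; apply: eq_starts (Up m) => j;
        rewrite ray_letters_ray.
      move=> c; case: (eqVneq c b) => [->|cb]; first by rewrite Eb.
      have -> : c = ~~ b by case: c cb; case: (b).
      by rewrite EN.
    rewrite Eb ray_letters_ray // -(starts_nth (Vp 0)) ?nth0 //= vL;
      by case/andP: HL.
  have [P1 p1 E1] := pt _ v1l; have [P2 p2 E2] := pt _ v2l.
  by exists P1, P2; split=> //; apply: (@side_neq b); rewrite E1 E2.
- move=> P pP; have gP := gd _ pP; have [v vl [sP vP wP]] := (ptP _).1 pP.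
  have [rv _ _] := rP _ vl.
  apply/fixes_pw => //; first by rewrite -(side_inalph b).
  by split; [apply: (return_fixes_forward Hb rv vP) |
    apply: (wpow_fixes_backward Hb Hw w_gt0 wP)].
move=> h P h0 gP; rewrite iter_inner -?(side_inalph b) //.
move/fixes_pw => /(_ _ gP)[|fV fU]; first by apply: wpow_inalph;
  rewrite -(side_inalph b).
have [v vl vV] := branchings_maximal Hb HL wvs h0 (subshift_side b gP) fV fU.
have [rv _ _] := rP _ vl.
apply/ptP; exists v => //; split.
- by move=> c; apply: subshift_signed.
- exact: (returns_unique Hb h0 rv fV vV).
- exact: (fixes_backward_unique h0 fU).
Qed.

(** A common multiple of the periods of the letters under the action of the
substitution on first letters, and of its mirror image. *)
Definition letter_exp := (size s)`!.
Local Notation KL := letter_exp.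

Lemma letter_pairsE (x y : nat) : (x, y) \in letter_pairs s ->
  forall c, returns (side_subst s c) KL [::] [:: if c then x else y].
Proof. by case/(letter_pairsP Hs) => _ ry rx []. Qed.

Lemma step_letter l c (x : nat) m : returns (side_subst s c) KL [::] [:: x] ->
  iter m (sdesc_step phi0 (1, (KL * k0)%N, l)) (pure_word n c [:: x]) =
  pure_word n c (iter m (return_step (side_subst s c) KL [::]) [:: x]).
Proof. by move=> rx; rewrite -(pure_word_nil n c); apply: step_returns. Qed.

Lemma letter_desc_valid : sdesc_valid phi0 (letter_desc KL (letter_pairs s)).
Proof.
rewrite /sdesc_valid /= muln_gt0 fact_gt0 k0_gt0 /=.
set f := sdesc_step _ _; apply/allP => _ /mapP[[x y] /letter_pairsE ret ->].
have V c : valid_side c f (pure_word n c [:: if c then x else y]).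
  have Hc := primitive_side c Hs.
  apply: (valid_sideP (@step_letter _ c _ 1%N (ret c))).
    exact: (return_chain Hc (ret c) 0).
  exact: (return_long Hc (ret c) 1).
have := valid_entryE true f (pure_word n true [:: x]) (pure_word n false [:: y]).
by rewrite (V true) (V false).
Qed.

Lemma letter_desc_pointsP P :
  sdesc_points phi0 (letter_desc KL (letter_pairs s)) P <->
  exists x y : nat, (x, y) \in letter_pairs s /\ forall c, signed c (side c P) /\
    forall m, starts (iter m (return_step (side_subst s c) KL [::]) [:: if c then x else y])
      (ray_letters (side c P)).
Proof.
set f := sdesc_step phi0 (letter_desc KL (letter_pairs s)).
have E (x y : nat) c V : (x, y) \in letter_pairs s ->
    tends_to (fun m => iter m f (pure_word n c [:: if c then x else y])) V <->
    signed c V /\ forall m,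
      starts (iter m (return_step (side_subst s c) KL [::]) [:: if c then x else y]) (ray_letters V).
  move=> /letter_pairsE/(_ c) rc; have Hc := primitive_side c Hs.
  apply: tends_to_iter => m.
  - exact: step_letter.
  - exact: return_chain.
  - exact: leq_trans (leq_addl _ _) (return_long Hc rc m).
  - by rewrite -(side_inalph c); apply: return_inalph.
split=> [[_ [/mapP[[x y] xy ->] /= h1 h2]]|[x [y [xy Hc]]]].
  exists x, y; split=> // -[].
    exact: ((E x y true _ xy).1 h1).
  exact: ((E x y false _ xy).1 h2).
exists (pure_word n true [:: x], pure_word n false [:: y]); split.
- exact: (map_f (fun p =>
  (pure_word n true [:: p.1], pure_word n false [:: p.2])) xy).
- exact: ((E x y true _ xy).2 (Hc true)).
- exact: ((E x y false _ xy).2 (Hc false)).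
Qed.

Lemma letter_desc_singular (p q : nat * nat) :
  p \in letter_pairs s -> q \in letter_pairs s -> p != q ->
  singular_for (inner 1 \o iter KL phi)
    (sdesc_points phi0 (letter_desc KL (letter_pairs s))).
Proof.
move=> pl ql pq.
have gd P : sdesc_points phi0 (letter_desc KL (letter_pairs s)) P ->
  subshift_point P.
  case/letter_desc_pointsP => x [y [xy H]].
  apply: (@side_subshift false) => [c|]; first by case: (H c).
  exact: (letter_pairs_admissible Hs xy (H true).2 (H false).2).
have pt (x y : nat) : (x, y) \in letter_pairs s ->
    exists2 P, sdesc_points phi0 (letter_desc KL (letter_pairs s)) P &
    ray_letters P.1 0 = x /\ ray_letters P.2 0 = y.
  move=> xy; have ret := letter_pairsE xy.
  have lim c : exists V : bd N, signed c V /\ forall m,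
      starts (iter m (return_step (side_subst s c) KL [::]) [:: if c then x else y]) (ray_letters V).
    have Hc := primitive_side c Hs; have [V Vp] := return_lim Hc (ret c).
    exists (ray n c V); split=> // m; apply: eq_starts (Vp m) => j;
      rewrite ray_letters_ray // => {}j.
    have := return_inalph Hc (ret c) j.+1; rewrite side_inalph => /allP; apply.
    rewrite -(starts_nth (Vp j.+1)) ?mem_nth //;
    by apply: leq_trans (leq_addl _ _) (return_long Hc (ret c) j.+1).
  have [U [sU Up]] := lim true; have [V [sV Vp]] := lim false.
  exists (U, V).
    by apply/letter_desc_pointsP; exists x, y; split=> // -[].
  by split; [rewrite -(starts_nth (Up 0)) | rewrite -(starts_nth (Vp 0))].
split=> //.
- case: p q pl ql pq => x y [x' y'] /pt[P pP [Px Py]] /pt[Q pQ [Qx Qy]].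
  rewrite xpair_eqE negb_and => pq; exists P, Q; split=> //.
  case/orP: pq => h; first by apply: (@side_neq true); rewrite /= Px Qx.
  by apply: (@side_neq false); rewrite /= Py Qy.
- move=> P pP; have gP := gd _ pP.
  have [x [y [xy H]]] := (letter_desc_pointsP P).1 pP; have ret := letter_pairsE xy.
  rewrite -(pure_word_nil n false); apply/fixes_pw => //; split.
    exact: (return_fixes_forward Hs (ret false) (H false).2).
  apply/fixes_backward_forward.
  exact: (return_fixes_forward (primitive_mirror Hs) (ret true) (H true).2).
move=> h P h0 gP; rewrite -(pure_word_nil n false) iter_inner // wpow_nil.
move/fixes_pw => /(_ isT gP)[fV /fixes_backward_forward fU].
have [_ _ gUV] := gP; have hK : 0 < KL * h by rewrite muln_gt0 fact_gt0.
have xy := letter_pairs_maximal Hs hK gUV fV fU; have ret := letter_pairsE xy.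
apply/letter_desc_pointsP; eexists; eexists; split; first exact: xy.
case; split; try exact: (subshift_signed _ gP).
  by apply: (returns_unique (primitive_mirror Hs) h0 (ret true)); rewrite ?wpow_nil.
by apply: (returns_unique Hs h0 (ret false)); rewrite ?wpow_nil.
Qed.

(** The sign of the word [w] of the map decides between the list of letters and the
branchings of one of the two substitutions. *)
Lemma singular_complete (w : FN N) k Omega : 0 < k ->
  singular_for (inner w \o iter k phi) Omega ->
  (exists p q, [/\ p \in letter_pairs s, q \in letter_pairs s, p != q &
     Omega = sdesc_points phi0 (letter_desc KL (letter_pairs s))]) \/
  (exists b, forall L, cancel_length (side_subst s b) L -> exists w1 vs,
     (w1, vs) \in branchings (side_subst s b) L /\
     Omega = sdesc_points phi0 (branching_desc b (period_exp (side_subst s b) L) w1 vs)).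
Proof.
move=> k0' sO; have [gO [P [Q [OP OQ PQ]]] fO _] := sO.
have [gP gQ] := (gO _ OP, gO _ OQ).
have [b [x [Hx Ew]]] := fixes_pure Hne sN phi_pw (subshift_opposite gP) (fO _ OP).
have sP c := subshift_signed c gP; have sQ c := subshift_signed c gQ.
have [c Pc] := neq_side sP sQ PQ.
case: (eqVneq x [::]) => [x0|x0].
  have lc R : Omega R -> (ray_letters R.1 0, ray_letters R.2 0) \in letter_pairs s.
    move=> OR; have gR := gO _ OR; have := fO _ OR.
    rewrite Ew x0 (_ :
      pure_word n b [::] =
        pure_word n false [::]) ?pure_word_nil // -(pure_word_nil n false).
    move/fixes_pw => /(_ isT gR)[fV /fixes_backward_forward fU];
      case: (gR) => _ _ gUV.
    exact: (letter_pairs_maximal Hs k0' gUV fV fU).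
  left; exists (ray_letters P.1 0, ray_letters P.2 0), (ray_letters Q.1 0,
    ray_letters Q.2 0).
  have pq : (ray_letters P.1 0, ray_letters P.2 0) != (ray_letters Q.1 0,
    ray_letters Q.2 0).
    by rewrite xpair_eqE negb_and; case: (c) Pc => /= ->; rewrite ?orbT.
  split; [exact: lc | exact: lc | exact: pq |].
  have KL0 : 0 < KL by exact: fact_gt0.
  apply: (singular_unique KL0 k0' sO (letter_desc_singular (lc _ OP) (lc _ OQ) pq)).
  rewrite Ew x0 -(pure_word_nil n b) !iter_inner // !wpow_nil.
  by rewrite [(k * _)%N]mulnC.
right; exists b => L HL; have Hb := primitive_side b Hs.
have := fO _ OP; rewrite Ew => /fixes_pw => /(_ Hx gP)[fP nP].
have := fO _ OQ; rewrite Ew => /fixes_pw => /(_ Hx gQ)[fQ nQ].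
have x_gt0 : 0 < size x by rewrite lt0n size_eq0.
have Eside : side (~~ b) P = side (~~ b) Q.
  apply: (signed_ray_ext (sP _) (sQ _)); apply: starts_eqfun => m.
  apply: starts_prefix (fixes_backward_wpow m nQ);
    apply: starts_comp (starts_mkseq _ m) (fixes_backward_wpow m nP) _.
  by rewrite size_mkseq size_rev (size_wpow Hb) ?side_inalph.
have {}Pc : ray_letters (side b P) 0 != ray_letters (side b Q) 0.
  case: (eqVneq c b) => [<- //|cb]; case/negP: Pc.
  have -> : c = ~~ b by case: c cb; case: (b).
  by rewrite Eside.
have gP' := subshift_side b gP; have gQ' := subshift_side b gQ.
rewrite Eside in gP' nP.
have [w1 [w1c E]] := branchings_complete Hb HL k0' x0 gP' gQ' Pc fP fQ nP.
exists w1; eexists; split; first exact: w1c.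
have K0 : 0 < period_exp (side_subst s b) L := period_exp_gt0 _ _.
apply: (singular_unique K0 k0' sO (branching_desc_singular HL w1c)).
have [_ Hw1 _ _] := branchingsP Hb HL w1c; rewrite side_inalph in Hw1.
by rewrite Ew !iter_inner // E [(k * _)%N]mulnC.
Qed.

End Singularities.

(** * The shift *)

Lemma shift_admissible s (U V U' V' : nat -> nat) : U' 0 = V 0 ->
  (forall j, U' j.+1 = U j) -> (forall j, V' j = V j.+1) ->
  admissible s U V -> admissible s U' V'.
Proof.
move=> U0 US VS gUV; apply: admissible_long => m.
have mkS (f : nat -> nat) i : mkseq f i.+1 = f 0 :: mkseq (fun j => f j.+1) i.
  by rewrite /mkseq /= -[1%N]addn0 iotaDl -map_comp.
exists (mkseq U' m.+1), (mkseq V' m); rewrite !size_mkseq.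
split=> //; try exact: starts_mkseq.
have -> : mkseq U' m.+1 = V 0 :: mkseq U m.
  by rewrite mkS U0; congr (_ :: _); apply: eq_mkseq.
rewrite rev_cons -cats1 -catA /=; apply: admissible_starts gUV (starts_mkseq U m) _.
have -> : V 0 :: mkseq V' m = mkseq V m.+1.
  by rewrite mkS; congr (_ :: _); apply: eq_mkseq.
exact: starts_mkseq.
Qed.

Section Shift.
Variable n : nat.
Local Notation N := n.+1.
Variable s : seq (seq nat).
Implicit Types (P Q : bd N * bd N) (l r : seq nat).
Local Notation subshift_point := (@subshift_point n s).

Lemma bdact_inv_letter (x : letter N) (V : bd N) m :
  (bdact (letterF x)^-1 V) m = lact_fun (linv x) V m.
Proof. by []. Qed.

Lemma shiftE P : signed true P.1 -> signed false P.2 ->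
  [/\ signed true (shift P).1, signed false (shift P).2,
      ray_letters (shift P).1 0 = ray_letters P.2 0,
      forall j, ray_letters (shift P).1 j.+1 = ray_letters P.1 j &
      forall j, ray_letters (shift P).2 j = ray_letters P.2 j.+1].
Proof.
move=> s1 s2; set x := P.2 0.
have E2 m : (shift P).2 m = P.2 m.+1.
  by rewrite bdact_inv_letter /lact_fun -/x linvK eqxx.
have E1 m : (shift P).1 m = if m is m'.+1 then P.1 m' else linv x.
  rewrite bdact_inv_letter /lact_fun -/x linvK; case: eqP => // E.
  by have := s1 0; rewrite E s2.
split=> [[|m]|m||j|j]; rewrite /ray_letters ?E1 ?E2 //.
by rewrite /= /x s2.
Qed.

Lemma unshiftE P : signed true P.1 -> signed false P.2 ->
  [/\ signed true (unshift P).1, signed false (unshift P).2,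
      ray_letters (unshift P).2 0 = ray_letters P.1 0,
      forall j, ray_letters (unshift P).2 j.+1 = ray_letters P.2 j &
      forall j, ray_letters (unshift P).1 j = ray_letters P.1 j.+1].
Proof.
move=> s1 s2; set x := P.1 0.
have E2 m : (unshift P).1 m = P.1 m.+1.
  by rewrite bdact_inv_letter /lact_fun -/x linvK eqxx.
have E1 m : (unshift P).2 m = if m is m'.+1 then P.2 m' else linv x.
  rewrite bdact_inv_letter /lact_fun -/x linvK; case: eqP => // E.
  by have := s2 0; rewrite E s1.
split=> [m|[|m]||j|j]; rewrite /ray_letters ?E1 ?E2 //.
by rewrite /= /x s1.
Qed.

Lemma shift_subshift P : subshift_point P -> subshift_point (shift P).
Proof.
case=> s1 s2 gP; have [h1 h2 h3 h4 h5] := shiftE s1 s2; split=> //.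
exact: shift_admissible gP.
Qed.

Lemma unshift_subshift P : subshift_point P -> subshift_point (unshift P).
Proof.
case=> s1 s2 gP; have [h1 h2 h3 h4 h5] := unshiftE s1 s2; split=> //.
by apply/admissible_mirror; apply: shift_admissible h3 h4 h5 _;
  apply/admissible_mirror.
Qed.

Lemma orbit_subshift P Q : subshift_point P -> shift_orbit P Q -> subshift_point Q.
Proof.
move=> gP [m [->|->]]; elim: m => //= m.
  exact: shift_subshift.
exact: unshift_subshift.
Qed.

Lemma closure2_subshift (E : set (bd N * bd N)) P :
  (forall Q, E Q -> subshift_point Q) -> closure2 E P -> subshift_point P.
Proof.
move=> gE [_ near].
have nthp (V W : bd N) m : pref V m.+1 = pref W m.+1 -> V m = W m.
  move=> E'; have := congr1 (fun t => nth (V 0) t m) E'.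
  by rewrite !nth_mkseq.
split=> [m|m|m].
- by have [Q /gE[s1 _ _] [E1 _]] := near m.+1; rewrite -(nthp _ _ _ E1).
- by have [Q /gE[_ s2 _] [_ E2]] := near m.+1; rewrite -(nthp _ _ _ E2).
have [Q /gE[_ _ gQ] [E1 E2]] := near m.
have nup (V : bd N) :
  letters_of (pref V m) = mkseq (ray_letters V) m by rewrite /letters_of -map_comp.
by rewrite -!nup -E1 -E2 !nup.
Qed.

Lemma starts_shift (V V' : nat -> nat) a r :
  (forall j, V' j = V j.+1) -> starts (a :: r) V -> a = V 0 /\ starts r V'.
Proof.
move=> VS; rewrite /starts /mkseq /= => -[E1 E2]; split=> //.
by rewrite -{2}E2 -[1%N]addn0 iotaDl -map_comp; apply: eq_map => j /=; rewrite VS.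
Qed.

Lemma starts_unshift (V V' : nat -> nat) a r :
  (forall j, V' j.+1 = V j) -> V' 0 = a -> starts r V -> starts (a :: r) V'.
Proof.
move=> VS V0; rewrite /starts /mkseq /= V0 => {2}<-.
rewrite -[1%N]addn0 iotaDl -map_comp; congr (_ :: _).
by apply: eq_map => j /=; rewrite VS.
Qed.

Lemma iter_shift P l r1 r2 : signed true P.1 -> signed false P.2 ->
  starts (rev l) (ray_letters P.1) -> starts (r1 ++ r2) (ray_letters P.2) ->
  let Q := iter (size r1) (@shift N) P in
  starts (rev (l ++ r1)) (ray_letters Q.1) /\ starts r2 (ray_letters Q.2).
Proof.
elim: r1 l P => [|a r1 IHr] l P s1 s2 lP rP Q; first by rewrite cats0.
have -> : Q = iter (size r1) (@shift N) (shift P) by rewrite -iterSr.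
have [h1 h2 h3 h4 h5] := shiftE s1 s2.
have [Ea {}rP] := starts_shift h5 rP.
rewrite -cat1s catA; apply: IHr => //.
by rewrite cats1 rev_rcons; apply: starts_unshift h4 _ lP; rewrite Ea.
Qed.

Lemma iter_unshift P l1 l2 r : signed true P.1 -> signed false P.2 ->
  starts (rev (l1 ++ l2)) (ray_letters P.1) -> starts r (ray_letters P.2) ->
  let Q := iter (size l2) (@unshift N) P in
  starts (rev l1) (ray_letters Q.1) /\ starts (l2 ++ r) (ray_letters Q.2).
Proof.
elim/last_ind: l2 r P => [|l2 a IHl] r P s1 s2 lP rP Q;
  first by rewrite cats0 in lP.
have -> : Q = iter (size l2) (@unshift N) (unshift P).
  by rewrite /Q size_rcons iterSr.
have [h1 h2 h3 h4 h5] := unshiftE s1 s2.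
move: lP; rewrite -rcons_cat rev_rcons => /(starts_shift h5)[Ea lP].
rewrite -cats1 -catA; apply: IHl => //.
by apply: starts_unshift h4 _ rP; rewrite Ea.
Qed.

End Shift.

(** * The attracting subshift *)

(** The words on the left and on the right of [i] in [T^(j+1) (i)], when [i] occurs
in [T (i)] between [p] and [q]. *)
Fixpoint left_word (T : seq nat -> seq nat) (p : seq nat) j : seq nat :=
  if j is j'.+1 then iter j T p ++ left_word T p j' else p.

Fixpoint right_word (T : seq nat -> seq nat) (q : seq nat) j : seq nat :=
  if j is j'.+1 then right_word T q j' ++ iter j T q else q.

Section Attracting.
Variable n : nat.
Local Notation N := n.+1.
Variables (s : seq (seq nat)) (phi : FN N -> FN N) (k : nat).
Local Notation p := (subst_power s k).
Hypotheses (Hs : nonerasing s) (sN : size s = N).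
Hypothesis phiM : {morph phi : u v / u * v}.
Hypothesis phi_pw : forall b x, inalph N x ->
  phi (pure_word n b x) = pure_word n b (sub (side_subst s b) x).
Hypotheses (k_gt0 : 0 < k) (Hp : primitive_subst p).

Lemma gen_pw (i : 'I_N) : gen i = pure_word n false [:: val i].
Proof. by apply: val_inj; rewrite /= inord_val. Qed.

Let power_inalph b j x : inalph N x -> inalph N (iter j (sub (side_subst s b)) x).
Proof. exact: endo_inalph. Qed.

Let iter_pw := endo_iter_pw Hs sN phi_pw.

Section Pair.
Variables (i : 'I_N) (m : nat) (x y : seq nat).
Hypotheses (Hx : inalph N x) (Hy : inalph N y) (x0 : 0 < size x) (y0 : 0 < size y).
Hypothesis Eim : iter m (sub s) [:: val i] = x ++ val i :: y.
Local Notation T := (iter m (sub s)).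
Local Notation A := (left_word T x).
Local Notation B := (right_word T y).

Lemma left_right_word j : iter (j.+1 * m) (sub s) [:: val i] = A j ++ val i :: B j.
Proof.
elim: j => [|j IHj]; first by rewrite mul1n.
rewrite mulSnr iterD Eim iter_sub_cat -[val i :: y]cat1s iter_sub_cat IHj /=.
by rewrite -!iterS -!iterM -!catA.
Qed.

Lemma T_inalph j z : inalph N z -> inalph N (iter j T z).
Proof. by move=> Hz; rewrite -iterM; apply: (power_inalph false). Qed.

Lemma T_size j z : inalph N z -> size z <= size (iter j T z).
Proof.
by move=> Hz; rewrite -iterM; apply: nonerasing_size => //; rewrite sN.
Qed.

Lemma left_word_inalph j : inalph N (A j).
Proof.
elim: j => // j IHj; rewrite /inalph all_cat; apply/andP; split=> //.
exact: (T_inalph j.+1).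
Qed.

Lemma right_word_inalph j : inalph N (B j).
Proof.
elim: j => // j IHj; rewrite /inalph all_cat; apply/andP; split=> //.
exact: (T_inalph j.+1).
Qed.

Lemma left_word_size j : j < size (A j).
Proof.
elim: j => // j IHj; rewrite size_cat -[j.+2]add1n leq_add //.
exact: leq_trans x0 (T_size j.+1 Hx).
Qed.

Lemma right_word_size j : j < size (B j).
Proof.
elim: j => // j IHj; rewrite size_cat addnC -[j.+2]add1n leq_add //.
exact: leq_trans y0 (T_size j.+1 Hy).
Qed.

Lemma left_prod j :
  \prod_(0 <= l < j.+1) iter (l * m) phi (pure_word n false x)^-1 =
  pure_word n true (rev (A j)).
Proof.
rewrite pure_word_inv; elim: j => [|j IHj].
  by rewrite big_nat1.
rewrite big_nat_recr //= IHj iter_pw ?/inalph ?all_rev // [sub (side_subst _ _)]/=.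
rewrite [iter (j.+1 * m) _ _]iter_sub_mirror revK iterM -pure_word_cat -rev_cat.
by [].
Qed.

Lemma right_prod j :
  gen i * \prod_(0 <= l < j.+1) iter (l * m) phi (pure_word n false y) =
  pure_word n false (val i :: B j).
Proof.
rewrite gen_pw.
suff E : \prod_(0 <= l < j.+1) iter (l * m) phi (pure_word n false y) =
  pure_word n false (B j).
  by rewrite E -pure_word_cat.
elim: j => [|j IHj]; first by rewrite big_nat1.
by rewrite big_nat_recr //= IHj iter_pw // -pure_word_cat iterM.
Qed.

Lemma pair_limits P :
  tends_to (fun j =>
    \prod_(0 <= l < j.+1) iter (l * m) phi (pure_word n false x)^-1) P.1 /\
  tends_to (fun j =>
    gen i * \prod_(0 <= l < j.+1) iter (l * m) phi (pure_word n false y)) P.2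
  <-> [/\ signed true P.1, signed false P.2 & forall j,
        starts (rev (A j)) (ray_letters P.1) /\ starts (val i :: B j) (ray_letters P.2)].
Proof.
have -> : (fun j =>
  \prod_(0 <= l < j.+1) iter (l * m) phi (pure_word n false x)^-1) =
    fun j => pure_word n true (rev (A j)) by apply: funext => j; apply: left_prod.
have -> : (fun j =>
  gen i * \prod_(0 <= l < j.+1) iter (l * m) phi (pure_word n false y)) =
    fun j => pure_word n false (val i :: B j) by apply: funext => j;
      apply: right_prod.
have cA j : prefix (rev (A j)) (rev (A j.+1)) by rewrite rev_cat prefix_prefix.
have cB j : prefix (val i :: B j) (val i :: B j.+1).
  by rewrite prefix_cons eqxx prefix_prefix.
have sA j : j <= size (rev (A j)) by rewrite size_rev ltnW // left_word_size.
have sB j : j <= size (val i :: B j) by rewrite /= ltnW // ltnW // ltnS right_word_size.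
have HA j : inalph N (rev (A j)) by rewrite /inalph all_rev;
  apply: left_word_inalph.
have HB j : inalph N (val i :: B j) by rewrite /inalph /= ltn_ord;
  apply: right_word_inalph.
split=> [[h1 h2]|[s1 s2 H]].
  have [s1 p1] := tends_to_chain cA sA HA h1.
  by have [s2 p2] := tends_to_chain cB sB HB h2.
by split; apply: tends_to_starts => // j; have [] := H j.
Qed.

Lemma pair_exists : exists P : bd N * bd N,
  [/\ signed true P.1, signed false P.2 & forall j,
        starts (rev (A j)) (ray_letters P.1) /\ starts (val i :: B j) (ray_letters P.2)].
Proof.
have [U Up] : exists U, forall j, starts (rev (A j)) U.
  apply: lim_exists => j; first by rewrite rev_cat prefix_prefix.
  by rewrite size_rev ltnW // left_word_size.
have [V Vp] : exists V, forall j, starts (val i :: B j) V.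
  apply: lim_exists => j; first by rewrite prefix_cons eqxx prefix_prefix.
  by rewrite /= ltnW // ltnW // ltnS right_word_size.
exists (ray n true U, ray n false V); split=> // j.
split; [apply: eq_starts (Up j) | apply: eq_starts (Vp j)] => m';
  rewrite ray_letters_ray // => l.
  have /allP := left_word_inalph l; apply; rewrite -mem_rev -(starts_nth (Up l)).
    by rewrite mem_nth // size_rev left_word_size.
  by rewrite size_rev left_word_size.
have /allP : inalph N (val i :: B l).
  by rewrite /inalph /= ltn_ord; apply: right_word_inalph.
by apply; rewrite -(starts_nth (Vp l)) ?mem_nth //= ltnW // ltnS right_word_size.
Qed.

End Pair.

Lemma inalph_letter (i : 'I_N) : inalph N [:: val i].
Proof. by rewrite /inalph /= ltn_ord. Qed.

Lemma size_p : size p = N. Proof. by rewrite size_subst_power. Qed.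

Lemma attracting_pair_subshift P : attracting_pair phi P -> subshift_point p P.
Proof.
case=> i [m [x [y [[m0 px py E] lim]]]].
have pos (u : FN N) : pure_positive u -> exists2 z, u = pure_word n false z &
    inalph N z /\ 0 < size z.
  case/andP=> u1 up; exists (letters_of u); last first.
    split; first exact: letters_of_inalph.
    rewrite size_map lt0n; apply: contra u1 => /eqP/size0nil u0.
    by apply/eqP/val_inj.
  by rewrite pure_word_letters //; apply: sub_all up => l /negPf ->.
have [x' Ex [Hx x0]] := pos _ px; have [y' Ey [Hy y0]] := pos _ py.
rewrite {}Ex {}Ey {px py} in E lim.
have Eim : iter m (sub s) [:: val i] = x' ++ val i :: y'.
  move: E; rewrite gen_pw iter_pw ?inalph_letter // -!pure_word_cat.
  move/pure_word_inj => -> //; first by rewrite -catA.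
    exact: (power_inalph false m (inalph_letter i)).
  by rewrite /inalph !all_cat /= ltn_ord; apply/andP; split=> //; apply/andP.
have [s1 s2 H] := (@pair_limits i m x' y' Hx Hy x0 y0 P).1 lim.
split=> //; apply: admissible_long => j; have [h1 h2] := H j.
exists (rev (left_word (iter m (sub s)) x' j)),
  (val i :: right_word (iter m (sub s)) y' j).
split=> //.
- by rewrite size_rev ltnW // left_word_size.
- by rewrite /= ltnW // ltnW // ltnS right_word_size.
apply/(lang_subst_power Hs k_gt0 Hp); rewrite revK -(left_right_word Eim).
apply: lang_iter_sub; apply/(lang_subst_power Hs k_gt0 Hp).
by apply: (lang_letter Hp); rewrite size_p; apply: ltn_ord.
Qed.

(** In the third iterate the second block is interior and contains all letters. *)
Lemma interior_letter : exists x y,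
  [/\ inalph N x, inalph N y, 0 < size x, 0 < size y &
      iter (3 * k)%N (sub s) [:: 0%N] = x ++ 0%N :: y].
Proof.
have N0 : 0 < N by []; have N0p : 0 < size p by rewrite size_p.
have H0 : inalph N [:: 0%N] by [].
have H0p : inalph (size p) [:: 0%N] by rewrite size_p.
rewrite -(iter_subst_power Hs) ?sN // iterS.
have := size_iter_subS Hp 2 N0p; have := iter_sub_inalph Hp 2 H0p.
case: (iter 2 _ _) => [|a [|b [|c t]]] //; rewrite /inalph [all _ _]/=.
case/and4P=> aN bN cN Ht _.
have ai := image_inalph Hp a; have a1 := image_size Hp aN.
have ci := sub_inalph Hp (c :: t); have bi := image_inalph Hp b.
have cti : inalph (size p) (c :: t) by rewrite /inalph /= cN.
have c1 := size_sub Hp cti.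
have [p1 [p2 Eb]] : exists p1 p2, nth [::] p b = p1 ++ 0%N :: p2.
  have := image_full Hp bN N0p; case/splitPr: (nth _ _ _) / => p1 p2.
  by exists p1, p2.
rewrite Eb in bi; rewrite !size_p in ai ci bi.
have /and3P[Hp1 _ Hp2] : [&& inalph N p1, true & inalph N p2].
  by move: bi; rewrite /inalph all_cat /= => /andP[-> ->].
exists (nth [::] p a ++ p1), (p2 ++ sub p (c :: t)); split.
- by rewrite /inalph all_cat; apply/andP.
- by rewrite /inalph all_cat; apply/andP.
- by rewrite size_cat; apply: leq_trans (leq_addr _ _); apply: ltnW.
- by rewrite size_cat; apply: leq_trans (leq_addl _ _); apply: leq_trans c1.
by rewrite !sub_cons Eb -!catA.
Qed.

(** Around the origin the pair of limits shows the words [T^(j+1) (i)], and by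
primitivity every factor occurs in these; the shift moves it to the origin. *)
Lemma attracting_subshiftP P : attracting_subshift phi P <-> subshift_point p P.
Proof.
split=> [[XY XYa XYP]|gP].
  apply: closure2_subshift XYP => Q; apply: orbit_subshift;
    exact: attracting_pair_subshift.
have [x [y [Hx Hy x0 y0 E]]] := interior_letter.
have Eim : iter (3 * k)%N (sub s) [:: val (@ord0 n)] = x ++ val (@ord0 n) :: y := E.
have [XY XYlim] := @pair_exists ord0 (3 * k)%N x y Hx Hy x0 y0.
have [s1 s2 XYp] := XYlim.
have XYa : attracting_pair phi XY.
  exists ord0, (3 * k)%N, (pure_word n false x), (pure_word n false y); split.
    have pos z : 0 < size z -> pure_positive (pure_word n false z).
      move=> z0; apply/andP; split.
        apply: contraTneq z0 => /(congr1 (@fword N))/(congr1 size) /=.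
        by rewrite size_map => ->.
      by apply: sub_all (pure_seq_pure n false z) => l /eqP->.
    split; [by rewrite muln_gt0 k_gt0 | exact: pos | exact: pos |].
    by rewrite gen_pw iter_pw ?inalph_letter // Eim -!pure_word_cat -catA.
  by apply/(@pair_limits ord0 (3 * k)%N x y Hx Hy x0 y0).
exists XY => //; have [t1 t2 gUV] := gP; split=> [PP|m].
  by have := t1 0; rewrite PP t2.
have [j zj] : exists j, infix (rev (mkseq (ray_letters P.1) m) ++
  mkseq (ray_letters P.2) m)
    (left_word (iter (3 * k) (sub s)) x j ++ val (@ord0 n) ::
     right_word (iter (3 * k) (sub s)) y j).
  have [j zj] := gUV m; exists j; rewrite -(left_right_word Eim).
  move: zj; rewrite (iter_subst_power Hs) ?sN // => /infix_trans; apply.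
  have -> : (j.+1 * (3 * k) = j * k + (3 * k + 2 * j * k))%N by lia.
  rewrite iterD; apply: infix_iter_sub.
  have -> : (3 * k + 2 * j * k = (3 + 2 * j) * k)%N by lia.
  rewrite -(iter_subst_power Hs) ?sN //.
  elim: (3 + 2 * j)%N => [|d IHd]; first exact: infix_refl.
  exact: infix_trans IHd (iter_sub_growing Hp d).
have [pA pB] := XYp j; set A := left_word _ _ _ in zj pA.
set B := val _ :: _ in zj pB.
case/infixP: zj => c [d Ecd].
suff [l [r [Q [OQ [Ql Qr]]]]] : exists l r Q, shift_orbit XY Q /\
    starts (rev (l ++ rev (mkseq (ray_letters P.1) m))) (ray_letters Q.1) /\
    starts (mkseq (ray_letters P.2) m ++ r) (ray_letters Q.2).
  have gQ : subshift_point p Q.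
    by apply: orbit_subshift OQ; apply: attracting_pair_subshift.
  exists Q => //; have [q1 q2 _] := gQ.
  rewrite !(pref_signed m q1, pref_signed m q2, pref_signed m t1, pref_signed m t2).
  move: Ql Qr; rewrite rev_cat revK => /(starts_prefix (prefix_prefix _ _)) Ql.
  move=> /(starts_prefix (prefix_prefix _ _)) Qr.
  by move: Ql Qr; rewrite /starts !size_mkseq => -> ->.
pose z1 := c ++ rev (mkseq (ray_letters P.1) m);
  pose z2 := mkseq (ray_letters P.2) m ++ d.
have Ez : A ++ B = z1 ++ z2 by rewrite Ecd /z1 /z2 -!catA.
case: (leqP (size A) (size z1)) => h.
  have [r1 E1 E2] := cat_split Ez h.
  exists c, d, (iter (size r1) (@shift N) XY); split.
    by exists (size r1); left.
  rewrite -/z1 -/z2 E1; apply: iter_shift => //.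
  by rewrite -E2.
have [l2 E1 E2] := cat_split (esym Ez) (ltnW h).
exists c, d, (iter (size l2) (@unshift N) XY); split.
  by exists (size l2); right.
rewrite -/z1 -/z2 E2; apply: iter_unshift => //.
by rewrite -E1.
Qed.

End Attracting.

(** * Bounded cancellation *)

Section BoundedCancellation.
Variable n : nat.
Local Notation N := n.+1.
Variables (s : seq (seq nat)) (phi psi : FN N -> FN N).
Hypotheses (Hs : primitive_subst s) (sN : size s = N).
Hypotheses (phiM : {morph phi : u v / u * v}) (phiK : cancel phi psi).
Hypothesis psiK : cancel psi phi.
Hypothesis phi_pw : forall b x, inalph N x ->
  phi (pure_word n b x) = pure_word n b (sub (side_subst s b) x).

Lemma psiM : {morph psi : u v / u * v}.
Proof. by move=> u v; apply: (can_inj phiK); rewrite phiM !psiK. Qed.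

(** An automorphism multiplies lengths at most by the longest image of a letter. *)
Lemma size_psi : exists M, forall u : FN N, size (psi u) <= M * size u.
Proof.
exists (\max_(l : letter N) size (psi (letterF l))) => -[t rt] /=.
elim: t rt => [|l t IHt] rt.
  have -> : psi (Word rt) = 1.
    apply: (mulgI (psi 1)); rewrite -psiM mulg1; congr psi.
    by rewrite mul1g; apply: val_inj.
  by [].
have rt' : reduced t by apply: path_sorted rt.
have -> : Word rt = letterF l * Word rt' by apply: val_inj;
  rewrite [RHS]reduced_mul.
rewrite psiM; apply: leq_trans (size_mul _ _) _; rewrite [size _]/= mulnS.
by apply: leq_add (IHt _);
  apply: (@leq_bigmax _ (fun l : letter N => size (psi (letterF l)))).
Qed.

(** If the images of [x] and [x'] agree for long, then long prefixes [x1] and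
[x1'] have images that differ by a short word; so the preimage of that word,
which is the reduced word [x1^-1 x1'], is short. *)
Lemma bounded_cancellation : exists C, forall b x x', inalph N x -> inalph N x' ->
  head 0%N x != head 0%N x' ->
  size (lcp (sub (side_subst s b) x) (sub (side_subst s b) x')) <= C.
Proof.
have [M HM] := size_psi; pose m := \max_(t <- s) size t.
exists (m * (M * (m + m)) + m)%N => b x x' Hx Hx' xx'.
have sm i : size (nth [::] (side_subst s b) i) <= m.
  case: b => /=; last exact: size_nth_max.
  apply: leq_trans (size_nth_max _ _) _; rewrite /m /mirror big_map.
  by apply: eq_leq; apply: eq_bigr => t _; rewrite size_rev.
set c := lcp _ _.
have [x1 [r [x1x Ec rm]]] := prefix_sub_split sm (lcp_prefixl _ _ : prefix c _).
have [x2 [r' [x2x Ec' rm']]] := prefix_sub_split sm (lcp_prefixr _ _ : prefix c _).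
have Hp y z : prefix y z -> inalph N z -> inalph N y.
  by case/prefixP=> y' ->; rewrite /inalph all_cat => /andP[].
have [H1 H2] := (Hp _ _ x1x Hx, Hp _ _ x2x Hx').
have phiV u : phi u^-1 = (phi u)^-1.
  have E1 : phi 1 = 1 by apply: (mulgI (phi 1)); rewrite -phiM !mulg1.
  by apply/esym/mulg1_eq; rewrite -phiM mulgV.
pose u := (pure_word n b x1)^-1 * pure_word n b x2.
have Eu : phi u = pure_word n b r * (pure_word n b r')^-1.
  rewrite phiM phiV !phi_pw //;
    apply: (mulgI (pure_word n b (sub (side_subst s b) x1))).
  by rewrite mulVKg mulgA -pure_word_cat -Ec Ec' pure_word_cat mulgK.
have su : size u <= M * (m + m).
  rewrite -[u]phiK Eu; apply: leq_trans (HM _) _; rewrite leq_mul2l.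
  apply/orP; right; apply: leq_trans (size_mul _ _) _.
  by rewrite size_inv !size_pw leq_add.
have Esu : size u = (size x1 + size x2)%N.
  rewrite /u pure_word_inv reduced_mul ?size_cat ?size_pw ?size_rev //.
  case: x1 {Ec Eu su u} x1x H1 => [|i1 x1] x1x H1; first exact: fwordP.
  case: x2 {Ec'} x2x H2 => [|i2 x2] x2x H2; first by rewrite cats0; apply: fwordP.
  apply: (@reduced_cat _ _ _ (inord i1, b)); try exact: fwordP.
  move=> _; rewrite /= rev_cons /pure_seq map_rcons last_rcons /linv /= negbK.
  apply: contra xx' => /eqP[/(congr1 val)]; have /andP[i1N _] := H1;
    have /andP[i2N _] := H2.
  rewrite /= !inordK // => E.
  by case/prefixP: x1x => ? ->; case/prefixP: x2x => ? ->; rewrite /= E.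
rewrite Ec size_cat leq_add //; apply: leq_trans (size_sub_le _ sm) _.
by rewrite leq_mul2l; apply/orP; right; apply: leq_trans su; rewrite Esu leq_addr.
Qed.

Lemma cancel_length_exists :
  exists L, cancel_length s L && cancel_length (mirror s) L.
Proof.
have [C HC] := bounded_cancellation; exists C.+1.
suff H b : cancel_length (side_subst s b) C.+1 by rewrite (H false) (H true).
apply/andP; split=> //; apply/allP => d /windowsP[dd s1 s2 H1 H2] /=.
rewrite size_side_subst sN in H1 H2; have c := HC b _ _ H1 H2 dd.
have Hb := primitive_side b Hs.
have := size_sub Hb (_ : inalph _ d.1); have := size_sub Hb (_ : inalph _ d.2).
rewrite size_side_subst sN => /(_ H2) h2 /(_ H1) h1.
rewrite s1 -addnn in h1; rewrite s2 -addnn in h2; apply/andP; split.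
  by apply: leq_trans h1; rewrite ltn_add2l ltnS.
by apply: leq_trans h2; rewrite ltn_add2l ltnS.
Qed.

End BoundedCancellation.

(** * Correctness of the algorithm *)

Lemma enc_seq_map A B (f : A -> B) (e : B -> tree) s :
  enc_seq e (map f s) = enc_seq (e \o f) s.
Proof. by elim: s => //= x s ->. Qed.

Lemma eq_enc_seq (A : eqType) (e e' : A -> tree) s :
  {in s, e =1 e'} -> enc_seq e s = enc_seq e' s.
Proof.
elim: s => //= x s IHs E; rewrite (E x) ?mem_head // IHs // => y ys.
by apply: E; rewrite inE ys orbT.
Qed.

Section Input.
Variable n : nat.
Local Notation N := n.+1.
Variable phi : FN N -> FN N.
Hypotheses (n_gt0 : 0 < n) (phiM : {morph phi : u v / u * v}).
Hypotheses (phi_bij : bijective phi) (phi_pos : A_positive phi).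
Hypothesis phi_prim : primitive phi.

Definition raw_aut : seq signed_word :=
  [seq [seq (val l.1, l.2) | l <- fword (phi (gen i))] | i <- enum 'I_N].

Lemma encode_raw_aut : encode raw_aut = enc_aut phi.
Proof.
rewrite /enc_aut /encode /encoding_seq /raw_aut !enc_seq_map.
by apply: eq_enc_seq => i _ /=; rewrite enc_seq_map.
Qed.

Local Notation s := (subst_of raw_aut).

Lemma subst_ofE : s = [seq letters_of (phi (gen i)) | i <- enum 'I_N].
Proof. by rewrite /subst_of -map_comp; apply: eq_map => i /=;
  rewrite -map_comp. Qed.

Lemma size_subst_of : size s = N.
Proof. by rewrite subst_ofE size_map size_enum_ord. Qed.

Lemma nth_subst_of (i : 'I_N) : nth [::] s i = letters_of (phi (gen i)).
Proof.
by rewrite subst_ofE (nth_map ord0) ?size_enum_ord // nth_ord_enum.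
Qed.

Lemma phi_gen (i : 'I_N) :
  phi (gen i) = pure_word n false (nth [::] s i) /\ nth [::] s i != [::].
Proof.
have /andP[u1 up] := phi_pos i; rewrite nth_subst_of; split.
  by rewrite pure_word_letters //; apply: sub_all up => l /negPf ->.
apply: contra u1 => /eqP E; apply/eqP/val_inj => /=.
by move: E; case: (fword _).
Qed.

Lemma subst_of_nonerasing : nonerasing s.
Proof.
apply/(all_nthP [::]) => i; rewrite size_subst_of => iN.
have [_ ->] := phi_gen (Ordinal iN); rewrite andbT.
by rewrite (nth_subst_of (Ordinal iN)); apply: letters_of_inalph.
Qed.

Lemma phi_pw b x : inalph N x ->
  phi (pure_word n b x) = pure_word n b (sub (side_subst s b) x).
Proof.
have E1 : phi 1 = 1 by apply: (mulgI (phi 1)); rewrite -phiM !mulg1.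
have pos z : inalph N z -> phi (pure_word n false z) = pure_word n false (sub s z).
  elim: z => [|i z IHz]; first by rewrite pure_word_nil E1.
  case/andP=> iN Hz; rewrite -[i :: z]cat1s pure_word_cat phiM IHz //.
  rewrite cat1s sub_cons pure_word_cat; congr mul.
  have <- : gen (Ordinal iN) = pure_word n false [:: i] by rewrite gen_pw.
  by have [] := phi_gen (Ordinal iN).
case: b => Hx; last exact: pos.
have Ex : pure_word n true x =
  (pure_word n false (rev x))^-1 by rewrite pure_word_inv revK.
have V u : phi u^-1 = (phi u)^-1 by apply/esym/mulg1_eq; rewrite -phiM mulgV.
by rewrite Ex V pos ?/inalph ?all_rev // pure_word_inv sub_mirror.
Qed.

Lemma power_test_exists : exists k, power_test raw_aut k.
Proof.
have [k k0 H] := phi_prim; exists k; rewrite /power_test k0 /primitive_subst.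
rewrite size_subst_power size_subst_of ltnS n_gt0 /=.
have Hi (i : 'I_N) :
  iter k phi (gen i) = pure_word n false (iter k (sub s) [:: val i]).
  by rewrite gen_pw (endo_iter_pw subst_of_nonerasing size_subst_of phi_pw) // inalph_letter.
have Hin i : i < N -> inalph N (iter k (sub s) [:: i]).
  move=> iN; have := nonerasing_iter subst_of_nonerasing k;
    rewrite size_subst_of; apply.
  by rewrite /inalph /= iN.
have mem_p t : t \in subst_power s k ->
    exists2 i, i < N & t = iter k (sub s) [:: i].
  by case/mapP=> i; rewrite size_subst_of mem_iota /= add0n => iN ->; exists i.
apply/andP; split; apply/allP => t /mem_p[i iN ->].
  exact: Hin.
apply/allP => j; rewrite size_subst_power size_subst_of mem_iota /= add0n => jN.
have := H (Ordinal iN) (Ordinal jN); rewrite Hi => /mapP[j' j'i [E]];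
  have {E} := congr1 val E; rewrite /=.
have jN' : j' < N := allP (Hin _ iN) _ j'i.
by rewrite inordK // => ->.
Qed.

Variables (k L : nat).
Hypotheses (Hk : power_test raw_aut k) (HL : length_test (raw_aut, k) L).
Local Notation p := (subst_power s k).
Local Notation phik := (iter k phi).

Let k_gt0 : 0 < k. Proof. by case/andP: Hk. Qed.
Let Hp : primitive_subst p. Proof. by case/andP: Hk. Qed.
Let sizep : size p = N. Proof. by rewrite size_subst_power size_subst_of. Qed.

Let HLb b : cancel_length (side_subst p b) L.
Proof. by case/andP: HL => h1 h2; case: b. Qed.

Let phikM : {morph phik : u v / u * v}. Proof. exact: endo_iterM. Qed.

Lemma side_subst_power b x : inalph N x ->
  sub (side_subst p b) x = iter k (sub (side_subst s b)) x.
Proof.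
move=> Hx; case: b => /=; last by rewrite sub_subst_power ?size_subst_of.
by rewrite mirror_subst_power sub_subst_power // /mirror size_map size_subst_of.
Qed.

Let phik_pw b x : inalph N x ->
  phik (pure_word n b x) = pure_word n b (sub (side_subst p b) x).
Proof.
by move=> Hx; rewrite side_subst_power // (endo_iter_pw subst_of_nonerasing size_subst_of phi_pw).
Qed.

(** Passing to a power of [phi] changes neither the subshift nor the sets of
periodic points of the maps of which some power is considered. *)
Lemma singularityP Omega : singularity phi Omega <->
  exists w j, 0 < j /\ singular_for p (inner w \o iter j phik) Omega.
Proof.
have Sg P : attracting_subshift phi P <-> subshift_point p P.
  exact: (attracting_subshiftP subst_of_nonerasing size_subst_of phi_pw k_gt0 Hp).
have Ej j : iter j phik = iter (j * k) phi by apply: funext => u; rewrite iterM.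
have iterMf (psi : FN N -> FN N) h : iter h (iter k psi) = iter (h * k) psi.
  by apply: funext => u; rewrite iterM.
split=> [[sub_S _ [_ [w [j [j0 ->]]] [fO mO]] lettersO]|[w [j [j0 [gO lO fO mO]]]]].
  have [v Ev] := inner_iter_exists phiM w j k.
  exists v, j; split=> //; rewrite Ej -Ev.
  split=> // [P /sub_S/Sg //|P OP|h P h0 gP].
    apply: (fixes_iter subst_of_nonerasing size_subst_of phiM phi_pw);
      last exact: fO.
    by apply: (subshift_opposite (s := p)); apply/Sg/sub_S.
  rewrite iterMf; apply: mO; first by rewrite muln_gt0 h0.
  exact/Sg.
have [P [Q [OP OQ PQ]]] := lO.
split=> //; first by move=> R /gO/Sg.
  by exists P, Q; split=> // E; case: PQ; rewrite E.
exists (inner w \o iter j phik).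
  by exists w, (j * k)%N; rewrite muln_gt0 j0 k_gt0 Ej.
by split=> // h R h0 /Sg; apply: mO.
Qed.

Definition branching_descs b : seq (sdesc N) :=
  [seq branching_desc n k b (period_exp (side_subst p b) L) c.1 c.2 |
    c <- branchings (side_subst p b) L].

Definition letter_descs : seq (sdesc N) :=
  [seq d <- [:: letter_desc n k (letter_exp p) (letter_pairs p)] |
     has (fun x => has (fun y => ~~ ((x.1 == y.1) && (x.2 == y.2)))
       (letter_pairs p)) (letter_pairs p)].

Definition all_descs : seq (sdesc N) :=
  branching_descs false ++ branching_descs true ++ letter_descs.

Lemma enc_word_pw b x : inalph N x ->
  enc_word (pure_word n b x) = encode (sign_word b x).
Proof.
move=> Hx; rewrite /enc_word /encode /encoding_seq /= !enc_seq_map.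
apply: eq_enc_seq => i /(allP Hx) iN.
by rewrite /= /enc_letter /enc_pair /= inordK.
Qed.

Lemma encode_descs b :
  enc_seq (@enc_sdesc N) (branching_descs b) = encode (raw_descs b p k L).
Proof.
rewrite /encode /encoding_seq [LHS]enc_seq_map [RHS]enc_seq_map.
apply: eq_enc_seq => -[w vs] wvs /=; have Hb := primitive_side b Hp.
have [_ Hw El _] := branchingsP Hb (HLb b) wvs.
have Hw' : inalph N w by rewrite size_side_subst sizep in Hw.
have Hrw : inalph N (rev w) by rewrite /inalph all_rev.
congr (Node (Node _ _) _); first exact: enc_word_pw.
rewrite [LHS]enc_seq_map [RHS]enc_seq_map; apply: eq_enc_seq => v vl /=.
rewrite El in vl; have [[Hv _] _ _ _] := branches_return Hb (HLb b) vl.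
rewrite size_side_subst sizep in Hv.
by case: (b); congr (Node _ _); apply: enc_word_pw.
Qed.

Lemma encode_letter_descs :
  enc_seq (@enc_sdesc N) letter_descs = encode (raw_letter_descs p k).
Proof.
rewrite /letter_descs /raw_letter_descs /=; case: ifP => //= _.
congr (Node (Node (Node _ _) _) _).
rewrite [LHS]enc_seq_map [RHS]enc_seq_map.
apply: eq_enc_seq => -[x y] /(letter_pairsP Hp)[Lxy _ _].
have := lang_inalph Hp Lxy; rewrite sizep => /and3P[xN yN _].
have E b z : z < N ->
  enc_word (pure_word n b [:: z]) = enc_seq (enc_pair enc_nat enc_bool) [:: (z, b)].
  by move=> zN; apply: enc_word_pw; rewrite /inalph /= zN.
exact: (f_equal2 Node (E true x xN) (E false y yN)).
Qed.

Lemma encode_all_descs :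
  enc_seq (@enc_sdesc N) all_descs = encode (raw_output (raw_aut, k, L)).
Proof.
have ecat A B (e : A -> tree) (e' : B -> tree) u u' v v' :
    enc_seq e u = enc_seq e' u' -> enc_seq e v = enc_seq e' v' ->
    enc_seq e (u ++ v) = enc_seq e' (u' ++ v').
  move=> + Ev; elim: u u' => [|x u IHu] [|x' u'] //= [-> /IHu->//].
change (enc_seq (@enc_sdesc N) (branching_descs false ++ branching_descs true ++
  letter_descs) =
  enc_seq encode (raw_descs false p k L ++ raw_descs true p k L ++
    raw_letter_descs p k)).
apply: (ecat); first exact: (encode_descs false).
apply: ecat; first exact: (encode_descs true).
exact: encode_letter_descs.
Qed.

Lemma all_descs_valid : all (sdesc_valid phi) all_descs.
Proof.
have v b : all (sdesc_valid phi) (branching_descs b).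
  apply/allP => _ /mapP[[w vs] wvs ->].
  exact: (branching_desc_valid Hp sizep phikM phik_pw k_gt0 (erefl _) (HLb b) wvs).
rewrite /all_descs !all_cat !v /=; apply/allP => d.
rewrite mem_filter inE => /andP[_ /eqP->].
exact: (letter_desc_valid Hp sizep phik_pw k_gt0 (erefl _)).
Qed.

Lemma all_descs_singularities Omega : singularity phi Omega <->
  exists2 d, d \in all_descs & Omega = sdesc_points phi d.
Proof.
have pqE : forall x y : nat * nat, ~~ ((x.1 == y.1) && (x.2 == y.2)) = (x != y).
  by move=> [x1 x2] [y1 y2]; rewrite xpair_eqE.
split=> [/singularityP[w [j [j0 sO]]]|[d]].
  have [[x [y [xl yl xy ->]]]|[b]] :=
    singular_complete Hp sizep phikM phik_pw (erefl _) j0 sO.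
    exists (letter_desc n k (letter_exp p) (letter_pairs p)) => //.
    rewrite !mem_cat mem_filter inE eqxx andbT; apply/orP; right; apply/orP; right.
    by apply/hasP; exists x => //; apply/hasP; exists y => //; rewrite pqE.
  case/(_ L (HLb b)) => w1 [vs [wvs ->]].
  exists (branching_desc n k b (period_exp (side_subst p b) L) w1 vs) => //.
  have inb : branching_desc n k b (period_exp (side_subst p b) L) w1 vs \in branching_descs b.
    by apply/mapP; exists (w1, vs).
  by rewrite !mem_cat; case: b inb wvs => -> _; rewrite ?orbT.
rewrite !mem_cat => dA ->; apply/singularityP.
have sb b : d \in branching_descs b -> exists w j, 0 < j /\
    singular_for p (inner w \o iter j phik) (sdesc_points phi d).
  case/mapP=> -[w vs] wvs ->; do 2!eexists; split; last first.
    exact: (branching_desc_singular Hp sizep phikM phik_pw (erefl _) (HLb b) wvs).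
  exact: period_exp_gt0.
case/or3P: dA => [/sb //|/sb //|].
rewrite mem_filter inE => /andP[/hasP[x xl /hasP[y yl]]]; rewrite pqE => xy /eqP->.
do 2!eexists; split; last first.
  exact: (letter_desc_singular Hp sizep phikM phik_pw (erefl _) xl yl xy).
exact: fact_gt0.
Qed.

End Input.

Theorem theorem0p2 :
  exists algo : prog,
    forall (N : nat) (phi : {multiplicative FN N -> FN N}),
      1 < N -> bijective phi -> A_positive phi -> primitive phi ->
      exists L : seq (sdesc N),
        [/\ runs algo (enc_aut phi) (enc_seq (@enc_sdesc N) L),
            all (sdesc_valid phi) L &
            forall Omega : set (bd N * bd N),
              singularity phi Omega <->
              exists2 d, d \in L & Omega = sdesc_points phi d].
Proof.
have [algo Halgo] := algorithm_exists;
  exists algo => -[//|n] phi n_gt0 bij pos prim.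
have phiM : {morph phi : u v / u * v} by move=> u v; rewrite gmulfM.
have [|k Hk|k [L [Hk HL run]]] := Halgo (raw_aut phi).
- exact: (power_test_exists n_gt0 phiM pos prim).
- have [psi phiK psiK] := bij; have Hp := andP Hk.
  have sz := size_subst_of phi; have ne := subst_of_nonerasing pos.
  have kK : cancel (iter k phi) (iter k psi).
    by elim: (k) => // j IHj u; rewrite iterSr iterS phiK IHj.
  have kK' : cancel (iter k psi) (iter k phi).
    by elim: (k) => // j IHj u; rewrite iterSr iterS psiK IHj.
  apply: (cancel_length_exists Hp.2 _ (endo_iterM phiM k) kK kK').
    by rewrite size_subst_power sz.
  move=> b x Hx; rewrite (endo_iter_pw ne sz (phi_pw phiM pos)) //.
  by rewrite side_subst_power.
exists (all_descs phi k L); split.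
- by rewrite -encode_raw_aut (encode_all_descs Hk HL).
- exact: (all_descs_valid phiM pos Hk HL).
- exact: (all_descs_singularities phiM pos Hk HL).
Qed.
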